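(* There exist universal constants $c, C, C' > 0$ such that the following holds along every sequence of triples $(n,N,m)$ with $n, N, m\to\infty$, for all sufficiently large indices in the sequence, for any $\epsilon \in (0,1)$ and $\alpha > 0$: (i) If $\beta = o(1)$, then with probability at least $1 - \epsilon^{-2} e^{-c\log m} - 2e^{-cn\epsilon^2} - C' n^{-\alpha}$, we have $$\big| \log s_1(X) - Z \big| \;\le\; C\Big(\frac{\epsilon}{1-\epsilon} + \frac{\beta^2\log m}{n}\Big) + \frac{(1+2\alpha)\log n}{2}.$$ (ii) If $\beta = \Omega(1)$, $\log m = o(N^{1/3})$ and $N = o(n^3)$, then with probability at least $1 - (1+\epsilon^{-2})e^{-c(\log m)^{3/4}} - 2e^{-cn\epsilon^2} - C' n^{-\alpha/2}$, we have $$\frac{1}{\beta^2\log m}\big| \log s_1(X) - Z \big| \;\le\; C\Big(\frac{\epsilon}{(1-\epsilon)\,\beta\log m} + \frac{1}{\beta(\log m)^{1/4}}\Big) + \frac{(1+2\alpha)\log n}{2\beta^2\log m}.$$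
   Context: For integers $n, N, m$, let $X_{ij}$ ($1\le i\le m$, $1\le j\le N$) be i.i.d. random $n\times n$ real matrices, each with i.i.d. $\mathcal{N}(0, n^{-1})$ entries, and set $$X := \frac{1}{\sqrt m}\sum_{i=1}^m X_i, \qquad X_i := X_{iN}X_{i(N-1)}\cdots X_{i1}.$$ $s_1(X)=\sup_{\theta\in\mathcal{S}^{n-1}}\|X\theta\|$ is the largest singular value of $X$, where $\mathcal{S}^{n-1}\subset\mathbb{R}^n$ is the Euclidean unit sphere and $\|\cdot\|$ the Euclidean norm. Define $$\beta := \frac{\sqrt{2(N-1)}}{\sqrt{n\log m}}, \qquad Z := \begin{cases} 0 & \text{if } \beta\le\sqrt2,\\ -\dfrac{(\beta-\sqrt2)^2}{4}\,\log m & \text{if } \beta>\sqrt2.\end{cases}$$ Asymptotic convention: $n, N, m\to\infty$ simultaneously (along a sequence), and $o(\cdot)$, $\Omega(\cdot)$ refer to this limit; thus $\beta=o(1)$ means $\beta\to0$ along the sequence, and $\beta=\Omega(1)$ means $\beta$ is bounded below by a positive constant along the sequence. ''Sufficiently large'' is uniform in $\epsilon$ and $\alpha$. *)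

(* Defs.v *)
From HB Require Import structures.
From mathcomp Require Import all_boot all_order all_algebra.
From mathcomp Require Import all_classical all_reals all_analysis.

Set Implicit Arguments.
Unset Strict Implicit.
Unset Printing Implicit Defensive.

Import Order.TTheory GRing.Theory Num.Theory.
Import numFieldNormedType.Exports.

Local Open Scope classical_set_scope.
Local Open Scope ring_scope.

(* The norm on ''cV[R]_n' provided by the library is the sup norm. *)
Definition enorm (R : realType) (n : nat) (v : 'cV[R]_n) : R :=
  Num.sqrt (\sum_(i < n) v i 0 ^+ 2).

Definition unit_sphere (R : realType) (n : nat) : set 'cV[R]_n :=
  [set v | enorm v = 1].

Definition s1 (R : realType) (n : nat) (A : 'M[R]_n) : R :=
  sup [set enorm (A *m v) | v in @unit_sphere R n].

Definition mutually_independent d (T : measurableType d) (R : realType)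
    (P : probability T R) (I : finType) (X : I -> {RV P >-> R}) : Prop :=
  forall (J : {set I}) (B : I -> set R),
    (forall i, measurable (B i)) ->
    P (\bigcap_(i in [set` J]) (X i @^-1` B i)) =
    (\prod_(i in J) P (X i @^-1` B i))%E.

(* 'X i j a b' is the entry (a, b) of the matrix 'X_{(i+1)(j+1)}'.  Since the
   matrices are independent and each has independent entries, all the entries
   are jointly independent.  The second parameter of 'normal_prob' is the
   standard deviation. *)
Definition iid_gaussian_entries d (T : measurableType d) (R : realType)
    (P : probability T R) (n N m : nat)
    (X : 'I_m -> 'I_N -> 'I_n -> 'I_n -> {RV P >-> R}) : Prop :=
  mutually_independent
    (fun k : 'I_m * 'I_N * ('I_n * 'I_n) => X k.1.1 k.1.2 k.2.1 k.2.2) /\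
  forall i j a b (B : set R), measurable B ->
    distribution P (X i j a b) B =
    normal_prob 0 (Num.sqrt (n%:R^-1)) B.

Definition random_mx d (T : measurableType d) (R : realType)
    (P : probability T R) (n : nat) (X : 'I_n -> 'I_n -> {RV P >-> R})
    (w : T) : 'M[R]_n :=
  \matrix_(a, b) X a b w.

(* 'rev_ord' puts the factor of largest index leftmost. *)
Definition mx_chain (R : realType) (n N : nat) (A : 'I_N -> 'M[R]_n) : 'M[R]_n :=
  \big[mulmx/1%:M]_(j < N) A (rev_ord j).

Definition sum_of_products d (T : measurableType d) (R : realType)
    (P : probability T R) (n N m : nat)
    (X : 'I_m -> 'I_N -> 'I_n -> 'I_n -> {RV P >-> R}) (w : T) : 'M[R]_n :=
  (Num.sqrt m%:R)^-1 *:
    \sum_(i < m) mx_chain (fun j => random_mx (X i j) w).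

Definition beta (R : realType) (n N m : nat) : R :=
  Num.sqrt (2 * (N%:R - 1)) / Num.sqrt (n%:R * ln m%:R).

Definition Zlim (R : realType) (n N m : nat) : R :=
  let b := beta R n N m in
  if b <= Num.sqrt 2 then 0 else - ((b - Num.sqrt 2) ^+ 2 / 4 * ln m%:R).

(* The logarithm is extended-real valued, with value -oo at 0. *)
Definition log_s1_dev d (T : measurableType d) (R : realType)
    (P : probability T R) (n N m : nat)
    (X : 'I_m -> 'I_N -> 'I_n -> 'I_n -> {RV P >-> R}) (w : T) : \bar R :=
  `|lne (s1 (sum_of_products X w))%:E - (Zlim R n N m)%:E|%E.

(* Main.v *)
(* Conditionally on the first [N - 1] factors of each product, [X theta] is a
   Gaussian vector with variance [S / n] per entry, where [S] is the average
   over [i] of the squared norms [V i] of the partial products applied to the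
   unit vector [theta].  Each [V i] is a product of [N - 1] independent
   normalised chi-square variables, so that [E (V i ^ p)] is
   [exp (- p (1 - p) beta^2 (log m) / 2)] up to an error [O(p N / n^2)] in the
   exponent.

   Upper bound: Khintchine's inequality over the sign vectors bounds the power
   [2p] of [s1 X] by an average of [|X h|^(2p)], and subadditivity of [x ^ p]
   bounds the [p]-th moment of [S] by [m^(1-p) E (V ^ p)]; the optimal exponent
   is [p = min (1, sqrt 2 / beta)], and Markov's inequality concludes.

   Lower bound: a Gaussian vector is rarely small, so [S] has to be bounded
   below.  For [beta = o(1)] the [V i] have bounded second moments and
   Chebyshev's inequality applies.  Otherwise it is applied to the number of
   indices [i] such that [V i] reaches the level that dominates the moment of
   order [q], with [q] slightly below [p], for which this number has a large
   mean. *)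
Require Import Defs.
From HB Require Import structures.
From mathcomp Require Import all_boot all_order all_algebra.
From mathcomp Require Import all_classical all_reals all_analysis.
From mathcomp Require Import measurable_realfun ring lra.
Import Order.TTheory GRing.Theory Num.Theory.
Import numFieldNormedType.Exports.
Local Open Scope classical_set_scope.
Local Open Scope ring_scope.

Set Implicit Arguments.
Unset Strict Implicit.

(** * Gaussian integrals *)

(** A union bound over a net of the sphere costs a factor exponential in [n], while the statement
    only allows a loss of order [log n]. Averaging over sign vectors costs the constant of
    Khintchine's inequality and the factor [n^p] from their squared norm [n], which Markov's
    inequality absorbs at a level raised by [n^(1 + 2 alpha)]. From below, one coordinate of the
    image of one unit vector suffices.

    For large [beta] the exponent [p] is small, and turning a moment bound into a bound on [log s1]
    divides by [p]; the error in the logarithm of a chi-square moment must therefore be proportional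
    to [p]. This is why [x^p] is compared with combinations of exponentials that agree with it to
    third order at [1] and whose coefficients, apart from a constant [1], are multiples of [p];
    their means are explicit. The comparison from below fails near [0], an event of exponentially
    small probability, absorbed because [p >= 1 / n].

    Conditioning is replaced by resampling: a block of entries is read at an independent second
    sample point, and Tonelli's theorem yields an iterated integral. *)

Section density.
Context (d : measure_display) (T : measurableType d) (R : realType)
  (mu nu : {measure set T -> \bar R}) (g : T -> R).
Hypothesis mg : measurable_fun setT g.
Hypothesis g0 : forall x, 0 <= g x.
Hypothesis nuE : forall A, measurable A -> nu A = (\int[mu]_(x in A) (g x)%:E)%E.
Local Open Scope ereal_scope.
Import HBNNSimple.

Let integral_density_indic A : measurable A ->
  \int[nu]_x (\1_A x)%:E = \int[mu]_x ((\1_A x)%:E * (g x)%:E).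
Proof.
move=> mA; rewrite integral_indic//= setIT nuE// integral_mkcond/=.
apply: eq_integral => x _; rewrite patchE indicE.
by case: ifPn => _; rewrite ?mul1e ?mul0e.
Qed.

Let integral_density_nnsfun (f : {nnsfun T >-> R}) :
  \int[nu]_x (f x)%:E = \int[mu]_x ((f x)%:E * (g x)%:E).
Proof.
have g0' x : 0 <= (g x)%:E by rewrite lee_fin.
under [LHS]eq_integral do rewrite fimfunE -fsumEFin//.
rewrite [LHS]ge0_integral_fsum//; last 2 first.
  - by move=> r; exact/measurable_EFinP/measurableT_comp.
  - by move=> n x _; rewrite EFinM nnfun_muleindic_ge0.
under [RHS]eq_integral.
  move=> x xD; rewrite fimfunE -fsumEFin// muleC ge0_mule_fsumr; last first.
    by move=> r; rewrite EFinM nnfun_muleindic_ge0.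
  over.
have mr r : measurable_fun setT (fun x => (r * \1_(f @^-1` [set r]) x)%:E).
  by apply/measurable_EFinP; do 2 apply/measurableT_comp => //.
rewrite [RHS]ge0_integral_fsum//; last 2 first.
  - move=> r; apply: emeasurable_funM; first exact/measurable_EFinP.
    exact: mr.
  - by move=> n x _; rewrite EFinM mule_ge0// nnfun_muleindic_ge0.
apply: eq_fsbigr => r _; rewrite integralZl_indic_nnsfun//=.
rewrite integral_density_indic//.
have [r0|r0] := leP 0%R r.
  rewrite -ge0_integralZl//.
  - by apply: eq_integral => x _; rewrite -!EFinM; congr (_%:E); ring.
  - apply: emeasurable_funM; first exact/measurable_EFinP/measurable_indic.
    exact/measurable_EFinP.
  - by move=> x _; rewrite mule_ge0// lee_fin.
have -> : f @^-1` [set r] = set0.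
  rewrite -subset0 => x /= fx; have : (0 <= f x)%R by exact: fun_ge0.
  by rewrite fx leNgt r0.
under eq_integral do rewrite indic0 mul0e.
under [RHS]eq_integral do rewrite indic0 mulr0 mule0.
by rewrite !integral0 mule0.
Qed.

(** Passes from indicators to simple functions, then to monotone limits. It serves to rewrite
    integrals against [normal_prob] as Lebesgue integrals. *)
Lemma ge0_integral_density (f : T -> \bar R) : measurable_fun setT f ->
  (forall x, 0 <= f x) -> \int[nu]_x f x = \int[mu]_x (f x * (g x)%:E).
Proof.
move=> mf f0.
have g0' x : 0 <= (g x)%:E by rewrite lee_fin.
pose f_ := nnsfun_approx measurableT mf.
transitivity (lim (\int[nu]_x (f_ n x)%:E @[n --> \oo])).
  rewrite -monotone_convergence//=.
  - apply: eq_integral => ? /[!inE] xD; apply/esym/cvg_lim => //=.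
    exact: cvg_nnsfun_approx.
  - by move=> n; exact/measurable_EFinP/measurable_funTS.
  - by move=> n ? _; rewrite lee_fin.
  - by move=> ? _ ? ? mn; rewrite lee_fin; exact/lefP/nd_nnsfun_approx.
under eq_fun do rewrite integral_density_nnsfun.
rewrite -monotone_convergence//=.
- apply: eq_integral => x /[!inE] xD; apply/cvg_lim => //.
  by apply: cvgeZr => //; exact: cvg_nnsfun_approx.
- move=> n; apply: emeasurable_funM; exact/measurable_EFinP/measurable_funTS.
- by move=> n x _; rewrite mule_ge0// lee_fin.
- move=> x _ a b ab; rewrite lee_wpmul2r// lee_fin.
  exact/lefP/nd_nnsfun_approx.
Qed.

End density.

Lemma complete_square (R : realFieldType) (s t c D u y : R) :
  s != 0 -> D != 0 -> t * c ^+ 2 * s ^+ 2 = D - 1 ->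
  - (t / 2 * (u + c * y) ^+ 2) - y ^+ 2 / (s ^+ 2 * 2) =
  - (t / D / 2 * u ^+ 2) -
    (y + t * u * c * s ^+ 2 / D) ^+ 2 / (s ^+ 2 / D * 2).
Proof.
move=> s0 D0 E.
have -> : (y + t * u * c * s ^+ 2 / D) ^+ 2 / (s ^+ 2 / D * 2) =
  D * y ^+ 2 / (s ^+ 2 * 2) + t * u * c * y + t * u ^+ 2 * (t * c ^+ 2 * s ^+ 2) / (2 * D).
  by field; rewrite s0 D0.
have -> : D * y ^+ 2 / (s ^+ 2 * 2) = y ^+ 2 / (s ^+ 2 * 2) + t * c ^+ 2 / 2 * y ^+ 2.
  have -> : D = t * c ^+ 2 * s ^+ 2 + 1 by rewrite E subrK.
  by field; rewrite s0.
by rewrite E; field; rewrite D0.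
Qed.

(* Completing the square turns the integrand into a multiple of another
   Gaussian density; this is the only Gaussian integral needed. *)
Lemma integral_normal_expR_sqr (R : realType) (s t u c : R) :
  0 < s -> 0 < 1 + t * c ^+ 2 * s ^+ 2 ->
  (\int[normal_prob 0 s]_y (expR (- (t / 2 * (u + c * y) ^+ 2)))%:E =
   ((Num.sqrt (1 + t * c ^+ 2 * s ^+ 2))^-1 *
     expR (- (t / (1 + t * c ^+ 2 * s ^+ 2) / 2 * u ^+ 2)))%:E)%E.
Proof.
move=> s0; set D := 1 + _ => D0.
have hD : t * c ^+ 2 * s ^+ 2 = D - 1 by rewrite /D addrAC subrr add0r.
clearbody D.
have sn0 : s != 0 by rewrite gt_eqF.
have Dn0 : D != 0 by rewrite gt_eqF.
rewrite (@ge0_integral_density _ _ _ lebesgue_measure _ (normal_pdf 0 s)).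
- pose s' := s / Num.sqrt D.
  have sD0 : 0 < Num.sqrt D by rewrite sqrtr_gt0.
  have sD2 : Num.sqrt D ^+ 2 = D by rewrite sqr_sqrtr// ltW.
  have s'0 : 0 < s' by rewrite divr_gt0.
  have s'2 : s' ^+ 2 = s ^+ 2 / D by rewrite expr_div_n sD2.
  pose m := - (t * u * c * s ^+ 2) / D.
  pose q := (Num.sqrt D)^-1 * expR (- (t / D / 2 * u ^+ 2)).
  have pk : normal_peak s = (Num.sqrt D)^-1 * normal_peak s'.
    rewrite /normal_peak s'2 -invfM; congr (_^-1).
    rewrite -sqrtrM; last exact: ltW.
    by congr (Num.sqrt _); rewrite !mulr2n; field.
  have pdfE (y : R) : expR (- (t / 2 * (u + c * y) ^+ 2)) * normal_pdf 0 s y =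
      q * normal_pdf m s' y.
    rewrite normal_pdfE// normal_pdfE ?gt_eqF// /normal_fun pk /q mulrCA -expRD.
    have := complete_square u y sn0 Dn0 hD.
    rewrite s'2 /m subr0 !mulNr opprK -!(mulr_natr (_ ^+ 2)) => ->.
    by rewrite mulr_natr expRD; ring.
  transitivity (\int[lebesgue_measure]_y (q%:E * (normal_pdf m s' y)%:E))%E.
    by apply: eq_integral => y _; rewrite -!EFinM pdfE.
  rewrite integralZl//; last exact: integrable_normal_pdf.
  by rewrite integral_normal_pdf mule1.
- exact: measurable_normal_pdf.
- by move=> x; exact: normal_pdf_ge0.
- by [].
- apply/measurable_EFinP/measurableT_comp => //.
  apply/measurableT_comp => //; apply/measurable_funM => //.
  by apply/measurable_funX/measurable_funD => //; exact: measurable_funM.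
- by move=> x; rewrite lee_fin expR_ge0.
Qed.

(** The boxes form a pi-system on which mutual independence gives the joint law as a product;
    configurations carry the sigma-algebra that they generate. *)
Definition boxes (K : finType) (R : realType) : set (set (K -> R)) :=
  [set A | exists2 B : K -> set R, forall k, measurable (B k) &
    A = [set x | forall k, B k (x k)]].
Notation config K R := (g_sigma_algebraType (@boxes K R)).

(** * Resampling blocks of independent coordinates *)

Section config.
Context (K : finType) (R : realType).

Lemma setI_closed_boxes : setI_closed (@boxes K R).
Proof.
move=> _ _ [B mB ->] [C mC ->]; exists (fun k => B k `&` C k).
  by move=> k; exact: measurableI.
by apply/seteqP; split=> [x [Bx Cx] k|x BCx]; split => // k; case: (BCx k).
Qed.

Lemma boxesT : @boxes K R setT.
Proof. by exists (fun=> setT) => //; apply/seteqP; split. Qed.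

Lemma measurable_coord (k : K) : measurable_fun setT (fun x : config K R => x k).
Proof.
move=> _ B mB; rewrite setTI; apply: sub_sigma_algebra.
exists (fun j => if j == k then B else setT).
  by move=> j; case: ifP.
apply/seteqP; split=> [x Bx j|x /(_ k)]; last by rewrite eqxx.
by case: eqP => // ->.
Qed.

Lemma preimage_box (T : Type) (f : T -> config K R) (B : K -> set R) :
  f @^-1` [set x | forall k, B k (x k)] =
  \bigcap_(k in [set: K]) ((fun w => f w k) @^-1` B k).
Proof. by apply/seteqP; split=> w fw k //=; exact: fw. Qed.

Lemma measurable_config d (T : measurableType d) (f : T -> config K R) :
  (forall k, measurable_fun setT (fun w => f w k)) -> measurable_fun setT f.
Proof.
move=> mf; apply: (@measurability _ _ _ _ setT f (@boxes K R)) => //.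
move=> _ [_ [B mB ->] <-]; rewrite setTI preimage_box.
apply: fin_bigcap_measurable => // k _.
by rewrite -[X in measurable X]setTI; exact: mf.
Qed.

End config.

Section block_resampling.
Context (d : measure_display) (T : measurableType d) (R : realType)
  (P : probability T R) (K : finType) (X : K -> {RV P >-> R}).
Hypothesis indepX : mutually_independent X.

Definition sample (w : T) : config K R := fun k => X k w.

Definition mix (B : pred K) (w w' : T) : config K R :=
  fun k => if B k then X k w' else X k w.

Lemma measurable_sample : measurable_fun setT sample.
Proof. by apply: measurable_config => k; exact: measurable_funP. Qed.

Lemma measurable_mix B : measurable_fun setT (fun z : T * T => mix B z.1 z.2).
Proof.
apply: measurable_config => k; rewrite /mix; case: (B k).
  exact: measurableT_comp.
exact: measurableT_comp.
Qed.

Lemma probability_box (B : K -> set R) : (forall k, measurable (B k)) ->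
  P (sample @^-1` [set x | forall k, B k (x k)]) =
  (\prod_(k : K) P (X k @^-1` B k))%E.
Proof.
move=> mB; have := @indepX [set: K]%SET B mB.
rewrite (eq_bigl xpredT); last by move=> k; rewrite finset.in_setT.
move=> <-; rewrite preimage_box; congr (P _).
by apply/seteqP; split=> w h k /= _; apply: h; rewrite //= finset.in_setT.
Qed.

(** On a box both sides factor into the same product over [K]: in the product measure, the
    coordinates outside [B] constrain the first point and those in [B] the second. Boxes are stable
    under intersection, hence determine the measure. *)
Lemma law_mix (B : pred K) (A : set (config K R)) : measurable A ->
  P (sample @^-1` A) = (P \x P)%E ((fun z => mix B z.1 z.2) @^-1` A).
Proof.
move=> mA.
pose m1 : {measure set (config K R) -> \bar R} :=
  measure_function_pushforward__canonical__measure_function_Measure P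
    measurable_sample.
pose m2 : {measure set (config K R) -> \bar R} :=
  measure_function_pushforward__canonical__measure_function_Measure (P \x P)%E
    (measurable_mix B).
change (m1 A = m2 A).
apply: (@measure_unique _ R (config K R) (@boxes K R) (fun=> setT) erefl
  (@setI_closed_boxes K R) (fun=> @boxesT K R) _ m1 m2) => //.
- exact: bigcup_const.
- move=> _ [C mC ->]; rewrite /m1/= /m2/= /pushforward probability_box//.
  have -> : (fun z => mix B z.1 z.2) @^-1` [set x | forall k, C k (x k)] =
    (sample @^-1` [set x | forall k, (if B k then setT else C k) (x k)]) `*`
    (sample @^-1` [set x | forall k, (if B k then C k else setT) (x k)]).
    apply/seteqP; split=> [[w w'] /= h|[w w'] /= [h1 h2]].
      by split=> k; move: (h k); rewrite /mix /sample; case: (B k).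
    by move=> k; move: (h1 k) (h2 k); rewrite /mix /sample; case: (B k).
  have mb C' : (forall k, measurable (C' k)) ->
      measurable (sample @^-1` [set x | forall k, C' k (x k)]).
    move=> mC'; have mS : measurable ([set x | forall k, C' k (x k)] : set (config K R)).
      by apply: sub_sigma_algebra; exists C'.
    by have := measurable_sample measurableT mS; rewrite setTI.
  have mC1 k : measurable (if B k then setT else C k) by case: ifP.
  have mC2 k : measurable (if B k then C k else setT) by case: ifP.
  rewrite product_measure1E; [|exact: (mb _ mC1)|exact: (mb _ mC2)].
  apply: (etrans _ (esym (congr2 mule (probability_box mC1) (probability_box mC2)))).
  rewrite -big_split/=; apply: eq_bigr => k _.
  by case: (B k); rewrite !preimage_setT !probability_setT ?mule1 ?mul1e.
- by move=> k; rewrite /m1/= /pushforward preimage_setT probability_setT ltry.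
Qed.

(** Plays the role of conditional expectation: the inner integral averages over the coordinates in
    [B] while the others stay frozen at [w]. *)
Lemma integral_resample (B : pred K) (f : config K R -> \bar R) :
  measurable_fun setT f -> (forall x, 0 <= f x)%E ->
  (\int[P]_w f (sample w) = \int[P]_w \int[P]_w' f (mix B w w'))%E.
Proof.
move=> mf f0.
have mmix := measurable_mix B.
rewrite -(@fubini_tonelli1 _ _ _ _ _ P P (fun z => f (mix B z.1 z.2)))//; last first.
  exact: measurableT_comp.
transitivity (\int[pushforward P sample]_x f x)%E.
  by rewrite ge0_integral_pushforward//; exact: measurable_sample.
transitivity (\int[pushforward (P \x P)%E (fun z => mix B z.1 z.2)]_x f x)%E.
  apply: eq_measure_integral; first exact: measurable_sample.
  by move=> ? A mA _; exact: law_mix.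
by rewrite ge0_integral_pushforward.
Qed.

End block_resampling.

Definition depends_on (K : Type) (R U : Type) (B : pred K) (f : (K -> R) -> U) :=
  forall x y, (forall k, B k -> x k = y k) -> f x = f y.

Section gaussian_sample.
Context (d : measure_display) (T : measurableType d) (R : realType)
  (P : probability T R) (K : finType) (X : K -> {RV P >-> R}).
Hypothesis indepX : mutually_independent X.

Definition mean (f : config K R -> R) : \bar R :=
  (\int[P]_w (f (sample X w))%:E)%E.

Lemma measurable_sampled (f : config K R -> R) : measurable_fun setT f ->
  measurable_fun setT (fun w => (f (sample X w))%:E).
Proof.
move=> mf; apply/measurable_EFinP.
by apply: (measurableT_comp mf); exact: measurable_sample.
Qed.

Lemma mean_ge0 (f : config K R -> R) : (forall x, 0 <= f x) -> (0 <= mean f)%E.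
Proof. by move=> f0; apply: integral_ge0 => w _; rewrite lee_fin. Qed.

Lemma eq_mean (f g : config K R -> R) : f =1 g -> mean f = mean g.
Proof. by move=> fg; congr mean; exact/funext. Qed.

Lemma mean_cst (c : R) : mean (fun=> c) = c%:E.
Proof. by rewrite /mean integral_cst// -[RHS]mule1; congr (_ * _)%E; exact: probability_setT. Qed.

Lemma le_mean (f g : config K R -> R) :
  measurable_fun setT f -> measurable_fun setT g ->
  (forall x, 0 <= f x) -> (forall x, f x <= g x) -> (mean f <= mean g)%E.
Proof.
move=> mf mg f0 fg; apply: ge0_le_integral => //.
- by move=> w _; rewrite lee_fin.
- exact: measurable_sampled.
- exact: measurable_sampled.
- by move=> w _; rewrite lee_fin.
Qed.

Lemma meanD (f g : config K R -> R) :
  measurable_fun setT f -> measurable_fun setT g ->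
  (forall x, 0 <= f x) -> (forall x, 0 <= g x) ->
  mean (fun x => f x + g x) = (mean f + mean g)%E.
Proof.
move=> mf mg f0 g0; rewrite /mean; under eq_integral do rewrite EFinD.
rewrite ge0_integralD//; try exact: measurable_sampled.
- by move=> w _; rewrite lee_fin.
- by move=> w _; rewrite lee_fin.
Qed.

Lemma meanZ (c : R) (f : config K R -> R) : 0 <= c ->
  measurable_fun setT f -> (forall x, 0 <= f x) ->
  mean (fun x => c * f x) = (c%:E * mean f)%E.
Proof.
move=> c0 mf f0; rewrite /mean; under eq_integral do rewrite EFinM.
rewrite ge0_integralZl//; try exact: measurable_sampled.
by move=> w _; rewrite lee_fin.
Qed.

Lemma mean_sum (I : Type) (r : seq I) (f : I -> config K R -> R) :
  (forall i, measurable_fun setT (f i)) -> (forall i x, 0 <= f i x) ->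
  mean (fun x => \sum_(i <- r) f i x) = (\sum_(i <- r) mean (f i))%E.
Proof.
move=> mf f0; elim: r => [|i r ih].
  by rewrite big_nil -[RHS]mean_cst; apply: eq_mean => x; rewrite big_nil.
rewrite big_cons -ih -meanD//.
- by apply: eq_mean => x; rewrite big_cons.
- exact: measurable_sum.
- by move=> x; exact: sumr_ge0.
Qed.

Definition splice (B : pred K) (y x : config K R) : config K R :=
  fun k => if B k then x k else y k.

Lemma measurable_splice B y : measurable_fun setT (splice B y).
Proof.
apply: measurable_config => k; rewrite /splice; case: (B k) => //.
exact: measurable_coord.
Qed.

Lemma mean_splice (B : pred K) (f : config K R -> R) :
  measurable_fun setT f -> (forall x, 0 <= f x) ->
  mean f = (\int[P]_w mean (fun x => f (splice B (sample X w) x)))%E.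
Proof.
move=> mf f0; rewrite /mean (integral_resample indepX B (f := fun x => (f x)%:E))//.
exact/measurable_EFinP.
Qed.

Let measurable_mean_splice (B : pred K) (f : config K R -> R) :
  measurable_fun setT f -> (forall x, 0 <= f x) ->
  measurable_fun setT (fun w => mean (fun x => f (splice B (sample X w) x))).
Proof.
move=> mf f0.
have mF : measurable_fun setT (fun z : T * T => (f (mix X B z.1 z.2))%:E).
  by apply/measurable_EFinP; apply: (measurableT_comp mf); exact: measurable_mix.
by apply: (measurable_fun_fubini_tonelli_F _ mF) => z; rewrite lee_fin.
Qed.

(** Tower property as an inequality: a bound on the mean over the block, valid for every frozen [y],
    is integrated over [y]. *)
Lemma mean_splice_le (B : pred K) (f g : config K R -> R) :
  measurable_fun setT f -> measurable_fun setT g ->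
  (forall x, 0 <= f x) ->
  (forall y, (mean (fun x => f (splice B y x)) <= (g y)%:E)%E) ->
  (mean f <= mean g)%E.
Proof.
move=> mf mg f0 fg; rewrite (@mean_splice B f)//; apply: ge0_le_integral => //.
- by move=> w _; exact: mean_ge0.
- exact: measurable_mean_splice.
- exact: measurable_sampled.
Qed.

Lemma mean_splice_ge (B : pred K) (f g : config K R -> R) :
  measurable_fun setT f -> measurable_fun setT g ->
  (forall x, 0 <= f x) -> (forall x, 0 <= g x) ->
  (forall y, ((g y)%:E <= mean (fun x => f (splice B y x)))%E) ->
  (mean g <= mean f)%E.
Proof.
move=> mf mg f0 g0 fg; rewrite (@mean_splice B f)//; apply: ge0_le_integral => //.
- by move=> w _; rewrite lee_fin.
- exact: measurable_sampled.
- exact: measurable_mean_splice.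
Qed.

(** Resampling [B] freezes [g], which leaves the inner integral, while [f] only sees fresh
    coordinates. *)
Lemma mean_mul_indep (B : pred K) (f g : config K R -> R) :
  measurable_fun setT f -> measurable_fun setT g ->
  (forall x, 0 <= f x) -> (forall x, 0 <= g x) ->
  depends_on B f -> depends_on (predC B) g ->
  mean (fun x => f x * g x) = (mean f * mean g)%E.
Proof.
move=> mf mg f0 g0 df dg.
rewrite (mean_splice B) => [||x]; last 2 first.
- exact: measurable_funM.
- by rewrite mulr_ge0.
transitivity (\int[P]_w ((g (sample X w))%:E * mean f))%E.
  apply: eq_integral => w _; rewrite -meanZ//; apply: eq_integral => w' _.
  rewrite mulrC; congr (_ * _)%:E.
    by apply: dg => k /negbTE Bk; rewrite /splice /sample Bk.
  by apply: df => k Bk; rewrite /splice /sample Bk.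
rewrite ge0_integralZr//; first by rewrite muleC.
- exact: measurable_sampled.
- by move=> w _; rewrite lee_fin.
- exact: mean_ge0.
Qed.

Variable s : R.
Hypothesis s0 : 0 < s.
Hypothesis lawX : forall k B, measurable B ->
  distribution P (X k) B = normal_prob 0 s B.

Variables (J : eqType) (co : J -> K) (a : J -> R).

Definition linear_form (r : seq J) (x : K -> R) : R :=
  \sum_(j <- r) a j * x (co j).

Lemma measurable_linear_form r :
  measurable_fun setT (linear_form r : config K R -> R).
Proof.
apply: measurable_sum => j; apply: measurable_funM => //.
exact: measurable_coord.
Qed.

(** Integrating out the coordinate [co k] replaces [t] by [t / c] with [c = 1 + t a_k^2 s^2], and
    the factors telescope: [c] times the quantity under the root for the remaining sum is the one
    for the whole sum. A negative [t] is allowed and yields exponential moments; the positivity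
    hypothesis is then the condition for finiteness. *)
Lemma mean_expR_sqr (r : seq J) (t : R) : uniq (map co r) ->
  0 < 1 + t * (s ^+ 2 * \sum_(j <- r) a j ^+ 2) ->
  mean (fun x => expR (- (t / 2 * linear_form r x ^+ 2))) =
  ((Num.sqrt (1 + t * (s ^+ 2 * \sum_(j <- r) a j ^+ 2)))^-1)%:E.
Proof.
elim: r t => [|k r ih] t /=.
  move=> _ _; rewrite big_nil !mulr0 addr0 sqrtr1 invr1 -[RHS]mean_cst.
  by apply: eq_mean => x; rewrite /linear_form big_nil expr0n mulr0 oppr0 expR0.
move=> /andP[kr ur]; rewrite big_cons.
set S := \sum_(j <- r) _; have S0 : 0 <= S by apply: sumr_ge0 => j _; exact: sqr_ge0.
have mlf : measurable_fun setT
    (fun x : config K R => expR (- (t / 2 * linear_form (k :: r) x ^+ 2))).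
  apply: measurableT_comp => //; apply: measurableT_comp => //.
  by apply: measurable_funM => //; apply: measurable_funX; exact: measurable_linear_form.
move=> D0.
(* For negative [t] the whole sum gives the smaller value, so its positivity passes to the term of
   [k] alone. *)
have tk0 : 0 < 1 + t * a k ^+ 2 * s ^+ 2.
  have [t0|t0] := leP 0 t.
    by apply: ltr_pwDl => //; apply: mulr_ge0; [apply: mulr_ge0 => //|]; exact: sqr_ge0.
  apply: (lt_le_trans D0); rewrite lerD2l -mulrA ler_nM2l// mulrDr mulrC.
  by rewrite lerDl; apply: mulr_ge0 => //; exact: sqr_ge0.
rewrite /mean (integral_resample indepX (pred1 (co k))
  (f := fun x => (expR (- (t / 2 * linear_form (k :: r) x ^+ 2)))%:E)); last 2 first.
- exact/measurable_EFinP.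
- by move=> x; rewrite lee_fin expR_ge0.
set c := 1 + t * a k ^+ 2 * s ^+ 2 in tk0 *.
transitivity (\int[P]_w ((Num.sqrt c)^-1%:E *
    (expR (- (t / c / 2 * linear_form r (sample X w) ^+ 2)))%:E))%E.
  apply: eq_integral => w _.
  rewrite -EFinM -integral_normal_expR_sqr//.
  have mXk : measurable_fun setT (X (co k) : T -> measurableTypeR R).
    by move=> mT B mB; exact: (measurable_funP (X (co k))).
  transitivity (\int[pushforward P (X (co k) : T -> measurableTypeR R)]_y
    (expR (- (t / 2 * (linear_form r (sample X w) + a k * y) ^+ 2)))%:E)%E; last first.
    by apply: eq_measure_integral => B mB _; exact: lawX.
  rewrite ge0_integral_pushforward//=; last first.
    apply/measurable_EFinP; apply: measurableT_comp => //.
    apply: measurableT_comp => //; apply: measurable_funM => //.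
    by apply: measurable_funX; apply: measurable_funD => //; exact: measurable_funM.
  rewrite preimage_setT.
  apply: eq_integral => w' _ /=; do 5 congr (_ _).
  rewrite /linear_form big_cons addrC /mix /= eqxx; congr (_ ^+ _).
  congr (_ + _); apply: eq_big_seq => j jr; congr (_ * _).
  by rewrite /sample; case: eqP => // jk; rewrite -jk map_f in kr.
have cS : 1 + t / c * (s ^+ 2 * S) = (1 + t * (s ^+ 2 * (a k ^+ 2 + S))) / c.
  by rewrite /c; field; rewrite -/c gt_eqF.
rewrite ge0_integralZl//; last first.
  apply: (measurable_sampled (f := fun x => expR (- (t / c / 2 * linear_form r x ^+ 2)))).
  apply: measurableT_comp => //; apply: measurableT_comp => //.
  by apply: measurable_funM => //; apply: measurable_funX; exact: measurable_linear_form.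
rewrite (_ : integral _ _ _ = mean (fun x => expR (- (t / c / 2 * linear_form r x ^+ 2))))//.
rewrite ih//; last by rewrite cS divr_gt0.
rewrite -EFinM -invfM -sqrtrM; last exact: ltW.
by rewrite cS mulrC divfK// gt_eqF.
Qed.

End gaussian_sample.

(** * Power moments of a chi-square variable *)

Section derivative_sign.
Context (R : realType).
Implicit Types (a x : R) (f g : R -> R).

Let MVT_from1 a f g x : a < 1 -> a < x -> x != 1 -> f 1 = 0 ->
  (forall z, a < z -> is_derive z 1 f (g z)) ->
  exists z, [/\ a < z, 0 < (z - 1) * (x - 1) & f x = g z * (x - 1)].
Proof.
move=> a1 ax xn1 f1 df.
have cf u v : a < u -> {within `[u, v], continuous f}.
  move=> au; apply: derivable_within_continuous => z; rewrite in_itv/= => /andP[uz _].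
  by have [] := df z (lt_le_trans au uz).
have [x1|x1|x1] := ltgtP x 1; last by rewrite x1 eqxx in xn1.
- have [|z] := @MVT _ f g x 1 x1 _ (cf _ _ ax).
    by move=> z; rewrite in_itv/= => /andP[xz _]; apply: df; exact: lt_trans xz.
  rewrite in_itv/= => /andP[xz z1] E; exists z; split.
  + exact: lt_trans xz.
  + by rewrite nmulr_rgt0 subr_lt0.
  + by rewrite -[f x]opprK -[- f x]add0r -f1 E -mulrN opprB.
- have [|z] := @MVT _ f g 1 x x1 _ (cf _ _ a1).
    by move=> z; rewrite in_itv/= => /andP[xz _]; apply: df; exact: lt_trans xz.
  rewrite in_itv/= => /andP[xz z1] E; exists z; split.
  + exact: lt_trans xz.
  + by rewrite mulr_gt0 ?subr_gt0.
  + by rewrite -E f1 subr0.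
Qed.

(** By the mean value theorem [f x] is [g z] times [x - 1] for some [z] on the same side of [1] as
    [x]. Alternating this lemma with the next carries the sign of a fourth derivative down to the
    function when the lower derivatives vanish at [1], as Taylor's formula would. *)
Lemma derive_sign_ge0 a f g : a < 1 -> f 1 = 0 ->
  (forall z, a < z -> is_derive z 1 f (g z)) ->
  (forall z, a < z -> 0 <= g z * (z - 1)) -> forall x, a < x -> 0 <= f x.
Proof.
move=> a1 f1 df g0 x ax; have [->|xn1] := eqVneq x 1; first by rewrite f1.
have [z [az zx ->]] := MVT_from1 a1 ax xn1 f1 df.
rewrite -(pmulr_lge0 _ zx).
have -> : g z * (x - 1) * ((z - 1) * (x - 1)) = g z * (z - 1) * (x - 1) ^+ 2 by ring.
by rewrite mulr_ge0 ?sqr_ge0 ?g0.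
Qed.

Lemma derive_ge0_sign a f g : a < 1 -> f 1 = 0 ->
  (forall z, a < z -> is_derive z 1 f (g z)) ->
  (forall z, a < z -> 0 <= g z) -> forall x, a < x -> 0 <= f x * (x - 1).
Proof.
move=> a1 f1 df g0 x ax; have [->|xn1] := eqVneq x 1; first by rewrite f1 mul0r.
have [z [az zx ->]] := MVT_from1 a1 ax xn1 f1 df.
by rewrite -mulrA mulr_ge0 ?g0// -expr2 sqr_ge0.
Qed.

End derivative_sign.

Section exponential_polynomials.
Context (R : realType).

(* Spans the test functions whose expectation is known exactly, together with
   the power [x `^ q] they are compared to; closed under differentiation. *)
Definition exp_pow (c0 c1 c2 c3 c4 c5 q x : R) : R :=
  c0 + c1 * expR (x - 1) + c2 * expR (- (x - 1)) +
  c3 * expR (2 * (x - 1)) + c4 * expR (- (2 * (x - 1))) + c5 * x `^ q.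

Lemma is_derive_exp_pow (c0 c1 c2 c3 c4 c5 q x : R) : 0 < x ->
  is_derive x 1 (exp_pow c0 c1 c2 c3 c4 c5 q)
    (exp_pow 0 c1 (- c2) (2 * c3) (- (2 * c4)) (c5 * q) (q - 1) x).
Proof.
move=> x0.
have dE (k c : R) : is_derive x 1 (fun z : R => c * expR (k * (z - 1)))
    (k * c * expR (k * (x - 1))).
  have H : is_derive x 1 (fun z : R => k * (z - 1)) k.
    by apply: is_derive_eq; rewrite subr0 [_ *: _]mulr1.
  have H' := @is_deriveZ _ _ _ _ c _ _ _ (is_derive1_comp (is_derive_expR _) H).
  by apply: (is_derive_eq H'); rewrite /GRing.scale/=; ring.
have H5 : is_derive x 1 (fun z : R => c5 * z `^ q) (c5 * (q * x `^ (q - 1))).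
  exact: (is_deriveZ _ (is_derive1_powR _ x0)).
have H0 : is_derive x 1 (fun=> c0) (0 : R) by exact: is_derive_cst.
have H1 := dE 1 c1; have H2 := dE (-1) c2; have H3 := dE 2 c3; have H4 := dE (-2) c4.
have := is_deriveD (is_deriveD (is_deriveD (is_deriveD (is_deriveD H0 H1) H2) H3) H4) H5.
set F := (X in is_derive _ _ X _) => H.
have -> : exp_pow c0 c1 c2 c3 c4 c5 q = F.
  by apply/funext => z; rewrite /F /exp_pow !fctE !mul1r !mulN1r !mulNr.
by apply: (is_derive_eq H); rewrite /exp_pow !mul1r !mulN1r !mulNr; ring.
Qed.

Lemma exp_pow1 (c0 c1 c2 c3 c4 c5 q : R) :
  exp_pow c0 c1 c2 c3 c4 c5 q 1 = c0 + c1 + c2 + c3 + c4 + c5.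
Proof. by rewrite /exp_pow subrr !mulr0 oppr0 expR0 powR1 !mulr1. Qed.

(** The four equations say that the function and its first three derivatives vanish at [1]; the last
    hypothesis is the sign of the fourth derivative. *)
Lemma exp_pow_ge0 (a c0 c1 c2 c3 c4 c5 q : R) : 0 <= a -> a < 1 ->
  c0 + c1 + c2 + c3 + c4 + c5 = 0 ->
  c1 - c2 + 2 * c3 - 2 * c4 + c5 * q = 0 ->
  c1 + c2 + 4 * c3 + 4 * c4 + c5 * q * (q - 1) = 0 ->
  c1 - c2 + 8 * c3 - 8 * c4 + c5 * q * (q - 1) * (q - 2) = 0 ->
  (forall x, a < x -> 0 <= exp_pow 0 c1 c2 (16 * c3) (16 * c4)
     (c5 * q * (q - 1) * (q - 2) * (q - 3)) (q - 4) x) ->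
  forall x, a < x -> 0 <= exp_pow c0 c1 c2 c3 c4 c5 q x.
Proof.
move=> a0 a1 e0 e1 e2 e3 h.
have D c0' c1' c2' c3' c4' c5' q' c1'' c2'' c3'' c4'' c5'' q'' :
    c1'' = c1' -> c2'' = - c2' -> c3'' = 2 * c3' -> c4'' = - (2 * c4') ->
    c5'' = c5' * q' -> q'' = q' - 1 ->
    forall z, a < z -> is_derive z 1 (exp_pow c0' c1' c2' c3' c4' c5' q')
      (exp_pow 0 c1'' c2'' c3'' c4'' c5'' q'' z).
  move=> -> -> -> -> -> -> z az; apply: is_derive_exp_pow; exact: le_lt_trans az.
refine (derive_sign_ge0 (g := exp_pow 0 c1 (- c2) (2 * c3) (- (2 * c4)) (c5 * q) (q - 1)) a1 _ _ _).
- by rewrite exp_pow1.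
- exact: D.
refine (derive_ge0_sign
  (g := exp_pow 0 c1 c2 (4 * c3) (4 * c4) (c5 * q * (q - 1)) (q - 2)) a1 _ _ _).
- by rewrite exp_pow1 -[RHS]e1; ring.
- by apply: D; ring.
refine (derive_sign_ge0 (g := exp_pow 0 c1 (- c2) (8 * c3) (- (8 * c4))
  (c5 * q * (q - 1) * (q - 2)) (q - 3)) a1 _ _ _).
- by rewrite exp_pow1 -[RHS]e2; ring.
- by apply: D; ring.
refine (derive_ge0_sign (g := exp_pow 0 c1 c2 (16 * c3) (16 * c4)
     (c5 * q * (q - 1) * (q - 2) * (q - 3)) (q - 4)) a1 _ _ h).
- by rewrite exp_pow1 -[RHS]e3; ring.
- by apply: D; ring.
Qed.

(* Matches [x `^ p] to third order at [x = 1], up to the term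
   [k p (2 cosh (x - 1) - 2)^2] which has the sign of [k]. *)
Definition pow_test (k p x : R) : R :=
  let c := ((p - 1) * (p - 2) - 1) / 6 in
  exp_pow (1 - p * (p - 1) + 6 * k * p)
    (p * ((1 - 2 * c + (p - 1)) / 2 - 4 * k))
    (p * ((p - 1 - (1 - 2 * c)) / 2 - 4 * k))
    (p * (c / 2 + k)) (p * (k - c / 2)) 0 0 x.

Let recip_sum_ge2 (e f : R) : 0 < e -> 0 < f -> e * f = 1 -> 2 <= e + f.
Proof.
move=> e0 f0 ef; rewrite leNgt; apply/negP => h.
have h' : 0 < (2 - (e + f)) * (2 + (e + f)) by rewrite mulr_gt0//; lra.
by have := sqr_ge0 (e - f); lra.
Qed.

(** For [p <= 1] the fourth derivative of [x^p] is nonpositive and helps, so only the exponential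
    part has to be nonnegative; [k = 1] makes the terms in [exp (2 (x - 1))] and its inverse
    dominate. *)
Lemma le_pow_test (p x : R) : 0 < p -> p <= 1 -> 0 < x ->
  x `^ p <= pow_test 1 p x.
Proof.
move=> p0 p1 x0; rewrite -subr_ge0 /pow_test.
set c := ((p - 1) * (p - 2) - 1) / 6.
have pp3 : 0 <= p * (3 - p) by rewrite mulr_ge0//; lra.
have pp12 : 0 <= (1 - p) * (2 - p) by rewrite mulr_ge0//; lra.
have c1 : c <= 1 / 6 by rewrite /c; lra.
have c2 : - (1 / 6) <= c by rewrite /c; lra.
set c0 := 1 - _ + _; set d1 := p * _; set d2 := p * _; set d3 := p * _; set d4 := p * _.
rewrite (_ : _ - _ = exp_pow c0 d1 d2 d3 d4 (-1) p x); last first.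
  by rewrite /exp_pow; ring.
apply: (@exp_pow_ge0 0) => //; rewrite /c0 /d1 /d2 /d3 /d4.
- by field.
- by rewrite /c; field.
- by field.
- by rewrite /c; field.
move=> {}x {}x0; rewrite /exp_pow.
set e := expR (x - 1); set f := expR (- (x - 1)).
have e0 : 0 < e by exact: expR_gt0.
have f0 : 0 < f by exact: expR_gt0.
have ef : e * f = 1 by rewrite /e /f -expRD subrr expR0.
have -> : expR (2 * (x - 1)) = e ^+ 2 by rewrite /e expr2 -expRD mulr_natl mulr2n.
have -> : expR (- (2 * (x - 1))) = f ^+ 2.
  by rewrite /f expr2 -expRD mulr_natl mulr2n opprD.
have w2 := recip_sum_ge2 e0 f0 ef.
have T0 : 0 <= -1 * p * (p - 1) * (p - 2) * (p - 3) * x `^ (p - 4).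
  apply: mulr_ge0; last exact: powR_ge0.
  have : 0 <= (1 - p) * (2 - p) * (3 - p) by rewrite !mulr_ge0// subr_ge0; lra.
  by move=> h; have := mulr_ge0 (ltW p0) h; lra.
apply: addr_ge0 => //; rewrite add0r.
clearbody c e f; clear c0 d1 d2 d3 d4 T0 x x0.
have -> : p * ((1 - 2 * c + (p - 1)) / 2 - 4 * 1) * e +
  p * ((p - 1 - (1 - 2 * c)) / 2 - 4 * 1) * f +
  16 * (p * (c / 2 + 1)) * e ^+ 2 + 16 * (p * (1 - c / 2)) * f ^+ 2 =
  p * (((p - 2 * c) / 2 - 4) * e + ((p - 2 + 2 * c) / 2 - 4) * f
   + (8 * c + 16) * e ^+ 2 + (16 - 8 * c) * f ^+ 2) by field.
apply: mulr_ge0; first exact: ltW.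
have h1 : - 6 * e <= ((p - 2 * c) / 2 - 4) * e by rewrite ler_pM2r//; lra.
have h2 : - 6 * f <= ((p - 2 + 2 * c) / 2 - 4) * f by rewrite ler_pM2r//; lra.
have h3 : 14 * e ^+ 2 <= (8 * c + 16) * e ^+ 2 by rewrite ler_pM2r ?exprn_gt0//; lra.
have h4 : 14 * f ^+ 2 <= (16 - 8 * c) * f ^+ 2 by rewrite ler_pM2r ?exprn_gt0//; lra.
have := sqr_ge0 (e - f); nra.
Qed.

(** Here the fourth derivative of [x^p] has the wrong sign and may blow up at [0]. On [x > 1 / 2]
    its contribution is at least [- 96 p], where [96 = 6 * 2^4], and [k = -5] makes the exponential
    part at least [96 p]. *)
Lemma pow_test_le (p x : R) : 0 < p -> p <= 1 -> 1 / 2 < x ->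
  pow_test (-5) p x <= x `^ p.
Proof.
move=> p0 p1 x0; rewrite -subr_ge0 /pow_test.
set c := ((p - 1) * (p - 2) - 1) / 6.
have pp3 : 0 <= p * (3 - p) by rewrite mulr_ge0//; lra.
have pp12 : 0 <= (1 - p) * (2 - p) by rewrite mulr_ge0//; lra.
have c1 : c <= 1 / 6 by rewrite /c; lra.
have c2 : - (1 / 6) <= c by rewrite /c; lra.
set c0 := 1 - _ + _; set d1 := p * _; set d2 := p * _; set d3 := p * _; set d4 := p * _.
rewrite (_ : _ - _ = exp_pow (- c0) (- d1) (- d2) (- d3) (- d4) 1 p x); last first.
  by rewrite /exp_pow; ring.
apply: (@exp_pow_ge0 (1 / 2)); last exact: x0; rewrite /c0 /d1 /d2 /d3 /d4.
- lra.
- lra.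
- by field.
- by rewrite /c; field.
- by field.
- by rewrite /c; field.
move=> {}x {}x0; rewrite /exp_pow.
set e := expR (x - 1); set f := expR (- (x - 1)).
have e0 : 0 < e by exact: expR_gt0.
have f0 : 0 < f by exact: expR_gt0.
have ef : e * f = 1 by rewrite /e /f -expRD subrr expR0.
have -> : expR (2 * (x - 1)) = e ^+ 2 by rewrite /e expr2 -expRD mulr_natl mulr2n.
have -> : expR (- (2 * (x - 1))) = f ^+ 2.
  by rewrite /f expr2 -expRD mulr_natl mulr2n opprD.
have w2 := recip_sum_ge2 e0 f0 ef.
have xp : x `^ (p - 4) <= 16.
  have [x1|x1] := leP x 1.
    apply: (@le_trans _ _ (x `^ (- 4%:R))); last first.
      rewrite powR_invn; last by lra.
      rewrite invf_ple ?posrE ?exprn_gt0//; last by lra.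
      rewrite (_ : 16^-1 = (1 / 2) ^+ 4); last by field.
      by rewrite lerXn2r ?nnegrE; lra.
    by apply: ger_powR; [apply/andP; split; lra|lra].
  apply: (@le_trans _ _ (x `^ 0)); last by rewrite powRr0; lra.
  by apply: ler_powR; lra.
have xp0 : 0 <= x `^ (p - 4) by exact: powR_ge0.
set X := x `^ (p - 4) in xp xp0 *.
have T0 : - 96 * p <= 1 * p * (p - 1) * (p - 2) * (p - 3) * X.
  have h : 0 <= (1 - p) * (2 - p) * (3 - p) by rewrite !mulr_ge0// subr_ge0; lra.
  have h' : (1 - p) * (2 - p) * (3 - p) <= 6 by nra.
  have : (1 - p) * (2 - p) * (3 - p) * X <= 6 * 16 by apply: ler_pM.
  by move=> hh; have := ler_wpM2l (ltW p0) hh; lra.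
clearbody c e f X; clear c0 d1 d2 d3 d4 x x0.
rewrite add0r.
have -> : - (p * ((1 - 2 * c + (p - 1)) / 2 - 4 * -5)) * e +
  - (p * ((p - 1 - (1 - 2 * c)) / 2 - 4 * -5)) * f +
  16 * - (p * (c / 2 - 5)) * e ^+ 2 + 16 * - (p * (-5 - c / 2)) * f ^+ 2 =
  p * ((- (p - 2 * c) / 2 - 20) * e + (- (p - 2 + 2 * c) / 2 - 20) * f
   + (80 - 8 * c) * e ^+ 2 + (80 + 8 * c) * f ^+ 2) by field.
have h1 : - 22 * e <= (- (p - 2 * c) / 2 - 20) * e by rewrite ler_pM2r//; lra.
have h2 : - 22 * f <= (- (p - 2 + 2 * c) / 2 - 20) * f by rewrite ler_pM2r//; lra.
have h3 : 78 * e ^+ 2 <= (80 - 8 * c) * e ^+ 2 by rewrite ler_pM2r ?exprn_gt0//; lra.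
have h4 : 78 * f ^+ 2 <= (80 + 8 * c) * f ^+ 2 by rewrite ler_pM2r ?exprn_gt0//; lra.
set B := (X in p * X); have hB : 96 <= B.
  have h5 : 78 * e ^+ 2 + 78 * f ^+ 2 - 22 * (e + f) <= B by rewrite /B; lra.
  apply: le_trans h5; have := sqr_ge0 (e - f).
  have : 0 <= (e + f - 2) * (e + f - 2) by rewrite mulr_ge0//; lra.
  by nra.
by have := ler_wpM2l (ltW p0) hB; lra.
Qed.

End exponential_polynomials.

Section moment_estimates.
Context (R : realType).

(** The range and the coefficient of the fourth-order term are linked: the derivative of the
    difference, times [z - 1], is [(1 - z)^4 (4 z - 1) / z]. *)
Lemma ln_taylor_ub (z : R) : 1 / 4 < z ->
  - ln z <= (1 - z) + (1 - z) ^+ 2 / 2 + (1 - z) ^+ 3 / 3 + (1 - z) ^+ 4.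
Proof.
move=> hz; rewrite -subr_ge0.
pose f := fun z : R => (1 - z) + (1 - z) ^+ 2 / 2 + (1 - z) ^+ 3 / 3 + (1 - z) ^+ 4 - (- ln z).
pose g := fun z : R => z^-1 - 1 - (1 - z) - (1 - z) ^+ 2 - 4 * (1 - z) ^+ 3.
have a1 : 1 / 4 < 1 :> R by lra.
refine (@derive_sign_ge0 _ (1 / 4) f g a1 _ _ _ _ hz).
- by rewrite /f ln1; field.
- move=> {}z {}hz; have z0 : 0 < z by lra.
  have D := is_derive1_ln z0.
  by apply: is_derive_eq; rewrite /g /GRing.scale/=; field; rewrite gt_eqF.
- move=> {}z {}hz; have z0 : 0 < z by lra.
  have -> : g z * (z - 1) = (1 - z) ^+ 4 * (4 * z - 1) / z by rewrite /g; field; rewrite gt_eqF.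
  by apply: divr_ge0; [apply: mulr_ge0; [exact: exprn_even_ge0|lra]|lra].
Qed.

Lemma ln_taylor_lb (z : R) : 0 < z ->
  (1 - z) + (1 - z) ^+ 2 / 2 + (1 - z) ^+ 3 / 3 <= - ln z.
Proof.
move=> hz; rewrite -subr_ge0.
pose f := fun z : R => - ln z - ((1 - z) + (1 - z) ^+ 2 / 2 + (1 - z) ^+ 3 / 3).
pose g := fun z : R => 1 + (1 - z) + (1 - z) ^+ 2 - z^-1.
refine (@derive_sign_ge0 _ 0 f g ltr01 _ _ _ _ hz).
- by rewrite /f ln1; field.
- move=> {}z {}hz; have D := is_derive1_ln hz.
  by apply: is_derive_eq; rewrite /g /GRing.scale/=; field; rewrite gt_eqF.
- move=> {hz}z z0.
  have -> : g z * (z - 1) = (1 - z) ^+ 4 / z by rewrite /g; field; rewrite gt_eqF.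
  by apply: divr_ge0; [exact: exprn_even_ge0|lra].
Qed.

(* [expR (t * (Q - 1))] has mean [chi_mgf n t] when [n * Q] is chi-square with
   [n] degrees of freedom. *)
Definition chi_mgf (n : nat) (t : R) : R :=
  expR (- t) * ((Num.sqrt (1 - 2 * t / n%:R))^-1) ^+ n.

Lemma expR_le_quadratic (e : R) : `|e| <= 1 / 2 -> expR e <= 1 + e + 2 * e ^+ 2.
Proof.
rewrite ler_norml => /andP[e1 e2].
have h := expR_ge1Dx (- e).
have e0 := expR_gt0 e; have ee : expR (- e) * expR e = 1 by rewrite -expRD addNr expR0.
have h1 : (1 - e) * expR e <= 1 by rewrite -[leRHS]ee ler_pM2r.
have h2 : 1 <= (1 - e) * (1 + e + 2 * e ^+ 2).
  have : 0 <= e ^+ 2 * (1 - 2 * e) by rewrite mulr_ge0 ?sqr_ge0//; lra.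
  by nra.
by rewrite -(@ler_pM2l _ (1 - e)); [exact: le_trans h2|lra].
Qed.

(** In the exponent [- t - n / 2 ln (1 - 2 t / n)] the linear terms cancel and [t^2 / n] remains, up
    to [20 / n^2]; exponentiating adds at most [2 e^2 <= 72 / n^2]. *)
Lemma chi_mgf_bound (n : nat) (t : R) : (16 <= n)%N -> `|t| <= 2 ->
  `|chi_mgf n t - (1 + t ^+ 2 / n%:R)| <= 100 / n%:R ^+ 2.
Proof.
move=> n16 ht.
have x16 : 16 <= n%:R :> R by rewrite ler_nat.
pose x : R := n%:R; rewrite -/x in x16 *.
have x0 : 0 < x by lra.
have xn0 : x != 0 by rewrite gt_eqF.
pose i := x^-1; have i0 : 0 < i by rewrite invr_gt0.
have i16 : i <= 1 / 16 by rewrite /i invf_ple ?posrE//; lra.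
move: (ht); rewrite ler_norml => /andP[t1 t2].
pose u := 2 * t * i.
have u1 : u <= 1 / 4 by rewrite /u; nra.
have u2 : - (1 / 4) <= u by rewrite /u; nra.
pose z := 1 - u; have z0 : 0 < z by rewrite /z; lra.
pose e := - t - x / 2 * ln z.
have chiE : chi_mgf n t = expR e.
  rewrite /chi_mgf /e expRD -/x (_ : 1 - 2 * t / x = z)//; congr (_ * _).
  rewrite -powR12_sqrt ?ltW// /powR gt_eqF// -expRN -expRM_natl -/x.
  by congr expR; field.
have lb := ln_taylor_lb z0; have ub : _ <= _ := ln_taylor_ub (_ : 1 / 4 < z).
have {}ub := ub ltac:(rewrite /z; lra).
have zu : 1 - z = u by rewrite /z; ring.
rewrite !zu in lb ub.
have ti : t ^+ 2 <= 4 by nra.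
pose w := t ^+ 2 * i.
have w0 : 0 <= w by rewrite mulr_ge0 ?sqr_ge0// ltW.
have w4 : w <= 4 * i by rewrite ler_pM2r.
have xi : x * i = 1 by rewrite /i divff.
have i20 : 0 <= i ^+ 2 by exact: sqr_ge0.
have t3 : `|t ^+ 3| <= 8.
  by rewrite normrX (_ : 8 = 2 ^+ 3); [rewrite lerXn2r ?nnegrE//; lra|ring].
have t4 : t ^+ 4 <= 16 by nra.
have e1 : w - 20 * i ^+ 2 <= e.
  have : - t + x / 2 * (u + u ^+ 2 / 2 + u ^+ 3 / 3) <= e.
    by rewrite /e lerD2l -mulrN ler_pM2l//; lra.
  have -> : - t + x / 2 * (u + u ^+ 2 / 2 + u ^+ 3 / 3) = w + 4 / 3 * t ^+ 3 * i ^+ 2.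
    have xE : x = i^-1 by rewrite invrK.
    by rewrite /u /w xE; field; lra.
  apply: le_trans; rewrite lerD2l; move: t3; rewrite ler_norml => /andP[t3 _].
  by rewrite -mulNr ler_wpM2r//; lra.
have e2 : e <= w + 20 * i ^+ 2.
  have : e <= - t + x / 2 * (u + u ^+ 2 / 2 + u ^+ 3 / 3 + u ^+ 4).
    by rewrite /e lerD2l -mulrN ler_pM2l//; lra.
  have -> : - t + x / 2 * (u + u ^+ 2 / 2 + u ^+ 3 / 3 + u ^+ 4) =
      w + (4 / 3 * t ^+ 3 + 8 * t ^+ 4 * i) * i ^+ 2.
    have xE : x = i^-1 by rewrite invrK.
    by rewrite /u /w xE; field; lra.
  move=> h; apply: (le_trans h); rewrite lerD2l; move: t3; rewrite ler_norml => /andP[_ t3].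
  have : t ^+ 4 * i <= 16 * (1 / 16).
    by apply: ler_pM => //; [exact: exprn_even_ge0|lra].
  by move=> h'; rewrite ler_wpM2r//; lra.
have ii : i ^+ 2 <= 1 / 16 * i by rewrite expr2 ler_pM2r.
have he : `|e| <= 6 * i by rewrite ler_norml; apply/andP; split; lra.
have he2 : e ^+ 2 <= 36 * i ^+ 2.
  by rewrite -[e ^+ 2]real_normK ?num_real//
    (_ : 36 * _ = (6 * i) ^+ 2); [rewrite lerXn2r ?nnegrE//; lra|ring].
have he3 : `|e| <= 1 / 2 by lra.
have h1 := expR_ge1Dx e; have h2 := expR_le_quadratic he3.
rewrite chiE -/x -/i -/w -exprVn -/i ler_norml; apply/andP; split; lra.
Qed.

End moment_estimates.

Section test_values.
Context (R : realType).

(** The mean of [pow_test k p] at a chi-square variable with [n] degrees of freedom divided by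
    [n]. *)
Definition test_value (k p : R) (n : nat) : R :=
  let c := ((p - 1) * (p - 2) - 1) / 6 in
  (1 - p * (p - 1) + 6 * k * p)
  + (p * ((1 - 2 * c + (p - 1)) / 2 - 4 * k)) * chi_mgf n 1
  + (p * ((p - 1 - (1 - 2 * c)) / 2 - 4 * k)) * chi_mgf n (- 1)
  + (p * (c / 2 + k)) * chi_mgf n 2 + (p * (k - c / 2)) * chi_mgf n (- 2).

(** In [pow_test] this number [c] is the coefficient of [p sinh (2 (x - 1))], forced by the third
    derivative at [1]: [1 + 6 c = (p - 1) (p - 2)]. *)
Lemma third_coef_bound (p : R) : 0 < p -> p <= 1 ->
  `|((p - 1) * (p - 2) - 1) / 6| <= 1 / 6.
Proof.
move=> p0 p1.
have pp3 : 0 <= p * (3 - p) by rewrite mulr_ge0//; lra.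
have pp12 : 0 <= (1 - p) * (2 - p) by rewrite mulr_ge0//; lra.
by rewrite ler_norml; apply/andP; split; lra.
Qed.

(** At order [1 / n] only the second derivative [p (p - 1)] at [1] contributes, the variance being
    [2 / n]. Each coefficient carries a factor [p], and [56 = 22 + 22 + 6 + 6] bounds the sum of
    their sizes for [|k| <= 5]. *)
Lemma test_value_bound (k p : R) (n : nat) : 0 < p -> p <= 1 -> `|k| <= 5 ->
  (16 <= n)%N ->
  `|test_value k p n - (1 - p * (1 - p) / n%:R)| <= 56 * 100 * p / n%:R ^+ 2.
Proof.
move=> p0 p1 hk n16.
have h1 := @chi_mgf_bound R n 1 n16 ltac:(by rewrite normr1 ler1n).
have h2 := @chi_mgf_bound R n (- 1) n16 ltac:(by rewrite normrN normr1 ler1n).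
have h3 := @chi_mgf_bound R n 2 n16 ltac:(by rewrite ger0_norm).
have h4 := @chi_mgf_bound R n (- 2) n16 ltac:(by rewrite normrN ger0_norm).
have nR : 16 <= n%:R :> R by rewrite ler_nat.
rewrite /test_value.
set c := _ / 6; have := third_coef_bound p0 p1; rewrite -/c => hc.
move: h1 h2 h3 h4; set L1 := chi_mgf n 1; set L2 := chi_mgf n (- 1).
set L3 := chi_mgf n 2; set L4 := chi_mgf n (- 2).
set i := n%:R^-1; rewrite -exprVn -/i.
move=> h1 h2 h3 h4.
have -> : 1 - p * (p - 1) + 6 * k * p
  + (p * ((1 - 2 * c + (p - 1)) / 2 - 4 * k)) * L1
  + (p * ((p - 1 - (1 - 2 * c)) / 2 - 4 * k)) * L2
  + (p * (c / 2 + k)) * L3 + (p * (k - c / 2)) * L4 - (1 - p * (1 - p) * i) =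
  p * (((p - 2 * c) / 2 - 4 * k) * (L1 - (1 + 1 ^+ 2 * i)) +
    ((p - 2 + 2 * c) / 2 - 4 * k) * (L2 - (1 + (- 1) ^+ 2 * i)) +
    (c / 2 + k) * (L3 - (1 + 2 ^+ 2 * i)) + (k - c / 2) * (L4 - (1 + (- 2) ^+ 2 * i))).
  by field.
rewrite normrM (gtr0_norm p0) (_ : 56 * 100 * p * _ = p * (22 * (100 * i ^+ 2) +
  22 * (100 * i ^+ 2) + 6 * (100 * i ^+ 2) + 6 * (100 * i ^+ 2))); last by ring.
apply: ler_wpM2l; first exact: ltW.
move/ler_normlP: hc => [c1 c2]; move/ler_normlP: hk => [k1 k2].
have tri (a b u v : R) : `|a| <= u -> `|b| <= v -> `|a + b| <= u + v.
  by move=> ha hb; apply: (le_trans (ler_normD _ _)); exact: lerD.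
apply: (tri _ _ _ _); first apply: (tri _ _ _ _); first apply: (tri _ _ _ _);
  rewrite normrM; apply: ler_pM => //;
  rewrite ler_norml; apply/andP; split; lra.
Qed.

(** Serves on [x <= 1 / 2], where [pow_test_le] says nothing. Below [1] every correction to the
    value [1] is nonpositive; [f <= 4] is what keeps [1 + c (e + f - 2)] nonnegative. *)
Lemma pow_test_le1 (p x : R) : 0 < p -> p <= 1 -> 0 <= x -> x <= 1 ->
  pow_test (- 5) p x <= 1.
Proof.
move=> p0 p1 x0 x1; rewrite /pow_test.
set c := _ / 6; have := third_coef_bound p0 p1; rewrite -/c ler_norml => /andP[c1 c2].
rewrite /exp_pow; set e := expR (x - 1); set f := expR (- (x - 1)).
have e0 : 0 < e by exact: expR_gt0.
have f0 : 0 < f by exact: expR_gt0.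
have ef : e * f = 1 by rewrite /e /f -expRD subrr expR0.
have -> : expR (2 * (x - 1)) = e ^+ 2 by rewrite /e expr2 -expRD mulr_natl mulr2n.
have -> : expR (- (2 * (x - 1))) = f ^+ 2.
  by rewrite /f expr2 -expRD mulr_natl mulr2n opprD.
have e1 : e <= 1 by rewrite /e -[leRHS]expR0 ler_expR; lra.
have f1 : 1 <= f by rewrite /f -[leLHS]expR0 ler_expR; lra.
have f4 : f <= 4.
  apply: (@le_trans _ _ (expR (2^-1 + 2^-1))); first by rewrite /f ler_expR; lra.
  have h := expR_ge1Dx (- (2^-1 : R)).
  have h' : expR (- 2^-1) * expR (2^-1) = 1 :> R by rewrite -expRD addNr expR0.
  have h2 : expR (2^-1) <= 2 :> R.
    have : (1 + - 2^-1) * expR (2^-1) <= expR (- 2^-1) * expR (2^-1) :> R.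
      by rewrite ler_pM2r ?expR_gt0.
    by rewrite h'; lra.
  rewrite expRD (_ : 4 = 2 * 2); last by ring.
  by apply: ler_pM => //; rewrite expR_ge0.
rewrite mul0r addr0.
(* The last summand vanishes because [e f = 1]; it makes this a polynomial identity in [e] and
   [f]. *)
have -> : 1 - p * (p - 1) + 6 * -5 * p + p * ((1 - 2 * c + (p - 1)) / 2 - 4 * -5) * e +
   p * ((p - 1 - (1 - 2 * c)) / 2 - 4 * -5) * f + p * (c / 2 - 5) * e ^+ 2 +
   p * (-5 - c / 2) * f ^+ 2 =
   1 + p * (- (f - e) / 2 * (1 + c * (e + f - 2)) - (1 - p) / 2 * (e + f - 2)
     - 5 * (e + f - 2) ^+ 2) + 10 * p * (e * f - 1).
  by field.
rewrite ef subrr mulr0 addr0 -lerBrDl subrr.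
have w2 : 0 <= e + f - 2.
  have : 0 <= (1 - e) * (f - 1) by rewrite mulr_ge0// subr_ge0.
  by nra.
rewrite pmulr_rle0//.
have h1 : 0 <= (f - e) / 2 * (1 + c * (e + f - 2)) by rewrite mulr_ge0//; nra.
have h2 : 0 <= (1 - p) / 2 * (e + f - 2) by rewrite mulr_ge0//; lra.
have := sqr_ge0 (e + f - 2); lra.
Qed.

(** [pow_test] is continuous, and nonnegative at positive points, hence nonnegative at [0]. The
    value [0] matters because the squared norm of an image may vanish at some sample points. *)
Lemma le_pow_test0 (p x : R) : 0 < p -> p <= 1 -> 0 <= x ->
  x `^ p <= pow_test 1 p x.
Proof.
move=> p0 p1; rewrite le_eqVlt => /predU1P[<-|]; last exact: le_pow_test.
rewrite powR0 ?gt_eqF//.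
have cE (k c : R) : continuous (fun z : R => c * expR (k * (z - 1))).
  move=> z; apply: cvgM; first exact: cvg_cst.
  apply: (@continuous_comp _ _ _ (fun z : R => k * (z - 1)) expR); last exact: continuous_expR.
  by apply: cvgM; [exact: cvg_cst|apply: cvgB; [exact: cvg_id|exact: cvg_cst]].
have cF : continuous (pow_test 1 p).
  rewrite /pow_test.
  set c0 := (_ + _); set d1 := p * _; set d2 := p * _; set d3 := p * _; set d4 := p * _.
  have -> : exp_pow c0 d1 d2 d3 d4 0 0 = (fun z : R => c0 + d1 * expR (1 * (z - 1)) +
      d2 * expR (- 1 * (z - 1)) + d3 * expR (2 * (z - 1)) + d4 * expR (- 2 * (z - 1))).
    by apply/funext => z; rewrite /exp_pow mul0r addr0 mul1r mulN1r mulNr.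
  move=> z; do 4 (apply: cvgD; last exact: cE).
  exact: cvg_cst.
rewrite leNgt; apply/negP => F0.
have N0 : \forall z \near (0 : R), pow_test 1 p z < 0 by exact: (cvgr_lt _ (cF 0) _ F0).
have [e /= e0 /(_ (e / 2)) h] : nbhs_ball (0 : R) [set z | pow_test 1 p z < 0].
  by apply/nbhs_ballP.
have : pow_test 1 p (e / 2) < 0.
  apply: h; rewrite /ball/= sub0r normrN gtr0_norm ?divr_gt0//.
  by rewrite ltr_pdivrMr// ltr_pMr// ltr1n.
apply/negP; rewrite -leNgt; apply: le_trans (le_pow_test p0 p1 (divr_gt0 e0 (ltr0n _ 2))).
exact: powR_ge0.
Qed.

Lemma powR_sandwich (p x : R) : 0 < p -> p <= 1 -> 0 <= x ->
  pow_test (- 5) p x <= x `^ p + \1_[set y | y <= 1 / 2] x.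
Proof.
move=> p0 p1 x0; rewrite indicE; have [x2|x2] := leP x (1 / 2).
  rewrite mem_set//=; apply: (@le_trans _ _ 1).
    by apply: pow_test_le1 => //; lra.
  by rewrite lerDr powR_ge0.
rewrite memNset/=; last by apply/negP; rewrite -ltNge.
by rewrite addr0; exact: pow_test_le.
Qed.

End test_values.

(** * One Gaussian layer applied to a unit vector *)

Section chi_square_layer.
Context (d : measure_display) (T : measurableType d) (R : realType)
  (P : probability T R) (K : finType) (X : K -> {RV P >-> R}).
Hypothesis indepX : mutually_independent X.
Variable n : nat.
Hypothesis n0 : (0 < n)%N.
Hypothesis lawX : forall k B, measurable B ->
  distribution P (X k) B = normal_prob 0 (Num.sqrt (n%:R^-1)) B.
Variable co : 'I_n -> 'I_n -> K.
Hypothesis co_inj : forall a b a' b', co a b = co a' b' -> a = a' /\ b = b'.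

Definition image_sqr (v : 'I_n -> R) (x : K -> R) : R :=
  \sum_(a < n) linear_form (co a) v (index_enum 'I_n) x ^+ 2.

Lemma measurable_image_sqr v :
  measurable_fun setT (image_sqr v : config K R -> R).
Proof.
apply: measurable_sum => a; apply: measurable_funX.
exact: measurable_linear_form.
Qed.

Lemma image_sqr_ge0 v x : 0 <= image_sqr v x.
Proof. by apply: sumr_ge0 => a _; exact: sqr_ge0. Qed.

Variable v : 'I_n -> R.
Hypothesis v1 : \sum_b v b ^+ 2 = 1.

Let nR0 : 0 < n%:R :> R. Proof. by rewrite ltr0n. Qed.

(** Distinct rows of a layer use disjoint coordinates, so the mean is a product over the rows, each
    factor being [mean_expR_sqr] at [- 2 t]. *)
Lemma mean_expR_image_sqr (t : R) : 2 * t < n%:R ->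
  mean X (fun x => expR (t * image_sqr v x)) =
  (((Num.sqrt (1 - 2 * t / n%:R))^-1) ^+ n)%:E.
Proof.
move=> tn; pose row a := linear_form (co a) v (index_enum 'I_n).
pose D := 1 - 2 * t / n%:R.
have D0 : 0 < D by rewrite subr_gt0 ltr_pdivrMr// mul1r.
suff H (r : seq 'I_n) : uniq r ->
    mean X (fun x => expR (t * \sum_(a <- r) row a x ^+ 2)) =
    ((Num.sqrt D)^-1 ^+ size r)%:E.
  by rewrite H ?index_enum_uniq// -[index_enum _]enumT size_enum_ord.
elim: r => [_|a r ih /= /andP[ar ur]].
  rewrite expr0 -[RHS](mean_cst X).
  by apply: eq_mean => x; rewrite big_nil mulr0 expR0.
pose B : pred K := [pred k | [exists b, k == co a b]].
transitivity (mean X (fun x => expR (t * row a x ^+ 2) *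
    expR (t * \sum_(a <- r) row a x ^+ 2))).
  by apply: eq_mean => x; rewrite big_cons mulrDr expRD.
have mrow a' : measurable_fun setT (fun x : config K R => row a' x ^+ 2).
  by apply: measurable_funX; exact: measurable_linear_form.
rewrite (@mean_mul_indep _ _ _ _ _ X indepX B) //; first last.
- move=> x y xy; congr (expR (t * _)); apply: eq_big_seq => a' a'r.
  congr (_ ^+ _); apply: eq_bigr => b _; rewrite xy//=.
  apply/existsP => -[b' /eqP/co_inj[aa' _]]; by rewrite -aa' a'r in ar.
- move=> x y xy; congr (expR (t * _ ^+ 2)); apply: eq_bigr => b _; rewrite xy//=.
  by apply/existsP; exists b.
- apply: measurableT_comp => //; apply: measurable_funM => //.
  exact: measurable_sum.
- by apply: measurableT_comp => //; exact: measurable_funM.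
rewrite ih// exprS EFinM; congr (_ * _)%E.
have s2 : Num.sqrt (n%:R^-1) ^+ 2 = n%:R^-1 :> R.
  by rewrite sqr_sqrtr// invr_ge0 ltW.
have DE : 1 + (- (2 * t)) * (Num.sqrt (n%:R^-1) ^+ 2 * \sum_(b <- index_enum 'I_n) v b ^+ 2) = D.
  by rewrite v1 s2 mulr1 mulNr.
rewrite -DE -(@mean_expR_sqr _ _ _ _ _ X indepX _ _ lawX _ (co a) v) //; first last.
- by rewrite DE.
- by rewrite map_inj_uniq ?index_enum_uniq// => b b' /co_inj[].
- by rewrite sqrtr_gt0 invr_gt0.
apply: eq_mean => x; congr expR.
by rewrite /row; set y := _ ^+ 2; field.
Qed.

End chi_square_layer.

Section linear_combination.
Context (d : measure_display) (T : measurableType d) (R : realType)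
  (P : probability T R) (K : finType) (X : K -> {RV P >-> R}).
Variables (J : Type) (r : seq J) (c : J -> R) (e : J -> config K R -> R)
  (l : J -> R).
Hypothesis me : forall j, measurable_fun setT (e j).
Hypothesis e0 : forall j x, 0 <= e j x.
Hypothesis meanE : forall j, mean X (e j) = (l j)%:E.

Let mean_comb (c' : J -> R) : (forall j, 0 <= c' j) ->
  mean X (fun x => \sum_(j <- r) c' j * e j x) = (\sum_(j <- r) c' j * l j)%:E.
Proof.
move=> c0; rewrite mean_sum.
- by rewrite -sumEFin; apply: eq_bigr => j _; rewrite meanZ// meanE.
- by move=> j; exact: measurable_funM.
- by move=> j x; exact: mulr_ge0.
Qed.

Let pos j : R := Num.max (c j) 0.
Let neg j : R := Num.max (- c j) 0.

Let pos_neg j : pos j - neg j = c j.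
Proof. by rewrite /pos /neg; case: (leP (c j) 0); case: (leP (- c j) 0); lra. Qed.

Let pos0 j : 0 <= pos j. Proof. by rewrite le_max lexx orbT. Qed.
Let neg0 j : 0 <= neg j. Proof. by rewrite le_max lexx orbT. Qed.

Let combE (x : J -> R) : \sum_(j <- r) c j * x j =
  \sum_(j <- r) pos j * x j - \sum_(j <- r) neg j * x j.
Proof. by rewrite -sumrB; apply: eq_bigr => j _; rewrite -mulrBl pos_neg. Qed.

Let mcomb c' : measurable_fun setT (fun x : config K R => \sum_(j <- r) c' j * e j x).
Proof. by apply: measurable_sum => j; exact: measurable_funM. Qed.

(** Additivity of means is available for nonnegative functions, so the terms with negative
    coefficients are first moved to the side of [f]. *)
Lemma mean_le_comb (f : config K R -> R) : measurable_fun setT f ->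
  (forall x, 0 <= f x) -> (forall x, f x <= \sum_(j <- r) c j * e j x) ->
  (mean X f <= (\sum_(j <- r) c j * l j)%:E)%E.
Proof.
move=> mf f0 fe.
have : (mean X (fun x => (f x + \sum_(j <- r) neg j * e j x)%R) <=
        mean X (fun x => \sum_(j <- r) pos j * e j x)%R)%E.
  apply: le_mean => //.
  - exact: measurable_funD.
  - by move=> x; rewrite addr_ge0// sumr_ge0// => j _; rewrite mulr_ge0.
  - by move=> x; rewrite -lerBrDr -(combE (e ^~ x)).
rewrite meanD//; last by move=> x; rewrite sumr_ge0// => j _; rewrite mulr_ge0.
by rewrite !mean_comb// -leeBrDr// -EFinB -(combE l).
Qed.

Lemma comb_le_mean (f : config K R -> R) : measurable_fun setT f ->
  (forall x, 0 <= f x) -> (forall x, \sum_(j <- r) c j * e j x <= f x) ->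
  ((\sum_(j <- r) c j * l j)%:E <= mean X f)%E.
Proof.
move=> mf f0 fe.
have : (mean X (fun x => \sum_(j <- r) pos j * e j x)%R <=
        mean X (fun x => (f x + \sum_(j <- r) neg j * e j x)%R))%E.
  apply: le_mean => //.
  - exact: measurable_funD.
  - by move=> x; rewrite sumr_ge0// => j _; rewrite mulr_ge0.
  - by move=> x; rewrite -lerBlDr -(combE (e ^~ x)).
rewrite meanD//; last by move=> x; rewrite sumr_ge0// => j _; rewrite mulr_ge0.
by rewrite !mean_comb// -leeBlDr// -EFinB -(combE l).
Qed.

End linear_combination.

Section real_estimates.
Context (R : realType).

Lemma expR_neg_le_onem (w : R) : 0 <= w -> w <= 1 / 2 ->
  expR (- (w + 2 * w ^+ 2)) <= 1 - w.
Proof.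
move=> w0 w1.
have h := expR_ge1Dx (w + 2 * w ^+ 2).
have h1 : 1 <= (1 - w) * (1 + w + 2 * w ^+ 2).
  have : 0 <= w ^+ 2 * (1 - 2 * w) by rewrite mulr_ge0 ?sqr_ge0//; lra.
  by nra.
have e0 := expR_gt0 (w + 2 * w ^+ 2).
rewrite expRN -[leLHS]mul1r ler_pdivrMr//; apply: (le_trans h1).
by rewrite ler_pM2l//; lra.
Qed.

(** The left-hand side is Chernoff's bound, at parameter [- n / 2], for the probability that the
    normalised chi-square variable is at most [1 / 2]. It decays exponentially because
    [ln 2 > 1 / 2]; a cubic rate is recorded since [n^-3 <= p n^-2] for [p >= 1 / n]. *)
Lemma lower_tail_rate : exists2 C : R, 0 < C & forall n : nat, (0 < n)%N ->
  expR (n%:R / 4) * ((Num.sqrt 2)^-1) ^+ n <= C / n%:R ^+ 3.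
Proof.
pose g : R := ln 2 / 2 - 4^-1.
have g0 : 0 < g.
  have h := @ln_taylor_lb R (2^-1) ltac:(lra).
  rewrite lnV ?posrE// opprK in h.
  by rewrite /g; lra.
exists (6 / g ^+ 3); first by rewrite divr_gt0// exprn_gt0.
move=> n n0; have nR : 0 < n%:R :> R by rewrite ltr0n.
have -> : expR (n%:R / 4) * ((Num.sqrt 2)^-1) ^+ n = (expR (g * n%:R))^-1.
  rewrite -[RHS]expRN -powR12_sqrt// /powR gt_eqF// -[(expR (_ * ln _))^-1]expRN.
  rewrite -expRM_natr -expRD.
  by congr expR; rewrite /g; field.
rewrite -mulrA -invfM -exprMn invf_ple ?posrE ?expR_gt0 ?divr_gt0 ?exprn_gt0 ?mulr_gt0//.
rewrite invf_div.
have := @expR_ge1Dxn R (g * n%:R) 2 (ltW (mulr_gt0 g0 nR)).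
by rewrite (_ : 3`!%:R = 6)//; lra.
Qed.

End real_estimates.

Section image_sqr_moments.
Context (d : measure_display) (T : measurableType d) (R : realType)
  (P : probability T R) (K : finType) (X : K -> {RV P >-> R}).
Hypothesis indepX : mutually_independent X.
Variable n : nat.
Hypothesis n16 : (16 <= n)%N.
Hypothesis lawX : forall k B, measurable B ->
  distribution P (X k) B = normal_prob 0 (Num.sqrt (n%:R^-1)) B.
Variable co : 'I_n -> 'I_n -> K.
Hypothesis co_inj : forall a b a' b', co a b = co a' b' -> a = a' /\ b = b'.
Variable v : 'I_n -> R.
Hypothesis v1 : \sum_b v b ^+ 2 = 1.

Let Q := image_sqr co v.
Let n0 : (0 < n)%N. Proof. exact: leq_trans n16. Qed.
Let nR16 : 16 <= n%:R :> R. Proof. by rewrite ler_nat. Qed.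
Let mQ : measurable_fun setT (Q : config K R -> R).
Proof. exact: measurable_image_sqr. Qed.
Let Q0 x : 0 <= Q x. Proof. exact: image_sqr_ge0. Qed.

Let mean_centered t : 2 * t < n%:R ->
  mean X (fun x => expR (t * (Q x - 1))) = (chi_mgf n t)%:E.
Proof.
move=> tn; rewrite /chi_mgf EFinM -(mean_expR_image_sqr indepX n0 lawX co_inj v1 tn).
rewrite -meanZ ?expR_ge0//.
- by apply: eq_mean => x; rewrite -expRD; congr expR; rewrite /Q; ring.
- by apply: measurableT_comp => //; apply: measurable_funM.
Qed.

(** An index is a coefficient together with an exponent, the latter carrying the proof that its
    exponential mean is finite. *)
Let e (j : R * {t : R | 2 * t < n%:R}) (x : config K R) := expR (sval j.2 * (Q x - 1)).
Let l (j : R * {t : R | 2 * t < n%:R}) := chi_mgf n (sval j.2).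

Let me j : measurable_fun setT (e j).
Proof.
apply: measurableT_comp => //; apply: measurable_funM => //.
exact: measurable_funB.
Qed.

Let e0 j x : 0 <= e j x. Proof. exact: expR_ge0. Qed.

Let meanE j : mean X (e j) = (l j)%:E.
Proof. by case: j => c [t ht]; exact: mean_centered. Qed.

Let lt_n (t : R) : t <= 2 -> 2 * t < n%:R. Proof. by have := nR16; lra. Qed.

Let tt (t : R) (h : t <= 2) : {t : R | 2 * t < n%:R} := exist _ t (lt_n h).

Let ler0n2 : 0 <= 2 :> R. Proof. by []. Qed.
Let lerN12 : - 1 <= 2 :> R. Proof. lra. Qed.
Let lerN22 : - 2 <= 2 :> R. Proof. lra. Qed.

Let terms (c0 c1 c2 c3 c4 : R) : seq (R * {t : R | 2 * t < n%:R}) :=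
  [:: (c0, tt ler0n2); (c1, tt (ler1n R 2)); (c2, tt lerN12);
      (c3, tt (lexx _)); (c4, tt lerN22)].

Let terms_e c0 c1 c2 c3 c4 x :
  \sum_(j <- terms c0 c1 c2 c3 c4) j.1 * e j x = exp_pow c0 c1 c2 c3 c4 0 0 (Q x).
Proof.
rewrite !big_cons big_nil /e/= /exp_pow mul0r expR0 mul1r mulN1r mulNr.
by rewrite mul0r mulr1 !addr0 !addrA.
Qed.

Let chi_mgf0 : chi_mgf n 0 = 1 :> R.
Proof. by rewrite /chi_mgf oppr0 expR0 mulr0 mul0r subr0 sqrtr1 invr1 expr1n mulr1. Qed.

Let terms_l c0 c1 c2 c3 c4 :
  \sum_(j <- terms c0 c1 c2 c3 c4) j.1 * l j =
  c0 + c1 * chi_mgf n 1 + c2 * chi_mgf n (- 1) + c3 * chi_mgf n 2 + c4 * chi_mgf n (- 2).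
Proof. by rewrite !big_cons big_nil /l/= chi_mgf0 mulr1 !addr0 !addrA. Qed.

Lemma mean_powR_image_sqr_le (p : R) : 0 < p -> p <= 1 ->
  (mean X (fun x => (Q x `^ p)%R) <= (1 - p * (1 - p) / n%:R + 56 * 100 * p / n%:R ^+ 2)%:E)%E.
Proof.
move=> p0 p1; apply: (@le_trans _ _ (test_value 1 p n)%:E); last first.
  have := @test_value_bound R 1 p n p0 p1 ltac:(by rewrite normr1; lra) n16.
  rewrite lee_fin; set a := p * _ / _; set b := 56 * 100 * _ / _.
  by move/ler_normlP => [_ h]; rewrite addrC -lerBlDr.
rewrite /test_value -terms_l; apply: (mean_le_comb me e0 meanE) => [||x].
- exact: (measurableT_comp (@measurable_powR R p) mQ).
- by move=> x; exact: powR_ge0.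
- by rewrite terms_e; exact: le_pow_test0.
Qed.

Lemma mean_powR_image_sqr_ge (p : R) : 0 < p -> p <= 1 ->
  ((1 - p * (1 - p) / n%:R - 56 * 100 * p / n%:R ^+ 2 -
    expR (n%:R / 4) * ((Num.sqrt 2)^-1) ^+ n)%:E <= mean X (fun x => (Q x `^ p)%R))%E.
Proof.
move=> p0 p1.
have m1 : measurable_fun setT (fun x : config K R => \1_[set y : R | y <= 1 / 2] (Q x) : R).
  have mI : measurable [set y : R | y <= 1 / 2] by rewrite -set_itvNyc.
  exact: (measurableT_comp (measurable_indic mI) mQ).
have m2 : measurable_fun setT (fun x : config K R => Q x `^ p).
  exact: (measurableT_comp (@measurable_powR R p) mQ).
have h1 : ((test_value (- 5) p n)%:E <=
    mean X (fun x => (Q x `^ p + \1_[set y : R | y <= 1 / 2] (Q x))%R))%E.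
  rewrite /test_value -terms_l; apply: (comb_le_mean me e0 meanE) => [||x].
  - exact: measurable_funD.
  - by move=> x; rewrite addr_ge0 ?powR_ge0.
  - by rewrite terms_e; exact: powR_sandwich.
have h2 : (mean X (fun x => (\1_[set y : R | y <= 1 / 2] (Q x))%R) <=
    (expR (n%:R / 4) * ((Num.sqrt 2)^-1) ^+ n)%:E)%E.
  have nR := nR16.
  (* Chernoff's bound at [t = - n / 2], where [1 - 2 t / n] equals [2]. *)
  have nn : 2 * (- (n%:R / 2)) < n%:R :> R by lra.
  have := mean_expR_image_sqr indepX n0 lawX co_inj v1 nn.
  rewrite (_ : 1 - _ / _ = 2) => [E|]; last by field; lra.
  rewrite EFinM -E -meanZ ?expR_ge0//; last first.
    by apply: measurableT_comp => //; exact: measurable_funM.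
  apply: le_mean => //.
    by apply: measurable_funM => //; apply: measurableT_comp => //; exact: measurable_funM.
  move=> x; rewrite -expRD indicE; have [xs|xs] := leP (Q x) (1 / 2).
    rewrite mem_set//=; rewrite -[leLHS]expR0 ler_expR.
    have : n%:R / 2 * Q x <= n%:R / 2 * (1 / 2) by rewrite ler_wpM2l//; lra.
    by rewrite -/(Q x); lra.
  by rewrite memNset/= ?expR_ge0//; apply/negP; rewrite -ltNge.
have h3 := @test_value_bound R (- 5) p n p0 p1 ltac:(by rewrite normrN ger0_norm) n16.
rewrite meanD// in h1; last by move=> x; exact: powR_ge0.
have := le_trans h1 (leeD2l _ h2).
rewrite -leeBlDr// -EFinB; apply: le_trans.
rewrite lee_fin lerD2r; move: h3; set a := p * _ / _; set b := 56 * 100 * _ / _.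
by move/ler_normlP => [h3 _]; lra.
Qed.

(** With [y = x - 1], write [x^2 = 2 x - 1 + y^2], bound [x] by [pow_test 1 1 x] and [y^2] by
    [4 (exp y + exp (- y) - 2)]; the coefficients are those of the resulting sum. *)
Let sqr_le_exp_pow (x : R) : 0 <= x ->
  x ^+ 2 <= exp_pow 5 (- (8 / 3)) (- (16 / 3)) (11 / 6) (13 / 6) 0 0 x.
Proof.
move=> x0; have := le_pow_test0 ltr01 (lexx _) x0.
rewrite powRr1// /pow_test /exp_pow !mul0r !addr0.
set y := x - 1; set e1 := expR y; set e2 := expR (- y).
have e20 : 0 < e2 by exact: expR_gt0.
have e10 : 0 < e1 by exact: expR_gt0.
have cosh : y ^+ 2 <= 4 * (e1 + e2 - 2).
  pose f := expR (y / 2); pose g := expR (- (y / 2)).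
  have fg : f * g = 1 by rewrite /f /g -expRD subrr expR0.
  have ff : e1 = f ^+ 2 by rewrite /e1 /f expr2 -expRD -splitr.
  have gg : e2 = g ^+ 2 by rewrite /e2 /g expr2 -expRD -opprD -splitr.
  have -> : 4 * (e1 + e2 - 2) = 4 * (f - g) ^+ 2 by rewrite ff gg -fg; ring.
  have hf := expR_ge1Dx (y / 2); rewrite -/f in hf.
  have hg := expR_ge1Dx (- (y / 2)); rewrite -/g in hg.
  have f0 : 0 < f by exact: expR_gt0.
  have g0 : 0 < g by exact: expR_gt0.
  have [y0|y0] := leP 0 y.
    have g1 : g <= 1 by rewrite /g -[leRHS]expR0 ler_expR; lra.
    have : (y / 2) * (y / 2) <= (f - g) * (f - g) by apply: ler_pM; lra.
    by rewrite -!expr2 expr_div_n; lra.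
  have f1 : f <= 1 by rewrite /f -[leRHS]expR0 ler_expR; lra.
  have : (- (y / 2)) * (- (y / 2)) <= (g - f) * (g - f) by apply: ler_pM; lra.
  by rewrite -!expr2 sqrrN expr_div_n -[(g - f) ^+ 2]sqrrN opprB; lra.
have -> : x ^+ 2 = 2 * x - 1 + y ^+ 2 by rewrite /y; ring.
lra.
Qed.

(** [83 = 8 + 75]: the terms [t^2 / n] of the four exponential means give [8 / n], and their errors,
    with coefficients of total size [12], at most [1200 / n^2 <= 75 / n] for [n >= 16]. *)
Lemma mean_sqr_image_sqr_le :
  (mean X (fun x => (Q x ^+ 2)%R) <= (1 + 83 / n%:R)%:E)%E.
Proof.
apply: (@le_trans _ _ (\sum_(j <- terms 5 (- (8 / 3)) (- (16 / 3)) (11 / 6) (13 / 6))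
    j.1 * l j)%:E).
  apply: (mean_le_comb me e0 meanE) => [||x].
  - exact: measurable_funX.
  - by move=> x; exact: sqr_ge0.
  - by rewrite terms_e; exact: sqr_le_exp_pow.
rewrite lee_fin terms_l.
have := @chi_mgf_bound R n 1 n16 ltac:(by rewrite normr1 ler1n).
have := @chi_mgf_bound R n (- 1) n16 ltac:(by rewrite normrN normr1 ler1n).
have := @chi_mgf_bound R n 2 n16 ltac:(by rewrite ger0_norm).
have := @chi_mgf_bound R n (- 2) n16 ltac:(by rewrite normrN ger0_norm).
have nR := nR16; rewrite -exprVn; set i := n%:R^-1.
have i0 : 0 < i by rewrite invr_gt0; lra.
have i16 : i <= 1 / 16 by rewrite /i invf_ple ?posrE//; lra.
have ii : i ^+ 2 <= 1 / 16 * i by rewrite expr2 ler_pM2r.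
move=> /ler_normlP[a1 a2] /ler_normlP[b1 b2] /ler_normlP[c1 c2] /ler_normlP[d1 d2].
lra.
Qed.

End image_sqr_moments.

(* [n * image_sqr co v] is chi-square with [n] degrees of freedom; the error
   [c * p / n ^+ 2] in the exponent gets multiplied by the number of layers. *)
Definition power_moment_bounds (R : realType) (c : R) (n : nat) :=
  forall d (T : measurableType d) (P : probability T R) (K : finType)
    (X : K -> {RV P >-> R}) (co : 'I_n -> 'I_n -> K) (v : 'I_n -> R),
  mutually_independent X ->
  (forall k B, measurable B ->
    distribution P (X k) B = normal_prob 0 (Num.sqrt (n%:R^-1)) B) ->
  (forall a b a' b', co a b = co a' b' -> a = a' /\ b = b') ->
  \sum_b v b ^+ 2 = 1 ->
  (forall p, n%:R^-1 <= p -> p <= 1 ->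
    ((expR (- (p * (1 - p) / n%:R) - c * p / n%:R ^+ 2))%:E <=
       mean X (fun x => image_sqr co v x `^ p)%R)%E /\
    (mean X (fun x => image_sqr co v x `^ p)%R <=
      (expR (- (p * (1 - p) / n%:R) + c * p / n%:R ^+ 2))%:E)%E) /\
  (mean X (fun x => image_sqr co v x ^+ 2)%R <= (expR (c / n%:R))%:E)%E.

Lemma power_moments (R : realType) : exists2 c : R, 0 < c &
  \forall n \near \oo, power_moment_bounds c n.
Proof.
have [C C0 tail] := lower_tail_rate R.
(* The summand [1] gives [w <= c1 p / n] for the [w] below; the term [2 c1^2] of the final constant
   absorbs the square in [expR_neg_le_onem]. *)
have [c1 c1E] : exists c1 : R, c1 = (56 * 100 + 1) + C by exists ((56 * 100 + 1) + C).
have c10 : 0 < c1 by rewrite c1E; lra.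
exists (c1 + 2 * c1 ^+ 2); first by have := sqr_ge0 c1; lra.
near=> n => d T P K X co v indepX lawX co_inj v1.
have n16 : (16 <= n)%N by near: n; exact: nbhs_infty_ge.
have nR : 16 <= n%:R :> R by rewrite ler_nat.
have nc : 2 * c1 <= n%:R by near: n; exact: nbhs_infty_ger.
pose i : R := n%:R^-1.
have i0 : 0 < i by rewrite invr_gt0; lra.
have ci : c1 * i <= 1 / 2.
  by rewrite /i ler_pdivrMr; lra.
split; last first.
  apply: le_trans (mean_sqr_image_sqr_le indepX n16 lawX co_inj v1) _.
  rewrite lee_fin; apply: le_trans (expR_ge1Dx _).
  rewrite lerD2l ler_pM2r -/i//.
  by have := sqr_ge0 c1; lra.
move=> p ip p1; rewrite -exprVn -/i; rewrite -/i in ip.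
have p0 : 0 < p by exact: lt_le_trans ip.
have pii : p * i ^+ 2 <= p * i * 1.
  by rewrite expr2 -mulrA ler_pM2l// ler_pM2l//; rewrite /i invf_le1; lra.
split; last first.
  apply: le_trans (mean_powR_image_sqr_le indepX n16 lawX co_inj v1 p0 p1) _.
  rewrite lee_fin; apply: le_trans (expR_ge1Dx _).
  rewrite -exprVn -/i -addrA lerD2l lerD2l.
  rewrite -!(mulrA _ p) ler_pM2r; last by rewrite mulr_gt0 ?exprn_gt0.
  by have := sqr_ge0 c1; lra.
apply: le_trans (mean_powR_image_sqr_ge indepX n16 lawX co_inj v1 p0 p1).
have := tail n (leq_trans (isT : (0 < 16)%N) n16).
set t := expR (n%:R / 4) * _; rewrite -!exprVn -/i => tn.
(* [p >= 1 / n] turns the bound [C / n^3] into one proportional to [p]. *)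
have tp : t <= C * p * i ^+ 2.
  apply: (le_trans tn); rewrite exprS mulrA ler_pM2r ?exprn_gt0//.
  by rewrite ler_pM2l.
have {}tp : t <= (c1 - (56 * 100 + 1)) * p * i ^+ 2 by rewrite c1E addrC addKr.
have {}c1E : 56 * 100 + 1 <= c1 by rewrite c1E; lra.
clear tn tail C C0 nc; clearbody t.
have [w wE] : exists w, w = p * (1 - p) * i + (c1 - 1) * p * i ^+ 2.
  by exists (p * (1 - p) * i + (c1 - 1) * p * i ^+ 2).
have w0 : 0 <= w.
  have h1 : 0 <= p * (1 - p) * i by rewrite mulr_ge0 ?mulr_ge0 ?subr_ge0//; exact: ltW.
  have h2 : 0 <= (c1 - 1) * (p * i ^+ 2).
    by rewrite mulr_ge0//; [lra|rewrite mulr_ge0 ?sqr_ge0// ltW].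
  by rewrite wE; lra.
have wc : w <= p * (c1 * i).
  have : (c1 - 1) * (p * i ^+ 2) <= (c1 - 1) * (p * i * 1) by rewrite ler_wpM2l//; lra.
  have : 0 <= p * p * i by rewrite mulr_ge0 ?mulr_ge0// ltW.
  by rewrite wE; lra.
have w2 : w <= 1 / 2.
  apply: (le_trans wc); apply: le_trans ci; rewrite -[leRHS]mul1r ler_wpM2r//.
  by rewrite mulr_ge0// ltW.
rewrite lee_fin; apply: (@le_trans _ _ (1 - w)); last by rewrite wE; lra.
apply: le_trans (expR_neg_le_onem w0 w2); rewrite ler_expR.
have ww : w ^+ 2 <= p * c1 ^+ 2 * i ^+ 2.
  apply: (@le_trans _ _ ((p * (c1 * i)) ^+ 2)).
    by rewrite lerXn2r ?nnegrE// !mulr_ge0// ltW.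
  rewrite !exprMn mulrA ler_wpM2r ?sqr_ge0// ler_wpM2r ?sqr_ge0//.
  by rewrite expr2 -[leRHS]mulr1 ler_pM2l.
have pi0 : 0 <= p * i ^+ 2 by rewrite mulr_ge0 ?sqr_ge0// ltW.
clear -wE ww pi0; lra.
Unshelve. all: by end_near. Qed.

Lemma lee_wpmul2l_EFin (R : realType) (c : R) (a b : \bar R) : 0 <= c ->
  (a <= b)%E -> (c%:E * a <= c%:E * b)%E.
Proof. by move=> c0 ab; apply: (lee_wpmul2l _ ab); rewrite lee_fin. Qed.

(** * Products of Gaussian matrices *)

Section layers.
Context (R : realType) (n N m : nat).

Notation index := ('I_m * 'I_N.+1 * ('I_n * 'I_n))%type.

Definition nsq (v : 'cV[R]_n) : R := \sum_(a < n) v a 0 ^+ 2.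

Definition layer (x : index -> R) (i : 'I_m) (j : 'I_N.+1) : 'M[R]_n :=
  \matrix_(a, b) x (i, j, (a, b)).

(** The factors are numbered by ['I_N.+1], so that [j = N] applies all of them except the last;
    [inord j'] is the true layer number for [j' <= N]. *)
Fixpoint layers_image (x : index -> R) (i : 'I_m) (th : 'cV[R]_n) (j : nat) :
    'cV[R]_n :=
  if j is j'.+1 then layer x i (inord j') *m layers_image x i th j' else th.

Lemma nsq_ge0 v : 0 <= nsq v.
Proof. by apply: sumr_ge0 => a _; exact: sqr_ge0. Qed.

Lemma nsq_eq0 v : nsq v = 0 -> v = 0.
Proof.
move=> /eqP; rewrite psumr_eq0 => [/allP v0|a _]; last exact: sqr_ge0.
apply/colP => a; rewrite mxE; apply/eqP; rewrite -sqrf_eq0.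
by apply: v0; rewrite mem_index_enum.
Qed.

Lemma nsq0 : nsq 0 = 0.
Proof. by rewrite /nsq big1// => a _; rewrite mxE expr0n. Qed.

Lemma nsqZ c v : nsq (c *: v) = c ^+ 2 * nsq v.
Proof. by rewrite /nsq mulr_sumr; apply: eq_bigr => a _; rewrite mxE exprMn. Qed.

Definition coord (i : 'I_m) (j : 'I_N.+1) (a b : 'I_n) : index := (i, j, (a, b)).

Lemma coord_inj i j a b a' b' : coord i j a b = coord i j a' b' -> a = a' /\ b = b'.
Proof. by case. Qed.

Lemma nsq_layer (x : index -> R) i j v :
  nsq (layer x i j *m v) = image_sqr (coord i j) (fun b => v b 0) x.
Proof.
apply: eq_bigr => a _; congr (_ ^+ 2); rewrite mxE.
by apply: eq_bigr => b _; rewrite mxE mulrC.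
Qed.

Definition layer_block (i : 'I_m) (j : 'I_N.+1) : pred index :=
  [pred k | k.1 == (i, j)].

Lemma layer_splice i j (y x : config index R) :
  layer (splice (layer_block i j) y x) i j = layer x i j.
Proof. by apply/matrixP => a b; rewrite !mxE /splice /layer_block /= eqxx. Qed.

Lemma layers_image_splice i (j : nat) (y x : config index R) th : (j <= N)%N ->
  forall l, (l <= j)%N ->
  layers_image (splice (layer_block i (inord j)) y x) i th l = layers_image y i th l.
Proof.
move=> jN; elim=> [//|l ih lj] /=; rewrite ih ?(ltnW lj)//.
congr (_ *m _); apply/matrixP => a b; rewrite !mxE /splice /layer_block /=.
case: eqP => // -[/(congr1 val)] /=.
by rewrite !inordK ?ltnS// => [E|]; [rewrite E ltnn in lj|exact: leq_trans (ltnW lj) jN].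
Qed.

Lemma measurable_layers_image i th j a :
  measurable_fun setT (fun x : config index R => layers_image x i th j a 0).
Proof.
elim: j a => [|j ih] a /=; first exact: measurable_cst.
have -> : (fun x : config index R => (layer x i (inord j) *m layers_image x i th j) a 0) =
    (fun x => \sum_b x (i, inord j, (a, b)) * layers_image x i th j b 0).
  by apply/funext => x; rewrite mxE; apply: eq_bigr => b _; rewrite mxE.
apply: measurable_sum => b; apply: measurable_funM => //.
exact: measurable_coord.
Qed.

Lemma measurable_nsq_layers_image i th j :
  measurable_fun setT (fun x : config index R => nsq (layers_image x i th j)).
Proof.
by apply: measurable_sum => a; apply: measurable_funX; exact: measurable_layers_image.
Qed.

Section moments.
Context (d : measure_display) (T : measurableType d)
  (P : probability T R) (X : index -> {RV P >-> R}).
Hypothesis indepX : mutually_independent X.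
Hypothesis lawX : forall k B, measurable B ->
  distribution P (X k) B = normal_prob 0 (Num.sqrt (n%:R^-1)) B.
Variable c : R.
Hypothesis bounds : power_moment_bounds c n.
Hypothesis n0 : (0 < n)%N.

Let measurable_powR_nsq i th j (p : R) :
  measurable_fun setT (fun x : config index R => nsq (layers_image x i th j) `^ p).
Proof.
exact: (measurableT_comp (@measurable_powR R p) (measurable_nsq_layers_image i th j)).
Qed.

Let normalized (v : 'cV[R]_n) : v != 0 ->
  \sum_b ((Num.sqrt (nsq v))^-1 * v b 0) ^+ 2 = 1.
Proof.
move=> v0; under eq_bigr do rewrite exprMn.
rewrite -mulr_sumr exprVn sqr_sqrtr ?nsq_ge0// -/(nsq v) mulVf//.
by apply: contra_neq v0; exact: nsq_eq0.
Qed.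

Let nsq_layer_scale (v : 'cV[R]_n) x i j : v != 0 ->
  nsq (layer x i j *m v) =
  nsq v * image_sqr (coord i j) (fun b => (Num.sqrt (nsq v))^-1 * v b 0) x.
Proof.
move=> v0; have nv : nsq v != 0 by apply: contra_neq v0; exact: nsq_eq0.
rewrite nsq_layer /image_sqr mulr_sumr; apply: eq_bigr => a _.
rewrite /linear_form; under [in RHS]eq_bigr do rewrite -mulrA.
by rewrite -mulr_sumr exprMn mulrA exprVn sqr_sqrtr ?nsq_ge0// divff// mul1r.
Qed.

(** By homogeneity it suffices to treat a unit vector; the zero vector is apart, with [0^p = 0] as
    [p > 0]. *)
Lemma mean_powR_layer i j (v : 'cV[R]_n) (p : R) : n%:R^-1 <= p -> p <= 1 ->
  ((expR (- (p * (1 - p) / n%:R) - c * p / n%:R ^+ 2) * nsq v `^ p)%:E <=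
     mean X (fun x => nsq (layer x i j *m v) `^ p)%R)%E /\
  (mean X (fun x => nsq (layer x i j *m v) `^ p)%R <=
     (expR (- (p * (1 - p) / n%:R) + c * p / n%:R ^+ 2) * nsq v `^ p)%:E)%E.
Proof.
move=> np p1; have p0 : 0 < p by apply: lt_le_trans np; rewrite invr_gt0 ltr0n.
have [->|v0] := eqVneq v 0.
  rewrite nsq0 powR0 ?gt_eqF// !mulr0.
  under eq_mean do rewrite mulmx0 nsq0 powR0 ?gt_eqF//.
  by rewrite mean_cst.
have [+ _] := bounds indepX lawX (@coord_inj i j) (normalized v0).
move=> /(_ p np p1); set Q := image_sqr _ _ => -[h1 h2].
have -> : mean X (fun x => nsq (layer x i j *m v) `^ p)%R =
    ((nsq v `^ p)%:E * mean X (fun x => Q x `^ p)%R)%E.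
  rewrite -meanZ ?powR_ge0//.
  - apply: eq_mean => x; rewrite nsq_layer_scale// powRM ?nsq_ge0//.
    exact: image_sqr_ge0.
  - apply: (measurableT_comp (@measurable_powR R p)); exact: measurable_image_sqr.
  - by move=> x; exact: powR_ge0.
by split; rewrite (mulrC _ (nsq v `^ p)) EFinM lee_wpmul2l_EFin ?powR_ge0.
Qed.

Lemma mean_sqr_layer i j (v : 'cV[R]_n) :
  (mean X (fun x => nsq (layer x i j *m v) ^+ 2)%R <=
     (expR (c / n%:R) * nsq v ^+ 2)%:E)%E.
Proof.
have [->|v0] := eqVneq v 0.
  rewrite nsq0 expr0n mulr0; under eq_mean do rewrite mulmx0 nsq0 expr0n.
  by rewrite mean_cst.
have [_] := bounds indepX lawX (@coord_inj i j) (normalized v0).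
set Q := image_sqr _ _ => h.
have -> : mean X (fun x => nsq (layer x i j *m v) ^+ 2)%R =
    ((nsq v ^+ 2)%:E * mean X (fun x => Q x ^+ 2)%R)%E.
  rewrite -meanZ ?sqr_ge0//.
  - by apply: eq_mean => x; rewrite nsq_layer_scale// exprMn.
  - by apply: measurable_funX; exact: measurable_image_sqr.
  - by move=> x; exact: sqr_ge0.
by rewrite (mulrC _ (nsq v ^+ 2)) [leRHS]EFinM lee_wpmul2l_EFin ?sqr_ge0.
Qed.

(** One layer at a time: resampling layer [j] leaves the image under the earlier layers fixed, and
    [mean_powR_layer] applies to that fixed vector. *)
Lemma mean_powR_layers_image i th (p : R) j : n%:R^-1 <= p -> p <= 1 -> (j <= N)%N ->
  ((expR (j%:R * (- (p * (1 - p) / n%:R) - c * p / n%:R ^+ 2)) * nsq th `^ p)%:E <=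
     mean X (fun x => nsq (layers_image x i th j) `^ p)%R)%E /\
  (mean X (fun x => nsq (layers_image x i th j) `^ p)%R <=
     (expR (j%:R * (- (p * (1 - p) / n%:R) + c * p / n%:R ^+ 2)) * nsq th `^ p)%:E)%E.
Proof.
move=> np p1; set lo := _ - _; set hi := _ + _.
elim: j => [_|j ih jN].
  by rewrite !mul0r expR0 !mul1r /= mean_cst.
have [h1 h2] := ih (ltnW jN).
have expRS e : expR (j.+1%:R * e) = expR e * expR (j%:R * e) :> R.
  by rewrite -expRD; congr expR; rewrite -natr1; ring.
rewrite !expRS -!(mulrA (expR _)); split.
  apply: (@le_trans _ _ ((expR lo)%:E *
      mean X (fun x => nsq (layers_image x i th j) `^ p)%R)%E).
    by rewrite EFinM lee_wpmul2l_EFin ?expR_ge0.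
  rewrite -meanZ; [|exact: expR_ge0|exact: measurable_powR_nsq|by move=> x; exact: powR_ge0].
  apply: (mean_splice_ge indepX (B := layer_block i (inord j))).
  - exact: measurable_powR_nsq.
  - by apply: measurable_funM; [exact: measurable_cst|exact: measurable_powR_nsq].
  - by move=> x; exact: powR_ge0.
  - by move=> x; rewrite mulr_ge0 ?expR_ge0 ?powR_ge0.
  move=> y; under eq_mean do rewrite /= layer_splice layers_image_splice ?ltnS// ?(ltnW jN)//.
  by have [] := mean_powR_layer i (inord j) (layers_image y i th j) np p1.
apply: (@le_trans _ _ ((expR hi)%:E *
    mean X (fun x => nsq (layers_image x i th j) `^ p)%R)%E); last first.
  by rewrite EFinM lee_wpmul2l_EFin ?expR_ge0.
rewrite -meanZ; [|exact: expR_ge0|exact: measurable_powR_nsq|by move=> x; exact: powR_ge0].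
apply: (mean_splice_le indepX (B := layer_block i (inord j))).
- exact: measurable_powR_nsq.
- by apply: measurable_funM; [exact: measurable_cst|exact: measurable_powR_nsq].
- by move=> x; exact: powR_ge0.
move=> y; under eq_mean do rewrite /= layer_splice layers_image_splice ?ltnS// ?(ltnW jN)//.
by have [] := mean_powR_layer i (inord j) (layers_image y i th j) np p1.
Qed.

Lemma mean_sqr_layers_image i th j : (j <= N)%N ->
  (mean X (fun x => nsq (layers_image x i th j) ^+ 2)%R <=
     (expR (j%:R * (c / n%:R)) * nsq th ^+ 2)%:E)%E.
Proof.
have mS l : measurable_fun setT (fun x : config index R => nsq (layers_image x i th l) ^+ 2).
  by apply: measurable_funX; exact: measurable_nsq_layers_image.
elim: j => [_|j ih jN]; first by rewrite mul0r expR0 mul1r /= mean_cst.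
have -> : expR (j.+1%:R * (c / n%:R)) = expR (c / n%:R) * expR (j%:R * (c / n%:R)).
  by rewrite -expRD; congr expR; rewrite -natr1; ring.
apply: (@le_trans _ _ ((expR (c / n%:R))%:E *
    mean X (fun x => nsq (layers_image x i th j) ^+ 2)%R)%E); last first.
  by rewrite -mulrA EFinM lee_wpmul2l_EFin ?expR_ge0// ih// ltnW.
rewrite -meanZ ?expR_ge0//; last by move=> x; exact: sqr_ge0.
apply: (mean_splice_le indepX (B := layer_block i (inord j))) => //.
- exact: measurable_funM.
- by move=> x; exact: sqr_ge0.
move=> y; under eq_mean do rewrite /= layer_splice layers_image_splice ?ltnS// ?(ltnW jN)//.
exact: mean_sqr_layer.
Qed.

End moments.

End layers.

(** * Markov and Chebyshev inequalities *)

Section lower_tail.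
Context (d : measure_display) (T : measurableType d) (R : realType)
  (P : probability T R) (K : finType) (X : K -> {RV P >-> R}).

Lemma measurable_sample_preimage (A : set (config K R)) :
  measurable A -> measurable (sample X @^-1` A).
Proof. by move=> mA; have := measurable_sample X measurableT mA; rewrite setTI. Qed.

Lemma probability_le_mean (A : set (config K R)) (f : config K R -> R) :
  measurable A -> measurable_fun setT f -> (forall x, 0 <= f x) ->
  (forall x, A x -> 1 <= f x) -> (P (sample X @^-1` A) <= mean X f)%E.
Proof.
move=> mA mf f0 fA; have mA' := measurable_sample_preimage mA.
rewrite -[sample X @^-1` A]setIT -integral_indic//.
apply: ge0_le_integral => //.
- exact/measurable_EFinP/measurable_indic.
- exact: measurable_sampled.
- move=> w _; rewrite lee_fin indicE; have [/set_mem wA|//] := boolP (w \in _).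
  exact: fA.
Qed.

Lemma mean_indic (A : set (config K R)) : measurable A ->
  mean X (\1_A) = P (sample X @^-1` A).
Proof.
move=> mA; have mA' := measurable_sample_preimage mA.
by rewrite -[sample X @^-1` A]setIT -integral_indic.
Qed.

Variables (I : finType) (W : I -> config K R -> R) (w q : I -> R).
Hypothesis mW : forall i, measurable_fun setT (W i).
Hypothesis W0 : forall i x, 0 <= W i x.
Hypothesis meanW : forall i, mean X (W i) = (w i)%:E.
Hypothesis meanW2 : forall i, (mean X (fun x => W i x ^+ 2)%R <= (q i)%:E)%E.
Hypothesis meanWW : forall i j, i != j ->
  mean X (fun x => W i x * W j x) = (w i * w j)%:E.

Let S x := \sum_i W i x.
Let mu := \sum_i w i.

Let mS : measurable_fun setT S. Proof. exact: measurable_sum. Qed.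
Let S0 x : 0 <= S x. Proof. by apply: sumr_ge0 => i _. Qed.

Let w0 i : 0 <= w i.
Proof. by rewrite -lee_fin -meanW; exact: mean_ge0. Qed.

Let mean_S : mean X S = mu%:E.
Proof. by rewrite mean_sum// -sumEFin; apply: eq_bigr => i _. Qed.

Let mean_S2 : (mean X (fun x => S x ^+ 2)%R <= (\sum_i q i + mu ^+ 2)%:E)%E.
Proof.
have mWW i j : measurable_fun setT (fun x => W i x * W j x) by exact: measurable_funM.
have WW0 i j x : 0 <= W i x * W j x by exact: mulr_ge0.
have -> : mean X (fun x => S x ^+ 2) =
    (\sum_i \sum_j mean X (fun x => (W i x * W j x)%R))%E.
  under [RHS]eq_bigr do rewrite -mean_sum//.
  rewrite -mean_sum; first last.
  - by move=> i x; exact: sumr_ge0.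
  - by move=> i; exact: measurable_sum.
  apply: eq_mean => x; rewrite expr2 /S mulr_suml; apply: eq_bigr => i _.
  by rewrite mulr_sumr.
have -> : (\sum_i q i + mu ^+ 2)%:E = (\sum_i ((q i)%:E + \sum_j (w i * w j)%:E))%E.
  under [RHS]eq_bigr do rewrite sumEFin -EFinD.
  rewrite sumEFin big_split/= expr2 /mu mulr_suml; congr (_ + _)%:E.
  by apply: eq_bigr => i _; rewrite mulr_sumr.
apply: lee_sum => i _.
rewrite (bigD1 i)//= [in leRHS](bigD1 i)//=; apply: leeD.
  exact: meanW2.
apply: (@le_trans _ _ (\sum_(j | j != i) (w i * w j)%:E)%E).
  by apply: lee_sum => j ji; rewrite meanWW// eq_sym.
by rewrite leeDr// lee_fin mulr_ge0.
Qed.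

(** The mean of [(mu - S)^2] is bounded after moving [2 mu S] to the other side, which keeps every
    function nonnegative. The diagonal of [S^2] is bounded by the [q i], and the products over
    distinct pairs have means adding up to at most [mu^2]. *)
Lemma chebyshev_lower_tail (e : R) : 0 < e -> 0 < mu ->
  (P (sample X @^-1` [set x | (S x <= (1 - e) * mu)%R]) <=
    ((\sum_i q i) / (e ^+ 2 * mu ^+ 2))%:E)%E.
Proof.
move=> e0 mu0; pose D := e ^+ 2 * mu ^+ 2.
have D0 : 0 < D by rewrite mulr_gt0 ?exprn_gt0.
have mf : measurable_fun setT (fun x => (mu - S x) ^+ 2).
  by apply: measurable_funX; exact: measurable_funB.
have f0 x : 0 <= (mu - S x) ^+ 2 by exact: sqr_ge0.
have h1 : (mean X (fun x => (mu - S x) ^+ 2)%R <= (\sum_i q i)%:E)%E.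
  have h2 : (mean X (fun x => (mu - S x) ^+ 2 + 2 * mu * S x)%R <=
      (\sum_i q i + mu ^+ 2 + mu ^+ 2)%:E)%E.
    have -> : mean X (fun x => (mu - S x) ^+ 2 + 2 * mu * S x) =
        mean X (fun x => S x ^+ 2 + mu ^+ 2) by apply: eq_mean => x; ring.
    rewrite meanD//; last first.
    - by move=> x; exact: sqr_ge0.
    - by move=> x; exact: sqr_ge0.
    - exact: measurable_funX.
    by rewrite mean_cst [leRHS]EFinD; apply: leeD.
  have mu2 : 0 <= 2 * mu by rewrite mulr_ge0// ltW.
  rewrite meanD// in h2; last first.
  - by move=> x; rewrite mulr_ge0.
  - exact: measurable_funM.
  rewrite meanZ// mean_S -EFinM -leeBrDr// -EFinB in h2.
  by apply: (le_trans h2); rewrite lee_fin; lra.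
apply: (@le_trans _ _ (mean X (fun x => D^-1 * (mu - S x) ^+ 2)%R)).
  apply: probability_le_mean.
  - have := mS measurableT (measurable_itv `]-oo, ((1 - e) * mu)]).
    by rewrite setTI.
  - exact: measurable_funM.
  - by move=> x; rewrite mulr_ge0// invr_ge0 ltW.
  - move=> x /= Sx; rewrite -(mulVf (lt0r_neq0 D0)) ler_pM2l ?invr_gt0//.
    rewrite /D -exprMn lerXn2r ?nnegrE ?mulr_ge0//; try exact: ltW.
      by have := mulr_ge0 (ltW e0) (ltW mu0); lra.
    by lra.
rewrite meanZ//; last by rewrite invr_ge0 ltW.
by rewrite [X in (_ <= X%:E)%E]mulrC EFinM lee_wpmul2l_EFin// invr_ge0 ltW.
Qed.

End lower_tail.

Section product_sum.
Context (R : realType) (n N m : nat).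
Notation index := ('I_m * 'I_N.+1 * ('I_n * 'I_n))%type.
Implicit Types th : 'cV[R]_n.

Definition product_sum (x : index -> R) : 'M[R]_n :=
  (Num.sqrt m%:R)^-1 *: \sum_(i < m) mx_chain (layer x i).

Lemma mx_chain_image (x : index -> R) i th :
  mx_chain (layer x i) *m th =
  layer x i ord_max *m layers_image x i th N.
Proof.
(* Stated for a chain of any length [l], where [l.-1 - j] is the reversed index, to allow
   induction. *)
have chainE l : (\big[mulmx/1%:M]_(j < l) layer x i (inord (l.-1 - j))) *m th =
    layers_image x i th l.
  elim: l => [|l ih]; first by rewrite big_ord0 mul1mx.
  rewrite big_ord_recl/= subn0 -mulmxA -ih; congr (_ *m (_ *m _)).
  by apply: eq_bigr => j _; rewrite /bump/= add1n -subn1 -subnDA add1n.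
rewrite -[RHS]/(layer x i ord_max *m layers_image x i th N).
have -> : layer x i ord_max *m layers_image x i th N = layers_image x i th N.+1.
  by rewrite /= (_ : inord N = ord_max)//; apply: val_inj; rewrite /= inordK.
rewrite -chainE; congr (_ *m _); apply: eq_bigr => j _; congr layer.
by apply: val_inj; rewrite /= inordK ?subSS// ltnS leq_subr.
Qed.

Definition image_norms (th : 'cV[R]_n) (i : 'I_m) (x : index -> R) : R :=
  nsq (layers_image x i th N).

Definition mean_square (th : 'cV[R]_n) (x : index -> R) : R :=
  m%:R^-1 * \sum_i image_norms th i x.

Definition last_coord (a : 'I_n) (ib : 'I_m * 'I_n) : index :=
  (ib.1, ord_max, (a, ib.2)).

(** The coefficient of the entry [last_coord a ib] in coordinate [a] of the image of [th]. It is the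
    same for all [a] and only involves the factors before the last, so each coordinate is
    conditionally a centred Gaussian. *)
Definition last_coef (th : 'cV[R]_n) (y : index -> R) (ib : 'I_m * 'I_n) : R :=
  (Num.sqrt m%:R)^-1 * layers_image y ib.1 th N ib.2 0.

Definition last_block : pred index := [pred k | k.1.2 == ord_max].

Lemma product_sumE (x : index -> R) th a :
  (product_sum x *m th) a 0 =
  linear_form (last_coord a) (last_coef th x) (index_enum _) x.
Proof.
rewrite /product_sum -scalemxAl mulmx_suml mxE summxE mulr_sumr.
rewrite /linear_form -(pair_bigA _ (fun i b => last_coef th x (i, b) * x (last_coord a (i, b))))/=.
apply: eq_bigr => i _; rewrite mx_chain_image mxE mulr_sumr.
by apply: eq_bigr => b _; rewrite /last_coef/= mxE; ring.
Qed.

Lemma layers_image_splice_last (y x : config index R) i th :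
  layers_image (splice last_block y x) i th N = layers_image y i th N.
Proof.
suff H l : (l <= N)%N ->
    layers_image (splice last_block y x) i th l = layers_image y i th l by exact: H.
elim: l => [//|l ih lN] /=; rewrite ih ?(ltnW lN)//; congr (_ *m _).
apply/matrixP => a b; rewrite !mxE /splice /last_block /=.
case: eqP => // /(congr1 val) /=; rewrite inordK ?(leq_trans lN)// => E.
by rewrite E ltnn in lN.
Qed.

Lemma linear_form_splice_last (y x : config index R) th a :
  (product_sum (splice last_block y x) *m th) a 0 =
  linear_form (last_coord a) (last_coef th y) (index_enum _) x.
Proof.
rewrite product_sumE; apply: eq_bigr => -[i b] _.
rewrite /last_coef layers_image_splice_last; congr (_ * _).
by rewrite /splice /last_block /= eqxx.
Qed.

Lemma sum_sqr_last_coef th (y : index -> R) :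
  \sum_(ib <- index_enum _) last_coef th y ib ^+ 2 = mean_square th y.
Proof.
rewrite -(pair_bigA _ (fun i b => last_coef th y (i, b) ^+ 2))/= /mean_square.
rewrite mulr_sumr; apply: eq_bigr => i _.
rewrite /image_norms /nsq mulr_sumr; apply: eq_bigr => b _.
by rewrite /last_coef/= exprMn exprVn sqr_sqrtr.
Qed.

Lemma mean_square_ge0 th (x : index -> R) : 0 <= mean_square th x.
Proof. by rewrite mulr_ge0 ?invr_ge0// sumr_ge0// => i _; exact: nsq_ge0. Qed.

Lemma measurable_image_norms th i :
  measurable_fun setT (fun x : config index R => image_norms th i x).
Proof. exact: measurable_nsq_layers_image. Qed.

Lemma measurable_mean_square th :
  measurable_fun setT (fun x : config index R => mean_square th x).
Proof.
apply: measurable_funM => //; apply: measurable_sum => i.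
exact: measurable_image_norms.
Qed.

Lemma measurable_product_sum th a :
  measurable_fun setT (fun x : config index R => (product_sum x *m th) a 0).
Proof.
have -> : (fun x : config index R => (product_sum x *m th) a 0) =
    (fun x => \sum_(ib <- index_enum _) last_coef th x ib * x (last_coord a ib)).
  by apply/funext => x; rewrite product_sumE.
apply: measurable_sum => ib; apply: measurable_funM; last exact: measurable_coord.
by apply: measurable_funM => //; exact: measurable_layers_image.
Qed.

Section moments.
Context (d : measure_display) (T : measurableType d)
  (P : probability T R) (X : index -> {RV P >-> R}).
Hypothesis indepX : mutually_independent X.
Hypothesis lawX : forall k B, measurable B ->
  distribution P (X k) B = normal_prob 0 (Num.sqrt (n%:R^-1)) B.
Hypothesis n0 : (0 < n)%N.

Let nR0 : 0 < n%:R :> R. Proof. by rewrite ltr0n. Qed.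

Lemma mean_last_expR th (y : config index R) a (t : R) : 0 < 1 + t * (mean_square th y / n%:R) ->
  mean X (fun x => expR (- (t / 2 *
    (product_sum (splice last_block y x) *m th) a 0 ^+ 2))) =
  ((Num.sqrt (1 + t * (mean_square th y / n%:R)))^-1)%:E.
Proof.
move=> h.
have s2 : Num.sqrt (n%:R^-1) ^+ 2 = n%:R^-1 :> R by rewrite sqr_sqrtr// invr_ge0 ltW.
have E : t * (mean_square th y / n%:R) = t * (Num.sqrt (n%:R^-1) ^+ 2 *
    \sum_(ib <- index_enum _) last_coef th y ib ^+ 2).
  by rewrite sum_sqr_last_coef s2 (mulrC n%:R^-1).
rewrite E in h *; rewrite -(mean_expR_sqr indepX _ lawX (co := last_coord a) _ h).
- by apply: eq_mean => x; rewrite linear_form_splice_last.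
- by rewrite sqrtr_gt0 invr_gt0.
- rewrite map_inj_uniq ?index_enum_uniq// => -[i b] [i' b'] [].
  by move=> -> ->.
Qed.

(** Markov's inequality for [exp (- tau r^2 / 2)], with [tau] the inverse of the level, so that the
    exponential is at least [exp (- 1 / 2) >= 1 / 2] on the event. Given the earlier factors its
    mean is [(1 + tau S / n)^(-1/2)], which is at most [t] when [S >= s] and at most [1]
    otherwise. *)
Lemma small_ball th a (t s : R) : 0 < t -> 0 < s ->
  (P (sample X @^-1` [set x | ((product_sum x *m th) a 0 ^+ 2 <= t ^+ 2 * s / n%:R)%R])
   <= 2%:E * (t%:E + P (sample X @^-1` [set x | (mean_square th x < s)%R])))%E.
Proof.
move=> t0 s0; pose tau : R := n%:R / (t ^+ 2 * s).
have ts0 : 0 < t ^+ 2 * s by rewrite mulr_gt0 ?exprn_gt0.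
have tau0 : 0 < tau by rewrite divr_gt0.
pose e2 := expR (2^-1 : R).
have e20 : 0 < e2 by exact: expR_gt0.
have e22 : e2 <= 2.
  have h := expR_ge1Dx (- (2^-1 : R)).
  have h' : expR (- 2^-1) * e2 = 1 :> R by rewrite -expRD addNr expR0.
  have : (1 + - 2^-1) * e2 <= expR (- 2^-1) * e2 by rewrite ler_pM2r.
  by rewrite h'; lra.
pose g x : R := expR (- (tau / 2 * (product_sum x *m th) a 0 ^+ 2)).
have mg : measurable_fun setT (g : config index R -> R).
  apply: measurableT_comp => //; apply: measurableT_comp => //.
  by apply: measurable_funM => //; apply: measurable_funX; exact: measurable_product_sum.
pose A := [set x : config index R | mean_square th x < s].
have mA : measurable A.
  have := measurable_mean_square th measurableT (measurable_itv `]-oo, s[).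
  by rewrite setTI.
have mE : measurable [set x : config index R | (product_sum x *m th) a 0 ^+ 2 <= t ^+ 2 * s / n%:R].
  have mr : measurable_fun setT (fun x : config index R => (product_sum x *m th) a 0 ^+ 2).
    by apply: measurable_funX; exact: measurable_product_sum.
  have := mr measurableT _ (measurable_itv `]-oo, (t ^+ 2 * s / n%:R)]).
  by rewrite setTI.
apply: (@le_trans _ _ (mean X (fun x => (e2 * g x)%R))).
  apply: probability_le_mean => //.
  - exact: measurable_funM.
  - by move=> x; rewrite mulr_ge0 ?expR_ge0.
  - move=> x /= h; rewrite /g -expRD -[leLHS]expR0 ler_expR subr_ge0.
    have : tau * (product_sum x *m th) a 0 ^+ 2 <= tau * (t ^+ 2 * s / n%:R).
      by rewrite ler_pM2l.
    have -> : tau * (t ^+ 2 * s / n%:R) = 1.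
      by rewrite /tau; field; rewrite !gt_eqF.
    by lra.
have m1 : measurable_fun setT (\1_A : config index R -> R) by exact: measurable_indic.
rewrite -/A -mean_indic// -(mean_cst X t) -meanD; first last.
- by move=> x; rewrite indicE.
- by move=> x; exact: ltW.
- exact: m1.
- exact: measurable_cst.
rewrite -meanZ; first last.
- by move=> x; rewrite addr_ge0 ?indicE// ltW.
- exact: measurable_funD.
- by [].
apply: (mean_splice_le indepX (B := last_block)).
- exact: measurable_funM.
- by apply: measurable_funM => //; exact: measurable_funD.
- by move=> x; rewrite mulr_ge0 ?expR_ge0.
move=> y; rewrite meanZ; last 3 first.
- exact: expR_ge0.
- by apply: (measurableT_comp mg); exact: measurable_splice.
- by move=> x; exact: expR_ge0.
have S0 := mean_square_ge0 th y; set S := mean_square th y in S0.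
have D0 : 0 < 1 + tau * (S / n%:R).
  by rewrite ltr_pwDl// mulr_ge0 ?divr_ge0// ltW.
rewrite /g mean_last_expR// -EFinM lee_fin.
apply: ler_pM; [exact: ltW|by rewrite invr_ge0 sqrtr_ge0|exact: e22|].
rewrite indicE; have [yA|yA] := boolP (y \in A).
  apply: (@le_trans _ _ 1); last by rewrite lerDr ltW.
  rewrite invf_le1 ?sqrtr_gt0// -[leLHS]sqrtr1 ler_sqrt; last exact: ltW.
  by rewrite lerDl mulr_ge0 ?divr_ge0// ltW.
rewrite addr0.
have Ss : s <= S by rewrite leNgt; apply/negP => h; move/negP: yA; apply; rewrite inE.
rewrite -[leRHS]invrK lef_pV2 ?posrE ?invr_gt0 ?sqrtr_gt0//.
rewrite -(ger0_norm (ltW _ : 0 <= t^-1)) ?invr_gt0// -sqrtr_sqr ler_sqrt; last exact: ltW.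
have -> : tau * (S / n%:R) = S / s * t^-1 ^+ 2.
  by rewrite /tau; field; rewrite !gt_eqF.
have : 1 * t^-1 ^+ 2 <= S / s * t^-1 ^+ 2.
  by rewrite ler_pM2r ?exprn_gt0 ?invr_gt0// ler_pdivlMr// mul1r.
by rewrite mul1r; lra.
Qed.

End moments.

End product_sum.
Arguments last_block {n N m}.

(** * Upper bounds on the moments of the image of a fixed vector *)

Section powR_sums.
Context (R : realType).

Lemma powR_sub_add (a b p : R) : 0 <= a -> 0 <= b -> 0 < p -> p <= 1 ->
  (a + b) `^ p <= a `^ p + b `^ p.
Proof.
move=> a0 b0 p0 p1; have := addr_ge0 a0 b0; rewrite le_eqVlt => /predU1P[<-|ab].
  by rewrite powR0 ?gt_eqF// addr_ge0 ?powR_ge0.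
have H (z : R) : 0 <= z -> z <= a + b -> z / (a + b) * (a + b) `^ p <= z `^ p.
  move=> z0 zab; have [->|zn0] := eqVneq z 0; first by rewrite mul0r mul0r powR_ge0.
  have zz : z = (a + b) * (z / (a + b)) by rewrite mulrC divfK// gt_eqF.
  have q0 : 0 < z / (a + b) by rewrite divr_gt0// lt_neqAle eq_sym zn0.
  rewrite [in leRHS]zz powRM//; try exact: ltW.
  rewrite mulrC ler_wpM2l ?powR_ge0// ger1_powR//.
  by rewrite q0 ler_pdivrMr// mul1r.
have := lerD (H a a0 ltac:(by rewrite lerDl)) (H b b0 ltac:(by rewrite lerDr)).
by rewrite -mulrDl -mulrDl divff ?gt_eqF// mul1r.
Qed.

Lemma powR_sum_le (I : Type) (r : seq I) (f : I -> R) (p : R) :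
  (forall i, 0 <= f i) -> 0 < p -> p <= 1 ->
  (\sum_(i <- r) f i) `^ p <= \sum_(i <- r) f i `^ p.
Proof.
move=> f0 p0 p1; elim: r => [|i r ih]; first by rewrite !big_nil powR0 ?gt_eqF.
rewrite !big_cons; apply: (le_trans (powR_sub_add _ _ p0 p1)) => //.
  exact: sumr_ge0.
by rewrite lerD2l.
Qed.

(** Substitute for Jensen's inequality: with [c] of the order of the mean of [y], it bounds the mean
    of [y^p] by a multiple of [c^p], uniformly in [p]. *)
Lemma powR_le_affine (y c p : R) : 0 <= y -> 0 < c -> 0 < p -> p <= 1 ->
  y `^ p <= c `^ p * (1 + y / c).
Proof.
move=> y0 c0 p0 p1.
have zz : y = c * (y / c) by rewrite mulrC divfK// gt_eqF.
have q0 : 0 <= y / c by rewrite divr_ge0// ltW.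
rewrite [in leLHS]zz powRM//; last exact: ltW.
rewrite ler_wpM2l ?powR_ge0//.
have [q1|q1] := leP (y / c) 1.
  apply: (@le_trans _ _ 1); last by rewrite lerDl.
  have <- : 1 `^ p = 1 :> R by rewrite powR1.
  by apply: ge0_ler_powR; rewrite ?nnegrE//; exact: ltW.
apply: (@le_trans _ _ (y / c)); last by rewrite lerDr.
by apply: ler1_powR => //; exact: ltW.
Qed.

End powR_sums.

Section upper_moment.
Context (R : realType) (n N m : nat).
Notation index := ('I_m * 'I_N.+1 * ('I_n * 'I_n))%type.
Implicit Types th : 'cV[R]_n.
Context (d : measure_display) (T : measurableType d)
  (P : probability T R) (X : index -> {RV P >-> R}).
Hypothesis indepX : mutually_independent X.
Hypothesis lawX : forall k B, measurable B ->
  distribution P (X k) B = normal_prob 0 (Num.sqrt (n%:R^-1)) B.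
Hypothesis n0 : (0 < n)%N.

Let nR0 : 0 < n%:R :> R. Proof. by rewrite ltr0n. Qed.

Lemma nsq_product_sum_splice0 th (y x : config index R) :
  mean_square th y = 0 -> nsq (product_sum (splice last_block y x) *m th) = 0.
Proof.
rewrite -sum_sqr_last_coef => /eqP; rewrite psumr_eq0 => [/allP c0|ib _]; last exact: sqr_ge0.
rewrite /nsq big1// => a _; rewrite linear_form_splice_last /linear_form big1 ?expr0n// => ib _.
have := c0 ib (mem_index_enum _); rewrite sqrf_eq0 => /eqP ->.
by rewrite mul0r.
Qed.

Lemma measurable_nsq_product_sum th :
  measurable_fun setT (fun x : config index R => nsq (product_sum x *m th)).
Proof.
by apply: measurable_sum => a; apply: measurable_funX; exact: measurable_product_sum.
Qed.

(** The constant [6] stands for the exact value [1] because the second moment is read off an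
    exponential one: [r^2 <= 4 v exp (r^2 / (4 v))] for a coordinate of variance [v], and this
    exponential has mean [sqrt 2 <= 3 / 2]. *)
Let mean_nsq_last th (y : config index R) : mean_square th y != 0 ->
  (mean X (fun x => nsq (product_sum (splice last_block y x) *m th)) <=
   (6 * mean_square th y)%:E)%E.
Proof.
move=> S0; have S1 : 0 < mean_square th y by rewrite lt_neqAle eq_sym S0 mean_square_ge0.
set S := mean_square th y in S0 S1 *.
pose v := S / n%:R; have v0 : 0 < v by rewrite divr_gt0.
have mr a : measurable_fun setT
    (fun x : config index R => (product_sum (splice last_block y x) *m th) a 0).
  by apply: (measurableT_comp (measurable_product_sum th a)); exact: measurable_splice.
rewrite mean_sum; first last.
- by move=> a x; exact: sqr_ge0.
- by move=> a; exact: measurable_funX.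
have -> : (6 * S)%:E = (\sum_(a < n) (6 * v)%:E)%E.
  rewrite sumEFin sumr_const card_ord -mulr_natr /v; congr _%:E.
  by field; rewrite gt_eqF.
apply: lee_sum => a _.
have h : 0 < 1 + - (1 / (2 * v)) * (mean_square th y / n%:R).
  rewrite -/S -/v (_ : 1 + _ = 1 / 2); first by lra.
  by field; rewrite gt_eqF.
have E := mean_last_expR indepX lawX n0 a h.
apply: (@le_trans _ _ (mean X (fun x => 4 * v * expR (- (- (1 / (2 * v)) / 2 *
    (product_sum (splice last_block y x) *m th) a 0 ^+ 2)))%R)).
  apply: le_mean.
  - exact: measurable_funX.
  - apply: measurable_funM => //; apply: measurableT_comp => //.
    apply: measurableT_comp => //; apply: measurable_funM => //.
    exact: measurable_funX.
  - by move=> x; exact: sqr_ge0.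
  move=> x; set r2 := _ ^+ 2.
  have -> : - (- (1 / (2 * v)) / 2 * r2) = r2 / (4 * v) by field; rewrite gt_eqF.
  have v40 : 0 < 4 * v by rewrite mulr_gt0.
  rewrite mulrC -ler_pdivrMr//.
  by apply: le_trans (expR_ge1Dx _); rewrite lerDr.
rewrite meanZ; first last.
- by move=> x; exact: expR_ge0.
- apply: measurableT_comp => //.
  apply: measurableT_comp => //; apply: measurable_funM => //.
  exact: measurable_funX.
- by rewrite mulr_ge0// ltW.
rewrite E -EFinM lee_fin.
have -> : 1 + - (1 / (2 * v)) * (mean_square th y / n%:R) = 2^-1.
  by rewrite -/S -/v; field; rewrite gt_eqF.
have s2 : Num.sqrt (2^-1) ^+ 2 = 2^-1 :> R by rewrite sqr_sqrtr.
have s0 : 0 < Num.sqrt (2^-1) :> R by rewrite sqrtr_gt0.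
have s23 : 2 / 3 <= Num.sqrt (2^-1) :> R.
  rewrite -(ger0_norm (_ : 0 <= 2 / 3)) // -sqrtr_sqr ler_sqrt; lra.
have : (Num.sqrt (2^-1))^-1 <= 3 / 2 :> R.
  by rewrite invf_ple ?posrE//; lra.
move=> h1; have := ler_wpM2l (ltW v0) h1; lra.
Qed.

(** [powR_le_affine] at scale [S] reduces to the mean squared norm, whence [7 = 1 + 6]. When [S = 0]
    the image is zero whatever the last factors are. *)
Lemma mean_powR_product_sum_le th (p : R) : 0 < p -> p <= 1 ->
  (mean X (fun x => nsq (product_sum x *m th) `^ p)%R <=
   mean X (fun x => 7 * mean_square th x `^ p)%R)%E.
Proof.
move=> p0 p1.
have mn : measurable_fun setT (fun x : config index R => nsq (product_sum x *m th) `^ p).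
  exact: (measurableT_comp (@measurable_powR R p) (measurable_nsq_product_sum th)).
apply: (mean_splice_le indepX (B := last_block)).
- exact: mn.
- apply: measurable_funM => //.
  exact: (measurableT_comp (@measurable_powR R p) (measurable_mean_square th)).
- by move=> x; exact: powR_ge0.
move=> y; have [S0|S0] := eqVneq (mean_square th y) 0.
  under eq_mean do rewrite nsq_product_sum_splice0// powR0 ?gt_eqF//.
  by rewrite mean_cst lee_fin mulr_ge0 ?powR_ge0.
have S1 : 0 < mean_square th y by rewrite lt_neqAle eq_sym S0 mean_square_ge0.
set S := mean_square th y in S0 S1 *.
have ms : measurable_fun setT (fun x : config index R =>
    nsq (product_sum (splice last_block y x) *m th)).
  by apply: (measurableT_comp (measurable_nsq_product_sum th)); exact: measurable_splice.
apply: (@le_trans _ _ (mean X (fun x => S `^ p * (1 +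
    S^-1 * nsq (product_sum (splice last_block y x) *m th)))%R)).
  apply: le_mean.
  - by apply: (measurableT_comp mn); exact: measurable_splice.
  - by apply: measurable_funM => //; apply: measurable_funD => //; exact: measurable_funM.
  - by move=> x; exact: powR_ge0.
  by move=> x; rewrite (mulrC S^-1); apply: powR_le_affine => //; exact: nsq_ge0.
rewrite meanZ; first last.
- by move=> x; rewrite addr_ge0// mulr_ge0 ?nsq_ge0// invr_ge0 ltW.
- by apply: measurable_funD => //; exact: measurable_funM.
- exact: powR_ge0.
rewrite [X in (_ <= X%:E)%E]mulrC EFinM lee_wpmul2l_EFin ?powR_ge0//.
rewrite meanD; first last.
- by move=> x; rewrite mulr_ge0 ?nsq_ge0// invr_ge0 ltW.
- by [].
- exact: measurable_funM.
- exact: measurable_cst.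
rewrite mean_cst meanZ; first last.
- by move=> x; exact: nsq_ge0.
- exact: ms.
- by rewrite invr_ge0 ltW.
have := lee_wpmul2l_EFin (_ : 0 <= S^-1) (mean_nsq_last S0).
rewrite invr_ge0 => /(_ (ltW S1)) h.
apply: (le_trans (leeD2l _ h)); rewrite -/S -EFinM -EFinD lee_fin.
by rewrite mulrCA mulVf// mulr1; lra.
Qed.

Variable c : R.
Hypothesis bounds : power_moment_bounds c n.
Hypothesis m0 : (0 < m)%N.

Lemma mean_powR_product_sum th (p : R) : n%:R^-1 <= p -> p <= 1 ->
  (mean X (fun x => nsq (product_sum x *m th) `^ p)%R <=
   (7 * (m%:R `^ (1 - p) * (expR (N%:R * (- (p * (1 - p) / n%:R) + c * p / n%:R ^+ 2)) *
      nsq th `^ p)))%:E)%E.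
Proof.
move=> np p1; have p0 : 0 < p by apply: lt_le_trans np; rewrite invr_gt0.
have mR0 : 0 < m%:R :> R by rewrite ltr0n.
apply: (le_trans (mean_powR_product_sum_le th p0 p1)).
have mV i : measurable_fun setT (fun x : config index R => image_norms th i x `^ p).
  exact: (measurableT_comp (@measurable_powR R p) (measurable_image_norms th i)).
rewrite meanZ; first last.
- by move=> x; exact: powR_ge0.
- exact: (measurableT_comp (@measurable_powR R p) (measurable_mean_square th)).
- by [].
rewrite EFinM; apply: lee_wpmul2l_EFin => //.
apply: (@le_trans _ _ (mean X (fun x => m%:R^-1 `^ p * \sum_i image_norms th i x `^ p)%R)).
  apply: le_mean.
  - exact: (measurableT_comp (@measurable_powR R p) (measurable_mean_square th)).
  - by apply: measurable_funM => //; exact: measurable_sum.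
  - by move=> x; exact: powR_ge0.
  move=> x; rewrite powRM ?invr_ge0//; last by apply: sumr_ge0 => i _; exact: nsq_ge0.
  by rewrite ler_wpM2l ?powR_ge0// powR_sum_le// => i; exact: nsq_ge0.
rewrite meanZ; first last.
- by move=> x; apply: sumr_ge0 => i _; exact: powR_ge0.
- exact: measurable_sum.
- exact: powR_ge0.
rewrite mean_sum//; last by move=> i x; exact: powR_ge0.
set e := expR _ * _.
apply: (@le_trans _ _ ((m%:R^-1 `^ p)%:E * \sum_(i < m) e%:E)%E).
  apply: lee_wpmul2l_EFin; first exact: powR_ge0.
  apply: lee_sum => i _.
  by have [] := mean_powR_layers_image indepX lawX bounds n0 i th np p1 (leqnn N).
rewrite sumEFin sumr_const card_ord -EFinM lee_fin -[e *+ m]mulr_natl mulrA.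
rewrite -[m%:R^-1](powR_inv1 (ltW mR0)) -powRrM mulN1r -[X in _ * X * e](powRr1 (ltW mR0)).
rewrite -powRD; last by apply/implyP => _; exact: lt0r_neq0.
by rewrite [- p + 1]addrC mulrA.
Qed.

End upper_moment.

(** * The largest singular value *)

Section sign_average.
Context (R : realType) (n : nat).
Implicit Types (w : 'I_n -> R) (h : {ffun 'I_n -> bool}) (r : seq 'I_n).

Definition sgn_of h (i : 'I_n) : R := (- 1) ^+ h i.

Let flip (k : 'I_n) h : {ffun 'I_n -> bool} := [ffun i => h i (+) (i == k)].

Let flipK k : involutive (flip k).
Proof. by move=> h; apply/ffunP => i; rewrite !ffunE -addbA addbb addbF. Qed.

Let sgn_flip k h i : sgn_of (flip k h) i = (if i == k then - 1 else 1) * sgn_of h i.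
Proof.
rewrite /sgn_of ffunE; case: eqP => _; last by rewrite addbF mul1r.
by rewrite addbT; case: (h i); rewrite /= ?expr0 ?expr1; ring.
Qed.

Let sgn2 h i : sgn_of h i ^+ 2 = 1.
Proof. by rewrite /sgn_of -exprM mulnC exprM sqrrN !expr1n. Qed.

Let z w r h := \sum_(i <- r) w i * sgn_of h i.

(** Flipping the sign of [k] permutes the sign vectors and negates the summand. *)
Let sum_odd w r k (j : nat) : k \notin r ->
  \sum_h sgn_of h k * z w r h ^+ j = 0.
Proof.
move=> kr; set S := \sum_h _; suff : S = - S.
  by move/eqP; rewrite -subr_eq0 opprK -mulr2n mulrn_eq0/= => /eqP.
rewrite {1}/S (reindex_inj (can_inj (flipK k)))/= -sumrN; apply: eq_bigr => h _.
rewrite sgn_flip eqxx mulN1r mulNr; congr (- (_ * _ ^+ _)).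
apply: eq_big_seq => i ir; rewrite sgn_flip.
by case: eqP => [ik|_]; [rewrite -ik ir in kr|rewrite mul1r].
Qed.

Let H : R := #|{ffun 'I_n -> bool}|%:R.

Let sum_z2 w r : uniq r -> \sum_h z w r h ^+ 2 = H * \sum_(i <- r) w i ^+ 2.
Proof.
elim: r => [_|k r ih /= /andP[kr ur]].
  by rewrite big_nil mulr0 big1// => h _; rewrite /z big_nil expr0n.
rewrite big_cons mulrDr -ih//.
have -> : \sum_h z w (k :: r) h ^+ 2 = \sum_h (w k ^+ 2 + z w r h ^+ 2 +
    2 * w k * (sgn_of h k * z w r h ^+ 1)).
  apply: eq_bigr => h _; rewrite /z big_cons -/(z w r h).
  have -> : (w k * sgn_of h k + z w r h) ^+ 2 = w k ^+ 2 * sgn_of h k ^+ 2 +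
    z w r h ^+ 2 + 2 * w k * (sgn_of h k * z w r h ^+ 1) by ring.
  by rewrite sgn2 mulr1.
rewrite 2!big_split/= -(mulr_sumr _ _ _ (2 * w k)) sum_odd// mulr0 addr0; congr (_ + _).
by rewrite sumr_const /H mulr_natl.
Qed.

Let sum_z4 w r : uniq r -> \sum_h z w r h ^+ 4 <= 3 * H * (\sum_(i <- r) w i ^+ 2) ^+ 2.
Proof.
elim: r => [_|k r ih /= /andP[kr ur]].
  by rewrite big_nil expr0n mulr0 big1// => h _; rewrite /z big_nil expr0n.
rewrite big_cons; set s := \sum_(i <- r) _.
have -> : \sum_h z w (k :: r) h ^+ 4 = \sum_h (w k ^+ 4 + z w r h ^+ 4 +
    6 * w k ^+ 2 * z w r h ^+ 2 + 4 * w k ^+ 3 * (sgn_of h k * z w r h ^+ 1) +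
    4 * w k * (sgn_of h k * z w r h ^+ 3)).
  apply: eq_bigr => h _; rewrite /z big_cons -/(z w r h); set g := sgn_of h k.
  have g2 : g ^+ 2 = 1 by exact: sgn2.
  have g3 : g ^+ 3 = g by rewrite exprS g2 mulr1.
  have g4 : g ^+ 4 = 1 by rewrite (_ : 4 = 2 * 2)%N// exprM g2 expr1n.
  have -> : (w k * g + z w r h) ^+ 4 = w k ^+ 4 * g ^+ 4 + z w r h ^+ 4 +
    6 * w k ^+ 2 * z w r h ^+ 2 * g ^+ 2 + 4 * w k ^+ 3 * (g ^+ 3 * z w r h ^+ 1) +
    4 * w k * (g * z w r h ^+ 3) by ring.
  by rewrite g2 g3 g4; ring.
rewrite 4!big_split/= -(mulr_sumr _ _ _ (4 * w k)) -(mulr_sumr _ _ _ (4 * w k ^+ 3)).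
rewrite -(mulr_sumr _ _ _ (6 * w k ^+ 2)) !sum_odd// sum_z2// !mulr0 !addr0 -/s.
rewrite sumr_const -[_ *+ _]mulr_natl -/H.
have := ih ur; rewrite -/s.
have : 0 <= H * w k ^+ 4 by rewrite mulr_ge0// exprn_even_ge0.
by lra.
Qed.

(** For [x = 2 y / 3], the number [x - x^2 / 4] is at most [min (x, 1)], hence at most [x^p]. It is
    meant for [y] of mean [1] and second moment at most [3]: the slope [a = 2 / 3] maximises the
    resulting bound [a - 3 a^2 / 4], with value [1 / 3]. *)
Lemma powR_quadratic_lb (y p : R) : 0 < p -> p <= 1 -> 0 <= y ->
  2 / 3 * y - y ^+ 2 / 9 <= y `^ p.
Proof.
move=> p0 p1 y0; pose x := 2 / 3 * y.
have -> : 2 / 3 * y - y ^+ 2 / 9 = x - x ^+ 2 / 4 by rewrite /x; field.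
have x0 : 0 <= x by rewrite mulr_ge0.
have xy : x `^ p <= y `^ p.
  by apply: ge0_ler_powR; rewrite ?nnegrE ?(ltW p0)//; rewrite /x; lra.
apply: le_trans xy; have [x1|x1] := leP x 1.
  apply: (@le_trans _ _ x); first by rewrite gerBl divr_ge0 ?sqr_ge0.
  have [->|xn0] := eqVneq x 0; first exact: powR_ge0.
  by apply: ger1_powR => //; rewrite lt_neqAle eq_sym xn0 x0 x1.
apply: (@le_trans _ _ 1); first by have := sqr_ge0 (x / 2 - 1); lra.
have <- : 1 `^ p = 1 :> R by rewrite powR1.
by apply: ge0_ler_powR; rewrite ?nnegrE ?(ltW p0)//; exact: ltW.
Qed.

Let H0 : 0 < H.
Proof. by rewrite ltr0n; apply/card_gt0P; exists [ffun=> false]. Qed.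

(** The square of the sign sum, divided by [s], has mean [1] and second moment at most [3], so
    [powR_quadratic_lb] bounds its [p]-th moment below by [1 / 3], uniformly in [p]. *)
Lemma khintchine w (p : R) : 0 < p -> p <= 1 ->
  (\sum_i w i ^+ 2) `^ p <=
  3 / H * \sum_h ((\sum_i w i * sgn_of h i) ^+ 2) `^ p.
Proof.
move=> p0 p1; set s := \sum_i w i ^+ 2.
have [s00|sn0] := eqVneq s 0.
  have -> : s `^ p = 0 by apply/eqP; rewrite powR_eq0 s00 eqxx gt_eqF.
  rewrite mulr_ge0 ?divr_ge0 ?(ltW H0)//.
  by apply: sumr_ge0 => h _; exact: powR_ge0.
have s0 : 0 < s.
  by rewrite lt_neqAle eq_sym sn0 sumr_ge0// => i _; exact: sqr_ge0.
have u := index_enum_uniq 'I_n.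
have h2 := sum_z2 w u; have h4 := sum_z4 w u.
rewrite -/s in h2 h4.
apply: (@le_trans _ _ (3 / H * \sum_h s `^ p * (2 / 3 * (z w (index_enum _) h ^+ 2 / s) -
    (z w (index_enum _) h ^+ 2 / s) ^+ 2 / 9))); last first.
  rewrite ler_wpM2l ?divr_ge0 ?(ltW H0)//.
  apply: ler_sum => h _.
  have zz : z w (index_enum _) h ^+ 2 = s * (z w (index_enum _) h ^+ 2 / s).
    by rewrite mulrC divfK.
  rewrite [in leRHS]zz powRM; [|exact: ltW|]; last by rewrite divr_ge0 ?sqr_ge0// ltW.
  rewrite ler_wpM2l ?powR_ge0//; apply: powR_quadratic_lb => //.
  by rewrite divr_ge0 ?sqr_ge0// ltW.
rewrite -mulr_sumr mulrCA -[leLHS]mulr1 ler_wpM2l ?powR_ge0//.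
have -> : \sum_h (2 / 3 * (z w (index_enum _) h ^+ 2 / s) -
    (z w (index_enum _) h ^+ 2 / s) ^+ 2 / 9) =
    2 / 3 / s * \sum_h z w (index_enum _) h ^+ 2 -
    (9 * s ^+ 2)^-1 * \sum_h z w (index_enum _) h ^+ 4.
  rewrite !mulr_sumr -sumrB; apply: eq_bigr => h _; field.
  by rewrite sn0.
rewrite h2.
have h4' := ler_wpM2l (ltW (_ : 0 < (9 * s ^+ 2)^-1)) h4.
have {}h4' := h4' ltac:(by rewrite invr_gt0 mulr_gt0 ?exprn_gt0).
have e1 : (9 * s ^+ 2)^-1 * (3 * H * s ^+ 2) = H / 3 by field; rewrite sn0.
have e2 : 2 / 3 / s * (H * s) = 2 / 3 * H by field; rewrite sn0.
rewrite e1 in h4'; rewrite e2.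
rewrite mulrAC ler_pdivlMr ?H0// mul1r.
by lra.
Qed.

End sign_average.

Lemma cvg_finite_sum (R : realType) (I : Type) (r : seq I) (f : I -> nat -> R)
    (l : I -> R) : (forall i, f i k @[k --> \oo] --> l i) ->
  (\sum_(i <- r) f i k) @[k --> \oo] --> \sum_(i <- r) l i.
Proof.
move=> fl; elim: r => [|i r ih].
  by rewrite big_nil; under eq_fun do rewrite big_nil; exact: cvg_cst.
by rewrite big_cons; under eq_fun do rewrite big_cons; exact: cvgD.
Qed.

Section spectral_norm.
Context (R : realType) (n : nat).
Implicit Types (A : 'M[R]_n) (v th : 'cV[R]_n).

Lemma cauchy_schwarz (I : finType) (a b : I -> R) :
  (\sum_i a i * b i) ^+ 2 <= (\sum_i a i ^+ 2) * (\sum_i b i ^+ 2).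
Proof.
have [b0|b0] := eqVneq (\sum_i b i ^+ 2) 0.
  rewrite b0 mulr0; move/eqP: b0; rewrite psumr_eq0 => [/allP h|i _]; last exact: sqr_ge0.
  rewrite big1 ?expr0n// => i _; have := h i (mem_index_enum _).
  by rewrite sqrf_eq0 => /eqP ->; rewrite mulr0.
set B := \sum_i b i ^+ 2 in b0 *.
have B0 : 0 < B by rewrite lt_neqAle eq_sym b0 sumr_ge0// => i _; exact: sqr_ge0.
set C := \sum_i a i * b i; set D := \sum_i a i ^+ 2.
have : 0 <= \sum_i (a i - C / B * b i) ^+ 2 by apply: sumr_ge0 => i _; exact: sqr_ge0.
have -> : \sum_i (a i - C / B * b i) ^+ 2 = D - 2 * (C / B) * C + (C / B) ^+ 2 * B.
  rewrite /D /C /B !mulr_sumr -sumrB -big_split/=; apply: eq_bigr => i _; ring.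
have -> : D - 2 * (C / B) * C + (C / B) ^+ 2 * B = D - C ^+ 2 / B by field.
by rewrite subr_ge0 ler_pdivrMr.
Qed.

Lemma enormE v : enorm v = Num.sqrt (nsq v). Proof. by []. Qed.

Lemma unit_sphereP v : unit_sphere v <-> nsq v = 1.
Proof.
rewrite /unit_sphere/= enormE; split=> [h|->]; last exact: sqrtr1.
by rewrite -(sqr_sqrtr (nsq_ge0 v)) h expr1n.
Qed.

Definition sign_vector (h : {ffun 'I_n -> bool}) : 'cV[R]_n := \col_i sgn_of R h i.

Lemma nsq_sign_vector h : nsq (sign_vector h) = n%:R.
Proof.
rewrite /nsq; under eq_bigr do rewrite mxE /sgn_of -exprM mulnC exprM sqrrN !expr1n.
by rewrite sumr_const card_ord.
Qed.

Definition sign_average A (p : R) : R :=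
  3 / #|{ffun 'I_n -> bool}|%:R * \sum_h nsq (A *m sign_vector h) `^ p.

Let card0 : 0 < #|{ffun 'I_n -> bool}|%:R :> R.
Proof. by rewrite ltr0n; apply/card_gt0P; exists [ffun=> false]. Qed.

Lemma sign_average_ge0 A p : 0 <= sign_average A p.
Proof.
rewrite mulr_ge0 ?divr_ge0 ?(ltW card0)//.
by apply: sumr_ge0 => h _; exact: powR_ge0.
Qed.

(* Khintchine applied to [w = A^T z] with [z = A th]:
   [nsq z = <w, th>] and [<w, h> = <z, A h>]. *)
Lemma nsq_le_sign_average A th (p : R) : 0 < p -> p <= 1 -> nsq th = 1 ->
  nsq (A *m th) `^ p <= sign_average A p.
Proof.
move=> p0 p1 th1; set z := A *m th.
have [z0|z0] := eqVneq (nsq z) 0.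
  by rewrite z0 powR0 ?gt_eqF//; exact: sign_average_ge0.
have zp : 0 < nsq z by rewrite lt_neqAle eq_sym z0 nsq_ge0.
pose w (b : 'I_n) := \sum_a z a 0 * A a b.
have wv (v : 'cV[R]_n) : \sum_b w b * v b 0 = \sum_a z a 0 * (A *m v) a 0.
  under eq_bigr do rewrite mulr_suml.
  rewrite exchange_big/=; apply: eq_bigr => a _.
  rewrite [(A *m v) a 0]mxE mulr_sumr; apply: eq_bigr => b _.
  by rewrite mulrA.
have zw : nsq z ^+ 2 <= \sum_b w b ^+ 2.
  have := cauchy_schwarz w (fun b => th b 0).
  rewrite -/(nsq th) th1 mulr1 wv; apply: le_trans.
  by rewrite -/z /nsq; under eq_bigr do rewrite expr2.
have h1 : (nsq z ^+ 2) `^ p <= (\sum_b w b ^+ 2) `^ p.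
  by apply: ge0_ler_powR; rewrite ?nnegrE ?(ltW p0) ?sqr_ge0//;
    apply: sumr_ge0 => b _; exact: sqr_ge0.
have := le_trans h1 (khintchine w p0 p1).
set c := 3 / _ => h2.
have c0 : 0 <= c by rewrite divr_ge0// ltW.
have h3 : c * \sum_h ((\sum_i w i * sgn_of R h i) ^+ 2) `^ p <=
    nsq z `^ p * sign_average A p.
  rewrite /sign_average -/c mulrCA ler_wpM2l// mulr_sumr; apply: ler_sum => h _.
  rewrite -powRM ?nsq_ge0//; apply: ge0_ler_powR;
     rewrite ?nnegrE ?(ltW p0) ?sqr_ge0 ?mulr_ge0 ?nsq_ge0//.
  apply: le_trans (cauchy_schwarz (fun a => z a 0) (fun a => (A *m sign_vector h) a 0)).
  by rewrite -wv; under [in leRHS]eq_bigr do rewrite [sign_vector h _ _]mxE.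
have := le_trans h2 h3; rewrite expr2 powRM ?nsq_ge0// ler_pM2l//.
exact: powR_gt0.
Qed.

Hypothesis n0 : (0 < n)%N.

Let unit_vector : exists v, nsq v = 1.
Proof.
exists (\col_i (i == Ordinal n0)%:R); rewrite /nsq (bigD1 (Ordinal n0))//=.
rewrite mxE eqxx expr1n big1 ?addr0// => i /negbTE ni.
by rewrite mxE ni expr0n.
Qed.

Let image_set A := [set enorm (A *m v) | v in @unit_sphere R n].

Let image_set_has_sup A : has_sup (image_set A).
Proof.
have [v v1] := unit_vector; split.
  by exists (enorm (A *m v)); exists v => //; exact/unit_sphereP.
exists (Num.sqrt (sign_average A 1)) => _ [u /unit_sphereP u1 <-].
rewrite enormE ler_sqrt ?sign_average_ge0//.
by have := nsq_le_sign_average A ltr01 (lexx _) u1; rewrite powRr1 ?nsq_ge0.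
Qed.

Lemma le_s1 A v : nsq v = 1 -> enorm (A *m v) <= s1 A.
Proof.
move=> v1; apply: ub_le_sup; first by have [] := image_set_has_sup A.
by exists v => //; exact/unit_sphereP.
Qed.

Lemma s1_le A (t : R) : (forall v, nsq v = 1 -> enorm (A *m v) <= t) -> s1 A <= t.
Proof.
move=> h; apply: ge_sup; first by have [] := image_set_has_sup A.
by move=> _ [v /unit_sphereP v1 <-]; exact: h.
Qed.

Lemma s1_ge0 A : 0 <= s1 A.
Proof. by have [v v1] := unit_vector; apply: le_trans (le_s1 A v1); rewrite sqrtr_ge0. Qed.

Lemma s1_powR_le A (p : R) : 0 < p -> p <= 1 ->
  (s1 A ^+ 2) `^ p <= sign_average A p.
Proof.
move=> p0 p1; have pn0 : p != 0 by rewrite gt_eqF.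
have M0 := sign_average_ge0 A p; set M := sign_average A p in M0 *.
have h : s1 A <= Num.sqrt (M `^ p^-1).
  apply: s1_le => v v1; rewrite enormE ler_sqrt ?powR_ge0//.
  rewrite -[leLHS](powRr1 (nsq_ge0 _)) -(divff pn0) powRrM.
  apply: ge0_ler_powR; rewrite ?nnegrE ?powR_ge0 ?invr_ge0 ?(ltW p0)//.
  exact: nsq_le_sign_average.
apply: (@le_trans _ _ ((M `^ p^-1) `^ p)).
  apply: ge0_ler_powR; rewrite ?nnegrE ?sqr_ge0 ?powR_ge0 ?(ltW p0)//.
  rewrite -[leRHS](sqr_sqrtr (powR_ge0 _ _)) lerXn2r ?nnegrE ?s1_ge0//.
by rewrite -powRrM mulVf// powRr1.
Qed.

Definition int_vector (u : {ffun 'I_n -> int}) : 'cV[R]_n := \col_i (u i)%:~R.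

(** This reduction to countably many conditions is what makes [s1] measurable. For the converse,
    [floor (k v) / k] tends to [v], and both sides are homogeneous. *)
Lemma s1_le_int A (t : R) : 0 <= t ->
  s1 A <= t <-> forall u, nsq (A *m int_vector u) <= t ^+ 2 * nsq (int_vector u).
Proof.
move=> t0; split=> [At u|h].
  have [u0|u0] := eqVneq (nsq (int_vector u)) 0.
    by rewrite (nsq_eq0 u0) mulmx0 nsq0 mulr0.
  have up : 0 < nsq (int_vector u) by rewrite lt_neqAle eq_sym u0 nsq_ge0.
  pose c := Num.sqrt (nsq (int_vector u)).
  have c0 : 0 < c by rewrite sqrtr_gt0.
  have cc : c ^+ 2 = nsq (int_vector u) by rewrite sqr_sqrtr// ltW.
  have v1 : nsq (c^-1 *: int_vector u) = 1 by rewrite nsqZ exprVn cc mulVf.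
  have := le_trans (le_s1 A v1) At.
  rewrite enormE -scalemxAr nsqZ exprVn cc -[leRHS](ger0_norm t0) -sqrtr_sqr.
  by rewrite ler_sqrt ?sqr_ge0// mulrC ler_pdivrMr.
apply: s1_le => v v1.
rewrite enormE -[leRHS](ger0_norm t0) -sqrtr_sqr ler_sqrt ?sqr_ge0//.
pose u (k : nat) := [ffun i => Num.floor (k.+1%:R * v i 0)].
have cu i : (k.+1%:R^-1 * int_vector (u k) i 0) @[k --> \oo] --> v i 0.
  apply: (@squeeze_cvgr _ _ _ _ (fun k : nat => v i 0 - k.+1%:R^-1) (fun=> v i 0)).
  - near=> k; rewrite mxE ffunE.
    have k0 : 0 < k.+1%:R :> R by rewrite ltr0n.
    rewrite mulrC ler_pdivrMr// ler_pdivlMr// mulrBl mulVf ?gt_eqF// mulrC.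
    rewrite floor_le andbT lerBlDr.
    by have /andP[_ /ltW] := floor_itv (k.+1%:R * v i 0); rewrite intrD.
  - rewrite -[X in _ --> X]subr0; apply: cvgB; first exact: cvg_cst.
    exact: cvg_harmonic.
  - exact: cvg_cst.
have cA a : (k.+1%:R^-1 * (A *m int_vector (u k)) a 0) @[k --> \oo] --> (A *m v) a 0.
  have -> : (fun k : nat => k.+1%:R^-1 * (A *m int_vector (u k)) a 0) =
      (fun k : nat => \sum_b A a b * (k.+1%:R^-1 * int_vector (u k) b 0)).
    by apply/funext => k; rewrite mxE mulr_sumr; apply: eq_bigr => b _; rewrite mulrCA.
  rewrite mxE; apply: cvg_finite_sum => b; apply: cvgM; [exact: cvg_cst|exact: cu].
have cn (x : nat -> 'cV[R]_n) (y : 'cV[R]_n) :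
    (forall a, (k.+1%:R^-1 * x k a 0) @[k --> \oo] --> y a 0) ->
    (k.+1%:R^-1 ^+ 2 * nsq (x k)) @[k --> \oo] --> nsq y.
  move=> xy; have -> : (fun k : nat => k.+1%:R^-1 ^+ 2 * nsq (x k)) =
      (fun k : nat => \sum_a (k.+1%:R^-1 * x k a 0) * (k.+1%:R^-1 * x k a 0)).
    by apply/funext => k; rewrite mulr_sumr; apply: eq_bigr => a _; ring.
  rewrite /nsq; under [X in _ --> X]eq_bigr do rewrite expr2.
  by apply: cvg_finite_sum => a; apply: cvgM.
have c1 := cn _ _ cA.
have c2 : (t ^+ 2 * (k.+1%:R^-1 ^+ 2 * nsq (int_vector (u k)))) @[k --> \oo] --> t ^+ 2 * nsq v.
  by apply: cvgM; [exact: cvg_cst|exact: (cn _ _ cu)].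
rewrite v1 mulr1 in c2.
apply: (ler_cvg_to c1 c2); near=> k.
by rewrite mulrCA ler_wpM2l ?sqr_ge0.
Unshelve. all: by end_near. Qed.

End spectral_norm.

Section s1_tails.
Context (R : realType) (n N m : nat).
Notation index := ('I_m * 'I_N.+1 * ('I_n * 'I_n))%type.
Implicit Types th : 'cV[R]_n.
Context (d : measure_display) (T : measurableType d)
  (P : probability T R) (X : index -> {RV P >-> R}).
Hypothesis indepX : mutually_independent X.
Hypothesis lawX : forall k B, measurable B ->
  distribution P (X k) B = normal_prob 0 (Num.sqrt (n%:R^-1)) B.
Hypothesis n0 : (0 < n)%N.
Hypothesis m0 : (0 < m)%N.
Variable c : R.
Hypothesis bounds : power_moment_bounds c n.

Let nR0 : 0 < n%:R :> R. Proof. by rewrite ltr0n. Qed.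
Let mR0 : 0 < m%:R :> R. Proof. by rewrite ltr0n. Qed.

Let top_norm (x : config index R) : R := s1 (product_sum x).

Let measurable_top_norm_le (t : R) : measurable [set x | top_norm x <= t].
Proof.
have [t0|t0] := leP 0 t; last first.
  rewrite (_ : [set x | _] = set0)//; apply/seteqP; split => // x /=.
  by rewrite leNgt (lt_le_trans t0)// s1_ge0.
have -> : [set x | top_norm x <= t] = \bigcap_k (if unpickle k is Some u then
    [set x : config index R | nsq (product_sum x *m int_vector R u) <=
       t ^+ 2 * nsq (int_vector R u)] else setT).
  apply/seteqP; split=> [x /(s1_le_int n0 _ t0) h k _|x h].
    by case: unpickle => // u; exact: h.
  apply/(s1_le_int n0 _ t0) => u; have := h (pickle u) I.
  by rewrite pickleK.
apply: bigcapT_measurable => k; case: unpickle => // u.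
have mq := @measurable_nsq_product_sum R n N m (int_vector R u).
have := mq measurableT _ (measurable_itv `]-oo, (t ^+ 2 * nsq (int_vector R u))]).
by rewrite setTI.
Qed.

Lemma measurable_s1_product_sum :
  measurable_fun setT (fun x : config index R => s1 (product_sum x)).
Proof.
apply: (measurability _ (RGenOInfty.measurableE R)) => //.
move=> _ [_ [t ->] <-]; rewrite setTI.
rewrite (_ : _ @^-1` _ = ~` [set x | top_norm x <= t]).
  exact: measurableC.
apply/seteqP; split=> x /=; rewrite in_itv/= andbT ltNge; by move/negP.
Qed.

(** Markov's inequality for the sign average: [21 = 3 * 7] collects the constants of [khintchine]
    and [mean_powR_product_sum], and [n^p] comes from the squared norm of a sign vector. *)
Lemma s1_upper_tail (p u : R) : n%:R^-1 <= p -> p <= 1 -> 0 < u ->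
  (P (sample X @^-1` [set x | (u <= s1 (product_sum x) ^+ 2)%R]) <=
   (21 * (m%:R `^ (1 - p) * (expR (N%:R * (- (p * (1 - p) / n%:R) + c * p / n%:R ^+ 2)) *
      n%:R `^ p)) / u `^ p)%:E)%E.
Proof.
move=> np p1 u0; have p0 : 0 < p by apply: lt_le_trans np; rewrite invr_gt0.
set e := m%:R `^ _ * _.
have up0 : 0 < u `^ p by exact: powR_gt0.
have mh h : measurable_fun setT
    (fun x : config index R => nsq (product_sum x *m sign_vector R h) `^ p).
  exact: (measurableT_comp (@measurable_powR R p) (measurable_nsq_product_sum _)).
have msa : measurable_fun setT (fun x : config index R => sign_average (product_sum x) p).
  by apply: measurable_funM => //; exact: measurable_sum.
have H0 : 0 < #|{ffun 'I_n -> bool}|%:R :> R.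
  by rewrite ltr0n; apply/card_gt0P; exists [ffun=> false].
apply: (@le_trans _ _ (mean X (fun x => (u `^ p)^-1 * sign_average (product_sum x) p)%R)).
  apply: probability_le_mean.
  - have m2 : measurable_fun setT (fun x : config index R => s1 (product_sum x) ^+ 2).
      by apply: measurable_funX; exact: measurable_s1_product_sum.
    have := m2 measurableT _ (measurable_itv `[u, +oo[).
    rewrite setTI; congr (measurable _).
    by apply/seteqP; split=> x /=; rewrite in_itv/= andbT.
  - exact: measurable_funM.
  - by move=> x; rewrite mulr_ge0 ?sign_average_ge0// invr_ge0 ltW.
  - move=> x /= ux; rewrite mulrC ler_pdivlMr// mul1r.
    apply: le_trans (s1_powR_le n0 _ p0 p1).
    by apply: ge0_ler_powR; rewrite ?nnegrE ?(ltW p0) ?sqr_ge0// ltW.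
rewrite meanZ; first last.
- by move=> x; exact: sign_average_ge0.
- exact: msa.
- by rewrite invr_ge0 ltW.
rewrite [X in (_ <= X%:E)%E]mulrC EFinM lee_wpmul2l_EFin ?invr_ge0 ?(ltW up0)//.
rewrite /sign_average meanZ; first last.
- by move=> x; apply: sumr_ge0 => h _; exact: powR_ge0.
- exact: measurable_sum.
- by rewrite divr_ge0// ltW.
rewrite mean_sum//; last by move=> h x; exact: powR_ge0.
apply: (@le_trans _ _ ((3 / #|{ffun 'I_n -> bool}|%:R)%:E *
    \sum_(h : {ffun 'I_n -> bool}) (7 * e)%:E)%E).
  apply: lee_wpmul2l_EFin; first by rewrite divr_ge0// ltW.
  apply: lee_sum => h _.
  have := mean_powR_product_sum indepX lawX n0 bounds m0 (sign_vector R h) np p1.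
  by rewrite nsq_sign_vector.
rewrite sumEFin sumr_const -EFinM lee_fin -[7 * e *+ _]mulr_natl.
rewrite (mulrA (3 / _)) divfK ?gt_eqF//.
by clearbody e; lra.
Qed.

Let unit0 : 'cV[R]_n := \col_i (i == Ordinal n0)%:R.

Lemma nsq_unit0 : nsq unit0 = 1.
Proof.
rewrite /nsq (bigD1 (Ordinal n0))//= mxE eqxx expr1n big1 ?addr0// => i /negbTE ni.
by rewrite mxE ni expr0n.
Qed.

(** [s1] dominates each coordinate of the image of the first basis vector, so the small-ball
    estimate for one coordinate suffices. *)
Lemma s1_lower_tail (t s : R) : 0 < t -> 0 < s ->
  (P (sample X @^-1` [set x | (s1 (product_sum x) ^+ 2 <= t ^+ 2 * s / n%:R)%R]) <=
   2%:E * (t%:E + P (sample X @^-1` [set x | (mean_square unit0 x < s)%R])))%E.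
Proof.
move=> t0 s0; apply: le_trans (small_ball indepX lawX n0 unit0 (Ordinal n0) t0 s0).
have ms : measurable_fun setT (fun x : config index R => s1 (product_sum x) ^+ 2).
  by apply: measurable_funX; exact: measurable_s1_product_sum.
have mr : measurable_fun setT
    (fun x : config index R => (product_sum x *m unit0) (Ordinal n0) 0 ^+ 2).
  by apply: measurable_funX; exact: measurable_product_sum.
apply: le_measure.
- rewrite inE; apply: measurable_sample_preimage.
  have := ms measurableT _ (measurable_itv `]-oo, (t ^+ 2 * s / n%:R)]).
  by rewrite setTI.
- rewrite inE; apply: measurable_sample_preimage.
  have := mr measurableT _ (measurable_itv `]-oo, (t ^+ 2 * s / n%:R)]).
  by rewrite setTI.
move=> w /=; apply: le_trans.
set A := product_sum _.
have := le_s1 n0 A nsq_unit0; rewrite enormE => h.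
apply: (@le_trans _ _ (nsq (A *m unit0))).
  by rewrite /nsq (bigD1 (Ordinal n0))//= lerDl sumr_ge0// => i _; exact: sqr_ge0.
rewrite -[leLHS](sqr_sqrtr (nsq_ge0 _)) lerXn2r ?nnegrE ?sqrtr_ge0//.
exact: s1_ge0.
Qed.

End s1_tails.

(** * Lower tail of the mean square *)

Section truncation.
Context (R : realType).

(* The three terms correspond to [y <= ln V <= y'], [ln V < y] and [y' < ln V]. *)
Lemma powR_truncation (V q dl y y' : R) : 0 <= V -> 0 < dl -> dl < q ->
  V `^ q <= expR (q * y') * \1_[set v | expR y <= v] V +
    expR (dl * y) * V `^ (q - dl) + expR (- (dl * y')) * V `^ (q + dl).
Proof.
move=> V0 d0 dq.
have i0 : 0 <= expR (q * y') * \1_[set v | expR y <= v] V.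
  by rewrite mulr_ge0 ?expR_ge0// indicE.
have a0 : 0 <= expR (dl * y) * V `^ (q - dl) by rewrite mulr_ge0 ?expR_ge0 ?powR_ge0.
have b0 : 0 <= expR (- (dl * y')) * V `^ (q + dl) by rewrite mulr_ge0 ?expR_ge0 ?powR_ge0.
move: V0; rewrite le_eqVlt => /predU1P[V0|V0].
  have -> : V `^ q = 0 by rewrite -V0 powR0// gt_eqF//; lra.
  by rewrite !addr_ge0.
have E r : V `^ r = expR (r * ln V) by rewrite /powR gt_eqF.
pose v := ln V; have vV : expR v = V by rewrite lnK// posrE.
have [vy|vy] := ltP v y.
  apply: (@le_trans _ _ (expR (dl * y) * V `^ (q - dl))); last by lra.
  rewrite !E -expRD ler_expR -/v.
  have : dl * v <= dl * y by rewrite ler_pM2l// ltW.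
  by lra.
have [vy'|vy'] := leP v y'.
  apply: (@le_trans _ _ (expR (q * y') * \1_[set v | expR y <= v] V)); last by lra.
  rewrite indicE mem_set/=; last by rewrite -vV ler_expR.
  rewrite mulr1 E ler_expR -/v ler_pM2l//; lra.
apply: (@le_trans _ _ (expR (- (dl * y')) * V `^ (q + dl))); last by lra.
rewrite !E -expRD ler_expR -/v.
have : dl * y' <= dl * v by rewrite ler_pM2l// ltW.
by lra.
Qed.

End truncation.

(** Taken at [c] it bounds the logarithm of a moment from above, at [- c] from below. *)
Definition moment_exponent (R : realType) (n N : nat) (c p : R) : R :=
  N%:R * (- (p * (1 - p) / n%:R) + c * p / n%:R ^+ 2).

Section mean_square_tails.
Context (R : realType) (n N m : nat).
Notation index := ('I_m * 'I_N.+1 * ('I_n * 'I_n))%type.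
Variable th : 'cV[R]_n.
Hypothesis th1 : nsq th = 1.
Context (d : measure_display) (T : measurableType d)
  (P : probability T R) (X : index -> {RV P >-> R}).
Hypothesis indepX : mutually_independent X.
Hypothesis lawX : forall k B, measurable B ->
  distribution P (X k) B = normal_prob 0 (Num.sqrt (n%:R^-1)) B.
Hypothesis n0 : (0 < n)%N.
Hypothesis m0 : (0 < m)%N.
Variable c : R.
Hypothesis bounds : power_moment_bounds c n.

Let nR0 : 0 < n%:R :> R. Proof. by rewrite ltr0n. Qed.
Let mR0 : 0 < m%:R :> R. Proof. by rewrite ltr0n. Qed.

Let V (i : 'I_m) (x : config index R) : R := image_norms th i x.

Let mV i : measurable_fun setT (V i). Proof. exact: measurable_image_norms. Qed.
Let V0 i x : 0 <= V i x. Proof. exact: nsq_ge0. Qed.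

Let depends_V i : depends_on [pred k : index | k.1.1 == i] (V i).
Proof.
move=> x y xy; rewrite /V /image_norms; congr nsq.
suff H j : layers_image x i th j = layers_image y i th j by exact: H.
elim: j => [//|j ih] /=; rewrite ih; congr (_ *m _).
by apply/matrixP => a b; rewrite !mxE xy//= eqxx.
Qed.

Let mean_prod (g : R -> R) i j : measurable_fun setT g -> (forall y, 0 <= g y) ->
  i != j -> mean X (fun x => g (V i x) * g (V j x)) =
    (mean X (fun x => g (V i x)) * mean X (fun x => g (V j x)))%E.
Proof.
move=> mg g0 ij.
apply: (@mean_mul_indep _ _ _ _ _ X indepX [pred k : index | k.1.1 == i]) => //.
- exact: measurableT_comp.
- exact: measurableT_comp.
- by move=> x y xy; congr g; exact: depends_V.
- move=> x y xy; congr g; apply: depends_V => k /= /eqP kj; apply: xy => /=.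
  by rewrite kj eq_sym.
Qed.

Local Notation expo := (@moment_exponent R n N).

Let mean_V (p : R) i : n%:R^-1 <= p -> p <= 1 ->
  ((expR (expo (- c) p))%:E <= mean X (fun x => (V i x `^ p)%R))%E /\
  (mean X (fun x => (V i x `^ p)%R) <= (expR (expo c p))%:E)%E.
Proof.
move=> np p1.
have := mean_powR_layers_image indepX lawX bounds n0 i th np p1 (leqnn N).
by rewrite th1 powR1 !mulr1 /moment_exponent !mulNr.
Qed.

Let sumV x : \sum_i V i x = m%:R * mean_square th x.
Proof. by rewrite /mean_square mulrA divff ?gt_eqF// mul1r. Qed.

Let n1 : n%:R^-1 <= 1 :> R.
Proof. by rewrite invf_le1// ler1n. Qed.

(** At [p = 1] the main term of the moment exponent vanishes, so the mean of each squared norm is at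
    least [exp (- c N / n^2)]; Chebyshev's inequality is applied with second moments at most
    [exp (c N / n)]. *)
Lemma mean_square_lower_tail (e : R) : 0 < e -> e < 1 ->
  (P (sample X @^-1` [set x | (mean_square th x <
     (1 - e) * expR (- (c * N%:R / n%:R ^+ 2)))%R]) <=
   (e ^- 2 * expR (c * N%:R / n%:R + 2 * (c * N%:R / n%:R ^+ 2)) / m%:R)%:E)%E.
Proof.
move=> e0 e1; pose l := c * N%:R / n%:R ^+ 2; rewrite -/l.
pose w i := fine (mean X (V i)).
have V1 i : mean X (V i) = mean X (fun x => (V i x `^ 1)%R).
  by apply: eq_mean => x; rewrite powRr1.
have lE : expo (- c) 1 = - l by rewrite /moment_exponent /l subrr; ring.
have meanV i : mean X (V i) = (w i)%:E.
  rewrite /w fineK// ge0_fin_numE; last exact: mean_ge0.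
  rewrite V1; have [_ h] := mean_V i n1 (lexx _).
  by apply: (le_lt_trans h); rewrite ltry.
have wl i : expR (- l) <= w i.
  rewrite -lee_fin -meanV V1; have [h _] := mean_V i n1 (lexx _).
  by rewrite lE in h.
have mu_l : m%:R * expR (- l) <= \sum_i w i.
  have -> : m%:R * expR (- l) = \sum_(i < m) expR (- l).
    by rewrite sumr_const card_ord mulr_natl.
  exact: ler_sum.
have ml0 : 0 < m%:R * expR (- l) by rewrite mulr_gt0 ?expR_gt0.
have mu0 : 0 < \sum_i w i by exact: lt_le_trans mu_l.
pose q (i : 'I_m) := expR (c * N%:R / n%:R).
have meanV2 i : (mean X (fun x => (V i x ^+ 2)%R) <= (q i)%:E)%E.
  have := mean_sqr_layers_image indepX lawX bounds i th (leqnn N).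
  by rewrite th1 expr1n mulr1 /q mulrCA mulrA.
have meanVV i j : i != j -> mean X (fun x => V i x * V j x) = (w i * w j)%:E.
  move=> ij; rewrite EFinM -!meanV.
  (* [mean_prod] asks for a function that is nonnegative on the whole line; on the values of [V] the
     absolute value is the identity. *)
  have := @mean_prod (fun y => `|y|) i j (@normr_measurable _ _) (@normr_ge0 _ _) ij.
  rewrite (@eq_mean _ _ _ _ _ X _ (fun x => V i x * V j x)) => [->|x]; last by rewrite !ger0_norm.
  by congr (_ * _)%E; apply: eq_mean => x; rewrite ger0_norm.
have h := chebyshev_lower_tail mV V0 meanV meanV2 meanVV e0 mu0.
apply: (@le_trans _ _ (P (sample X @^-1` [set x | \sum_i V i x <= (1 - e) * \sum_i w i]))).
  have mS : measurable_fun setT (fun x => \sum_i V i x) by exact: measurable_sum.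
  have mM := @measurable_mean_square R n N m th.
  apply: le_measure.
  - rewrite inE; apply: measurable_sample_preimage.
    have := mM measurableT _ (measurable_itv `]-oo, ((1 - e) * expR (- l))[).
    by rewrite setTI.
  - rewrite inE; apply: measurable_sample_preimage.
    have := mS measurableT _ (measurable_itv `]-oo, ((1 - e) * \sum_i w i)]).
    by rewrite setTI.
  move=> x /= hx; rewrite sumV.
  apply: (@le_trans _ _ (m%:R * ((1 - e) * expR (- l)))).
    by rewrite ler_pM2l// ltW.
  by rewrite mulrCA ler_pM2l// subr_gt0.
apply: (le_trans h); rewrite lee_fin.
have -> : \sum_i q i = m%:R * expR (c * N%:R / n%:R) by rewrite /q sumr_const card_ord mulr_natl.
set L := expR (c * N%:R / n%:R); have L0 : 0 < L by exact: expR_gt0.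
rewrite expRD -/L.
set l' := expR (- l); have E0 : 0 < l' by exact: expR_gt0.
apply: (@le_trans _ _ (m%:R * L / (e ^+ 2 * (m%:R * l') ^+ 2))).
  rewrite ler_pM2l ?mulr_gt0// lef_pV2 ?posrE; first last.
  - by rewrite mulr_gt0// exprn_gt0.
  - by rewrite mulr_gt0// exprn_gt0// mulr_gt0.
  rewrite ler_pM2l ?exprn_gt0//; apply: lerXn2r => //; rewrite nnegrE ltW//.
rewrite le_eqVlt; apply/orP; left; apply/eqP.
have -> : expR (2 * l) = l' ^- 2 by rewrite -[2 * l]opprK expRN -mulrN expRM_natl.
by field; rewrite !gt_eqF.
Qed.

(* Second moment method for the number of [i] with [expR y <= V i], the level
   that carries the moment of order [q]. *)
Lemma mean_square_count_tail (q dl y y' p0 : R) : 0 < dl -> dl < q ->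
  n%:R^-1 <= q - dl -> q + dl <= 1 -> 0 < p0 ->
  p0 * expR (q * y') <= expR (expo (- c) q) -
    expR (dl * y) * expR (expo c (q - dl)) -
    expR (- (dl * y')) * expR (expo c (q + dl)) ->
  (P (sample X @^-1` [set x | (mean_square th x < expR y * p0 / 2)%R]) <=
   (4 / (m%:R * p0))%:E)%E.
Proof.
move=> d0 dq nqd qd1 p00 hp0.
have q0 : 0 < q by exact: lt_trans dq.
pose A := [set v : R | expR y <= v].
have mA : measurable A.
  by have := @measurable_itv R `[expR y, +oo[; rewrite set_itvE.
pose g : R -> R := \1_A.
have mg : measurable_fun setT g by exact: measurable_indic.
have g0 v : 0 <= g v by rewrite /g indicE.
pose W i x := g (V i x).
have mW i : measurable_fun setT (W i) by exact: (measurableT_comp mg (mV i)).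
have W0 i x : 0 <= W i x by exact: g0.
have W1 i x : W i x <= 1 by rewrite /W /g indicE; case: (_ \in _).
pose w i := fine (mean X (W i)).
have meanW i : mean X (W i) = (w i)%:E.
  rewrite /w fineK// ge0_fin_numE; last exact: mean_ge0.
  apply: (@le_lt_trans _ _ (mean X (fun=> 1))); last by rewrite mean_cst// ltry.
  exact: le_mean.
(* [powR_truncation] at [V i], averaged: the moment of order [q] minus the two outer terms leaves at
   least [p0 exp (q y')] for the indicator term. *)
have p0w i : p0 <= w i.
  rewrite -(ler_pM2r (expR_gt0 (q * y'))); apply: (le_trans hp0).
  have mVp (p : R) : measurable_fun setT (fun x => V i x `^ p).
    exact: (measurableT_comp (@measurable_powR R p) (mV i)).
  have Vp0 (p : R) x : 0 <= V i x `^ p by exact: powR_ge0.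
  have e0 z : 0 <= expR z :> R by exact: expR_ge0.
  have [lo _] := @mean_V q i ltac:(lra) ltac:(lra).
  have [_ h1] := @mean_V (q - dl) i ltac:(lra) ltac:(lra).
  have [_ h2] := @mean_V (q + dl) i ltac:(lra) ltac:(lra).
  have mM z (f : config index R -> R) : measurable_fun setT f ->
    measurable_fun setT (fun x => z * f x) by move=> mf; exact: measurable_funM.
  have M0 z (f : config index R -> R) : (forall x, 0 <= f x) ->
    forall x, 0 <= expR z * f x by move=> f0 x; exact: mulr_ge0.
  have : (mean X (fun x => V i x `^ q)%R <=
      mean X (fun x => (expR (q * y') * W i x + expR (dl * y) * V i x `^ (q - dl)) +
        expR (- (dl * y')) * V i x `^ (q + dl))%R)%E.
    apply: le_mean => //.
    - by apply: measurable_funD; [apply: measurable_funD|]; exact: mM.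
    - by move=> x; exact: powR_truncation.
  rewrite meanD; first last.
  - exact: M0.
  - by move=> x; apply: addr_ge0; apply: mulr_ge0.
  - exact: mM.
  - by apply: measurable_funD; exact: mM.
  rewrite meanD; first last.
  - exact: M0.
  - exact: M0.
  - exact: mM.
  - exact: mM.
  rewrite !meanZ// meanW => h.
  have : ((expR (expo (- c) q))%:E <= (expR (q * y') * w i +
     expR (dl * y) * expR (expo c (q - dl)) +
     expR (- (dl * y')) * expR (expo c (q + dl)))%:E)%E.
    apply: (le_trans lo); apply: (le_trans h); rewrite !EFinD !EFinM.
    by apply: leeD; [apply: leeD => //|]; exact: lee_wpmul2l_EFin.
  by rewrite lee_fin; lra.
have mu_p0 : m%:R * p0 <= \sum_i w i.
  have -> : m%:R * p0 = \sum_(i < m) p0 by rewrite sumr_const card_ord mulr_natl.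
  exact: ler_sum.
have mp0 : 0 < m%:R * p0 by rewrite mulr_gt0.
have mu0 : 0 < \sum_i w i by exact: lt_le_trans mu_p0.
(* An indicator is its own square, so the second moments add up to the mean of the count, and
   Chebyshev's bound at half of that mean is [4] over it. *)
have meanW2 i : (mean X (fun x => W i x ^+ 2)%R <= (w i)%:E)%E.
  rewrite -meanW; apply: le_mean => //.
  - exact: measurable_funX.
  - by move=> x; exact: sqr_ge0.
  - by move=> x; rewrite expr2; apply: ler_piMr.
have meanWW i j : i != j -> mean X (fun x => W i x * W j x) = (w i * w j)%:E.
  by move=> ij; rewrite EFinM -!meanW; exact: mean_prod.
have h2 : 0 < 2^-1 :> R by rewrite invr_gt0.
have h := chebyshev_lower_tail mW W0 meanW meanW2 meanWW h2 mu0.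
apply: (@le_trans _ _ (P (sample X @^-1` [set x | \sum_i W i x <= (1 - 2^-1) * \sum_i w i]))).
  have mS : measurable_fun setT (fun x => \sum_i W i x) by exact: measurable_sum.
  have mM := @measurable_mean_square R n N m th.
  apply: le_measure.
  - rewrite inE; apply: measurable_sample_preimage.
    have := mM measurableT _ (measurable_itv `]-oo, (expR y * p0 / 2)[).
    by rewrite setTI.
  - rewrite inE; apply: measurable_sample_preimage.
    have := mS measurableT _ (measurable_itv `]-oo, ((1 - 2^-1) * \sum_i w i)]).
    by rewrite setTI.
  move=> z; rewrite /preimage /mkset; move: (sample X z) => {z} x hx.
  have : expR y * \sum_i W i x <= m%:R * mean_square th x.
    rewrite -sumV mulr_sumr; apply: ler_sum => i _.
    rewrite /W /g indicE; have [/set_mem h'|_] := boolP (_ \in _); first by rewrite mulr1.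
    by rewrite mulr0.
  have : m%:R * mean_square th x <= m%:R * (expR y * p0 / 2) by rewrite ler_pM2l// ltW.
  have -> : m%:R * (expR y * p0 / 2) = expR y * (m%:R * p0 / 2) by ring.
  move=> a1 a2; have := le_trans a2 a1; rewrite ler_pM2l ?expR_gt0//.
  by lra.
apply: (le_trans h); rewrite lee_fin.
apply: (@le_trans _ _ (4 / \sum_i w i)); last first.
  by rewrite ler_pM2l// lef_pV2.
rewrite le_eqVlt; apply/orP; left; apply/eqP.
by field; rewrite gt_eqF.
Qed.

End mean_square_tails.

(** * Deviation bounds *)

Section deviation.
Context (R : realType) (n N m : nat).
Notation index := ('I_m * 'I_N.+1 * ('I_n * 'I_n))%type.
Context (d : measure_display) (T : measurableType d) (P : probability T R).
Variable X : 'I_m -> 'I_N.+1 -> 'I_n -> 'I_n -> {RV P >-> R}.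
Hypothesis n0 : (0 < n)%N.

Definition flat (k : index) : {RV P >-> R} := X k.1.1 k.1.2 k.2.1 k.2.2.

Lemma sum_of_productsE w : sum_of_products X w = product_sum (sample flat w).
Proof. by rewrite /sum_of_products /product_sum; congr (_ *: _). Qed.

Local Notation Z := (Zlim R n N.+1 m).

(** At [s1 = 0] both sides fail: the deviation is [+oo], and an exponential is positive. *)
Lemma log_s1_dev_le w (b : R) : (log_s1_dev X w <= b%:E)%E <->
  expR (2 * (Z - b)) <= s1 (product_sum (sample flat w)) ^+ 2 <= expR (2 * (Z + b)).
Proof.
rewrite /log_s1_dev sum_of_productsE; move: (product_sum _) => A.
have := s1_ge0 n0 A; rewrite le_eqVlt => /predU1P[<-|s0].
  rewrite /= lexx /= expr0n/=; split=> [|/andP[]]; first by rewrite leye_eq.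
  by rewrite [in X in X -> _]leNgt expR_gt0.
rewrite lne_EFin// -EFinB abse_EFin lee_fin ler_distl.
have -> : s1 A ^+ 2 = expR (2 * ln (s1 A)) by rewrite expRM_natl lnK.
by rewrite !ler_expR !ler_pM2l.
Qed.

Lemma measurable_log_s1_dev_le (b : R) :
  measurable [set w | (log_s1_dev X w <= b%:E)%E].
Proof.
have mf : measurable_fun setT (fun x : config index R => s1 (product_sum x) ^+ 2).
  by apply: measurable_funX; exact: measurable_s1_product_sum.
rewrite (_ : [set w | _] = sample flat @^-1` ((fun x => s1 (product_sum x) ^+ 2) @^-1`
    `[expR (2 * (Z - b)), expR (2 * (Z + b))])).
  apply: measurable_sample_preimage.
  by have := mf measurableT _ (measurable_itv `[expR (2 * (Z - b)), expR (2 * (Z + b))]);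
    rewrite setTI.
by apply/seteqP; split => w /=; rewrite in_itv/=;
  [move/log_s1_dev_le|move=> h; apply/log_s1_dev_le].
Qed.

Lemma probability_log_s1_dev (u l b pu pl : R) :
  u <= expR (2 * (Z + b)) -> expR (2 * (Z - b)) <= l ->
  (P (sample flat @^-1` [set x | (u <= s1 (product_sum x) ^+ 2)%R]) <= pu%:E)%E ->
  (P (sample flat @^-1` [set x | (s1 (product_sum x) ^+ 2 <= l)%R]) <= pl%:E)%E ->
  ((1 - pu - pl)%:E <= P [set w | (log_s1_dev X w <= b%:E)%E])%E.
Proof.
move=> ub lb hu hl.
have mf : measurable_fun setT (fun x : config index R => s1 (product_sum x) ^+ 2).
  by apply: measurable_funX; exact: measurable_s1_product_sum.
set U := sample flat @^-1` _ in hu; set W := sample flat @^-1` _ in hl.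
have mU : measurable U.
  apply: measurable_sample_preimage.
  have := mf measurableT _ (measurable_itv `[u, +oo[).
  by rewrite setTI; congr measurable; apply/seteqP; split => x /=; rewrite in_itv/= andbT.
have mW : measurable W.
  apply: measurable_sample_preimage.
  by have := mf measurableT _ (measurable_itv `]-oo, l]); rewrite setTI.
set G := [set w | _].
have mG : measurable G by exact: measurable_log_s1_dev_le.
have sub : [set: T] `<=` G `|` (U `|` W).
  move=> w _; have [Uw|Uw] := pselect (U w); first by right; left.
  have [Ww|Ww] := pselect (W w); first by right; right.
  left; apply/log_s1_dev_le; apply/andP; split.
    by apply: (le_trans lb); rewrite leNgt; apply/negP => h; apply: Ww; exact: ltW.
  by apply: le_trans ub; rewrite leNgt; apply/negP => h; apply: Uw; exact: ltW.
have : (P [set: T] <= P G + (P U + P W))%E.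
  apply: (@le_trans _ _ (P (G `|` (U `|` W)))).
    by apply: le_measure => //; rewrite inE//; do 2?apply: measurableU.
  apply: (le_trans (measureU2 _ _ _)) => //; first exact: measurableU.
  by apply: leeD => //; exact: measureU2.
rewrite probability_setT => h.
have : (1%:E <= P G + (pu + pl)%:E)%E.
  by apply: (le_trans h); apply: leeD => //; rewrite EFinD; exact: leeD.
by rewrite -leeBlDr// -EFinB opprD addrA.
Qed.

End deviation.

(* To be read with [w = (ln m)^(1/4)], [z = 1 / n], [h = N / n] and
   [p = min (1, sqrt 2 / b)]. *)
Section exponents.
Context (R : realType).
Variables (b w p z c : R).
Hypothesis w1 : 50 <= w.
Hypothesis b0 : 0 < b.
Hypothesis p0 : 0 < p.
Hypothesis p1 : p <= 1.
Hypothesis pb2 : (p * b) ^+ 2 <= 2.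
Hypothesis pbw : 2 <= p * b * w ^+ 2.
Hypothesis c0 : 0 < c.
Hypothesis z0 : 0 < z.
Hypothesis cbz : c * b * w ^+ 2 * z <= 2^-1.

Let r := p * b.
Let v := w^-1.
Let h := b ^+ 2 * w ^+ 4 / 2.
(** Up to errors [k] is the logarithm of the moment of [V]. Under the law tilted by [V^q], [ln V]
    has centre [(2 q - 1) h], the derivative of [k], and standard deviation [b w^2], the root of the
    second derivative [2 h]; the half-width [a] is [3 w] times as large. The gap between [p] and [q]
    buys [8 w^3] in [count_exponent], of which [q a] spends at most [9 / 2 w^3]. *)
Let q := p * (1 - 8 * v).
Let dl := p * v.
Let a := 3 * b * w ^+ 3.
Let y := (2 * q - 1) * h - a.
Let y' := (2 * q - 1) * h + a.
Let k x := - (x * (1 - x)) * h.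

Let w0 : 0 < w. Proof. by apply: lt_le_trans w1; rewrite ltr0n. Qed.
Let vw : v * w = 1. Proof. by rewrite mulVf// gt_eqF. Qed.
Let v0 : 0 < v. Proof. by rewrite invr_gt0. Qed.
Let v50 : v <= 50^-1. Proof. by rewrite lef_pV2 ?posrE. Qed.
Let r0 : 0 < r. Proof. exact: mulr_gt0. Qed.
Let r15 : r <= 3 / 2.
Proof.
rewrite leNgt; apply/negP => h'; have := pb2; rewrite -/r expr2.
by nra.
Qed.

(** The moment error accumulated over all layers. The condition [cbz] behind it says that
    [b^2 ln m], that is [2 N / n], is small against [n^2], which is where [N = o(n^3)] enters. *)
Let rem : c * p * h * z <= r * w ^+ 2 / 4.
Proof.
have -> : c * p * h * z = r * w ^+ 2 / 2 * (c * b * w ^+ 2 * z).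
  by rewrite /h /r; field.
have rw : 0 <= r * w ^+ 2 / 2 by rewrite divr_ge0// mulr_ge0 ?sqr_ge0// ltW.
by have := ler_wpM2l rw cbz; lra.
Qed.

(** With a margin of [2], each of the two outer terms of the truncation is at most a quarter of the
    moment, by [expR_sub2], so that half of the moment remains. *)
Let gap : h * dl ^+ 2 - dl * a + 2 * (c * p * h * z) <= - 2.
Proof.
have -> : h * dl ^+ 2 = r * (r * w ^+ 2) / 2.
  rewrite /h /dl /r; have -> : b ^+ 2 * w ^+ 4 / 2 * (p * v) ^+ 2 =
    p * b * (p * b * (w * v * w) ^+ 2) / 2 by ring.
  by rewrite (mulrC w) vw mul1r.
have -> : dl * a = 3 * (r * w ^+ 2).
  rewrite /dl /a /r; have -> : p * v * (3 * b * w ^+ 3) = 3 * (p * b * w ^+ 2) * (v * w) by ring.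
  by rewrite vw mulr1.
have rw : 0 <= r * w ^+ 2 by rewrite mulr_ge0 ?sqr_ge0// ltW.
have := ler_wpM2r rw r15; have := rem; have := pbw; rewrite -/r.
by lra.
Qed.

Lemma truncation_low : dl * y + (k (q - dl) + c * (q - dl) * h * z) <=
  k q - c * q * h * z - 2.
Proof.
have h0 : 0 <= c * h * z.
  by rewrite !mulr_ge0 ?ltW// /h divr_ge0// mulr_ge0 ?exprn_ge0// ltW.
have qp : q + q - dl <= 2 * p.
  by rewrite /q /dl; have := mulr_ge0 (ltW p0) (ltW v0); lra.
have := ler_wpM2l h0 qp; have := gap.
have -> : k (q - dl) = k q - dl * (2 * q - 1) * h + h * dl ^+ 2 by rewrite /k; ring.
have -> : dl * y = dl * (2 * q - 1) * h - dl * a by rewrite /y; ring.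
by lra.
Qed.

Lemma truncation_high : - (dl * y') + (k (q + dl) + c * (q + dl) * h * z) <=
  k q - c * q * h * z - 2.
Proof.
have h0 : 0 <= c * h * z.
  by rewrite !mulr_ge0 ?ltW// /h divr_ge0// mulr_ge0 ?exprn_ge0// ltW.
have qp : q + q + dl <= 2 * p.
  by rewrite /q /dl; have := mulr_ge0 (ltW p0) (ltW v0); lra.
have := ler_wpM2l h0 qp; have := gap.
have -> : k (q + dl) = k q + dl * (2 * q - 1) * h + h * dl ^+ 2 by rewrite /k; ring.
have -> : dl * y' = dl * (2 * q - 1) * h + dl * a by rewrite /y'; ring.
by lra.
Qed.

Let qle : q <= p.
Proof. by rewrite /q; have := mulr_ge0 (ltW p0) (ltW v0); lra. Qed.

Let q0 : 0 < q. Proof. by rewrite mulr_gt0//; have := v50; lra. Qed.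

Let chz0 : 0 <= c * h * z.
Proof. by rewrite !mulr_ge0 ?ltW// /h divr_ge0// mulr_ge0 ?exprn_ge0// ltW. Qed.

(** The right-hand side is, up to an additive constant, a lower bound for the logarithm of the mean
    number of indices that reach the level. At [q = p] and [p b = sqrt 2] its main part
    [w^4 - q^2 h] would vanish, which is why [q] lies below [p]. *)
Lemma count_exponent : 2 * w ^+ 3 <= w ^+ 4 - q * y' + k q - c * q * h * z.
Proof.
have -> : w ^+ 4 - q * y' + k q - c * q * h * z =
    w ^+ 4 - q ^+ 2 * h - q * a - q * (c * h * z).
  by rewrite /k /y'; ring.
have e1 : q * (c * h * z) <= r * w ^+ 2 / 4.
  apply: le_trans rem; have := ler_wpM2r chz0 qle; lra.
have e2 : q * a <= 3 * (r * w ^+ 3).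
  have a0 : 0 <= a by rewrite /a !mulr_ge0 ?exprn_ge0 ?ltW.
  by have := ler_wpM2r a0 qle; rewrite /a /r; lra.
have e3 : q ^+ 2 * h <= w ^+ 4 - 8 * w ^+ 3.
  have -> : q ^+ 2 * h = (p * b) ^+ 2 * ((1 - 8 * v) ^+ 2 * w ^+ 4) / 2.
    by rewrite /q /h; ring.
  have i0 : 0 <= 1 - 8 * v by have := v50; lra.
  have i1 : (1 - 8 * v) ^+ 2 <= 1 - 8 * v.
    by rewrite expr2 ler_piMl//; have := v0; lra.
  have w40 : 0 <= w ^+ 4 by rewrite exprn_ge0// ltW.
  have s : (1 - 8 * v) ^+ 2 * w ^+ 4 <= w ^+ 4 - 8 * w ^+ 3.
    apply: (le_trans (ler_wpM2r w40 i1)).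
    have -> : (1 - 8 * v) * w ^+ 4 = w ^+ 4 - 8 * (v * w) * w ^+ 3 by ring.
    by rewrite vw mulr1.
  have s0 : 0 <= (1 - 8 * v) ^+ 2 * w ^+ 4 by rewrite mulr_ge0 ?sqr_ge0.
  by have := ler_wpM2r s0 pb2; lra.
have w3 : 0 <= w ^+ 3 by rewrite exprn_ge0// ltW.
have w23 : w ^+ 2 <= w ^+ 3.
  by rewrite (exprS w 2) ler_peMl ?sqr_ge0//; apply: le_trans w1; rewrite ler1n.
have w20 : 0 <= w ^+ 2 by exact: sqr_ge0.
have := ler_wpM2r w3 r15; have := ler_wpM2r w20 r15.
by lra.
Qed.

(** Compares the logarithm of level times proportion, a lower bound for [S], with [2 Z]. The
    constant [22] covers [a + q a <= 6 b w^3], the cost [14 b w^3] of replacing [p] by [q], and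
    lower-order terms. *)
Lemma level_exponent : - ((1 - p) ^+ 2 * h) - 22 * (b * w ^+ 3) <=
  y - q * y' + k q - c * q * h * z - 2.
Proof.
have -> : y - q * y' + k q - c * q * h * z - 2 =
    - ((1 - q) ^+ 2 * h) - a - q * a - q * (c * h * z) - 2.
  by rewrite /k /y' /y; ring.
have bw0 : 0 <= b * w ^+ 2 by rewrite mulr_ge0 ?sqr_ge0// ltW.
have bw3 : 50 * (b * w ^+ 2) <= b * w ^+ 3.
  by rewrite (exprS w 2) (mulrCA b w (w ^+ 2)); exact: ler_wpM2r.
have rb : r * w ^+ 2 <= b * w ^+ 2.
  by rewrite /r -mulrA ler_piMl.
have e1 : q * (c * h * z) <= r * w ^+ 2 / 4.
  apply: le_trans rem; have := ler_wpM2r chz0 qle; lra.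
have q1 : q <= 1 by exact: le_trans p1.
have a0 : 0 <= a by rewrite /a !mulr_ge0 ?exprn_ge0 ?ltW.
have e2 : q * a <= a by rewrite ler_piMl.
have e3 : (1 - q) ^+ 2 * h <= (1 - p) ^+ 2 * h + 14 * (b * w ^+ 3).
  have -> : (1 - q) ^+ 2 * h = (1 - p) ^+ 2 * h +
      8 * (1 - p) * r * (b * w ^+ 3) * (v * w) + 32 * (p * r) * (b * w ^+ 2) * (v * w) ^+ 2.
    by rewrite /q /h /r; field.
  rewrite vw expr1n !mulr1.
  have bw30 : 0 <= b * w ^+ 3 by lra.
  have i1 : (1 - p) * r <= 3 / 2.
    by apply: le_trans r15; apply: ler_piMl; [exact: ltW|have := p0; lra].
  have i2 : p * r <= 3 / 2.
    by apply: le_trans r15; apply: ler_piMl; [exact: ltW|].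
  have := ler_wpM2r bw30 i1; have := ler_wpM2r bw0 i2.
  by lra.
have := pbw; rewrite -/r => hr.
by rewrite /a in e2 *; lra.
Qed.

End exponents.

Lemma expR_sub2 (R : realType) (t : R) : 4 * expR (t - 2) <= expR t.
Proof.
have -> : expR t = expR (t - 2) * (expR 1 * expR 1).
  by rewrite -!expRD; congr expR; ring.
have := expR_ge1Dx (1 : R); have := expR_gt0 (t - 2).
move: (expR (t - 2)) (expR 1) => x E x0 E2.
have EE : 4 <= E * E by nra.
by have := ler_wpM2l (ltW x0) EE; lra.
Qed.

(** * The two regimes of [beta] *)

Section regimes.
Context (R : realType) (n N m : nat).
Context (d : measure_display) (T : measurableType d) (P : probability T R).
Variable X : 'I_m -> 'I_N.+1 -> 'I_n -> 'I_n -> {RV P >-> R}.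
Hypothesis iidX : iid_gaussian_entries X.
Hypothesis n0 : (0 < n)%N.
Hypothesis m1 : (1 < m)%N.
Variable c : R.
Hypothesis c0 : 0 < c.
Hypothesis bounds : power_moment_bounds c n.

Local Notation Z := (Zlim R n N.+1 m).
Local Notation L := (ln m%:R : R).
Local Notation b := (beta R n N.+1 m).

Let nR0 : 0 < n%:R :> R. Proof. by rewrite ltr0n. Qed.
Let m0 : (0 < m)%N. Proof. exact: ltnW. Qed.
Let mR0 : 0 < m%:R :> R. Proof. by rewrite ltr0n. Qed.

Let indepX : mutually_independent (flat X). Proof. exact: iidX.1. Qed.
Let lawX k B : measurable B ->
  distribution P (flat X k) B = normal_prob 0 (Num.sqrt (n%:R^-1)) B.
Proof. exact: iidX.2. Qed.

Lemma ln_nat_gt0 : 0 < L. Proof. by rewrite ln_gt0// ltr1n. Qed.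

Lemma beta_sqr : b ^+ 2 * L = 2 * (N%:R / n%:R).
Proof.
have L0 := ln_nat_gt0.
rewrite /beta exprMn exprVn !sqr_sqrtr; first last.
- by rewrite -[N.+1%:R]natr1 addrK mulr_ge0.
- by rewrite mulr_ge0// ltW.
by rewrite -[N.+1%:R]natr1 addrK; field; rewrite !gt_eqF.
Qed.

Let nE : n%:R = expR (ln n%:R) :> R. Proof. by rewrite lnK. Qed.
Let mE : m%:R = expR L :> R. Proof. by rewrite lnK. Qed.

Let powR_n (a : R) : n%:R `^ a = expR (a * ln n%:R).
Proof. by rewrite /powR gt_eqF. Qed.

(** Both tails are taken at distance [(1 + 2 al) ln n] on the scale of [2 ln s1]. Above, one [ln n]
    pays for [n^p] and the rest gives [n^(- 2 al p)]; below, this is the factor [t^2 / n] of the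
    small-ball estimate at [t = n^(- al)]. *)
Lemma deviation_bound (p u s B al pu pl : R) : 0 < s -> n%:R^-1 <= p -> p <= 1 ->
  (1 + 2 * al) * ln n%:R + u <= 2 * (Z + B) ->
  2 * (Z - B) <= ln s - (1 + 2 * al) * ln n%:R ->
  21 * expR ((1 - p) * L + moment_exponent n N c p - p * u - 2 * al * p * ln n%:R) <= pu ->
  (P (sample (flat X) @^-1`
    [set x | (mean_square (\col_i (i == Ordinal n0)%:R) x < s)%R]) <= pl%:E)%E ->
  ((1 - pu - 2 * (n%:R `^ (- al) + pl))%:E <= P [set w | (log_s1_dev X w <= B%:E)%E])%E.
Proof.
move=> s0 np p1 hu hl hpu hpl.
have t0 : 0 < n%:R `^ (- al) :> R by exact: powR_gt0.
apply: (probability_log_s1_dev n0 (u := expR ((1 + 2 * al) * ln n%:R + u))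
  (l := (n%:R `^ (- al)) ^+ 2 * s / n%:R)).
- by rewrite ler_expR.
- rewrite powR_n nE -expRM_natl -expRN -{1}[s]lnK ?posrE// -!expRD ler_expR.
  by apply: (le_trans hl); rewrite expRK; lra.
- apply: le_trans (s1_upper_tail indepX lawX n0 m0 bounds np p1 (expR_gt0 _)) _.
  rewrite lee_fin; apply: le_trans hpu.
  rewrite -/(moment_exponent n N c p) -mulrA ler_pM2l// powR_n.
  rewrite {1}mE -!expRM -expRN -!expRD ler_expR.
  by rewrite le_eqVlt; apply/orP; left; apply/eqP; ring.
- apply: le_trans (s1_lower_tail indepX lawX n0 t0 s0) _.
  by rewrite EFinM; apply: lee_wpmul2l_EFin => //; rewrite [leRHS]EFinD; exact: leeD.
Qed.

Lemma first_regime (e al B : R) : 0 < e -> e < 1 -> 0 < al -> Z = 0 ->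
  e / (1 - e) + c * (b ^+ 2 * L / n%:R) + (1 + 2 * al) * ln n%:R / 2 <= B ->
  ((1 - 21 * n%:R `^ (- al) - 2 * (n%:R `^ (- al) +
     e ^- 2 * expR (2 * c * (b ^+ 2 * L)) / m%:R))%:E <=
   P [set w | (log_s1_dev X w <= B%:E)%E])%E.
Proof.
move=> e0 e1 al0 Z0 hB.
have n1 : n%:R^-1 <= 1 :> R by rewrite invf_le1// ler1n.
have ln0 : 0 <= ln n%:R :> R by rewrite ln_ge0// ler1n.
pose h : R := N%:R / n%:R; have h0 : 0 <= h by rewrite divr_ge0.
have hn0 : 0 <= c * h / n%:R by rewrite divr_ge0// mulr_ge0// ltW.
have hE : c * N%:R / n%:R ^+ 2 = c * h / n%:R by rewrite /h; field; rewrite gt_eqF.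
rewrite beta_sqr -/h in hB *.
have f0 : 0 < 1 - e by rewrite subr_gt0.
have e'0 : 0 <= e / (1 - e) by rewrite divr_ge0 ?ltW.
have th1 := nsq_unit0 R n0.
pose s := (1 - e) * expR (- (c * N%:R / n%:R ^+ 2)).
have s0 : 0 < s by rewrite mulr_gt0 ?expR_gt0.
(* [- ln (1 - e) = ln (1 + e / (1 - e)) <= e / (1 - e)], the origin of the first error term of the
   statement. *)
have lns : - (e / (1 - e)) - c * h / n%:R <= ln s.
  rewrite lnM ?posrE ?expR_gt0// expRK hE lerB// lerNl -lnV ?posrE//.
  have E : (1 - e)^-1 = 1 + e / (1 - e) by field; rewrite gt_eqF.
  by rewrite {1}E le_ln1Dx//; lra.
apply: (@deviation_bound 1 (c * h / n%:R) s) => //.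
- by rewrite Z0 add0r; lra.
- by rewrite Z0 sub0r; lra.
- rewrite subrr mul0r add0r powR_n ler_pM2l// ler_expR /moment_exponent subrr.
  have -> : N%:R * (- (1 * 0 / n%:R) + c * 1 / n%:R ^+ 2) = c * h / n%:R.
    by rewrite -hE; ring.
  by have := mulr_ge0 (ltW al0) ln0; lra.
- apply: le_trans (mean_square_lower_tail th1 indepX lawX n0 m0 bounds e0 e1) _.
  rewrite lee_fin; apply: ler_wpM2r; first by rewrite invr_ge0 ltW.
  apply: ler_wpM2l; first by rewrite invr_ge0 exprn_ge0 ?ltW.
  rewrite ler_expR hE -mulrA -/h.
  have : c * h / n%:R <= c * h.
    by rewrite ler_piMr// mulr_ge0// ltW.
  by lra.
Qed.

(** [ZE] and [pZE] are two forms of [Z] at the optimal [p]: the level that [S] reaches from below,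
    and the exponent of the moment bound divided by [p]. Their agreement makes the two tails meet.
    The bound [2 / n <= p] leaves room for [q - dl >= 1 / n]. *)
Lemma second_regime (p al B : R) : 0 < al ->
  let w := L `^ 4^-1 in
  50 <= w -> 0 < b -> 0 < p -> p <= 1 -> 2 / n%:R <= p ->
  (p * b) ^+ 2 <= 2 -> 2 <= p * b * w ^+ 2 -> c * b * w ^+ 2 / n%:R <= 2^-1 ->
  2 * Z = - ((1 - p) ^+ 2 * (b ^+ 2 * L / 2)) ->
  (1 - p) * L - p * (1 - p) * (b ^+ 2 * L / 2) = p * (2 * Z) ->
  11 * (b * w ^+ 3) + (1 + 2 * al) * ln n%:R / 2 <= B ->
  ((1 - 21 * expR (- (p * b * w ^+ 3) - 2 * al * p * ln n%:R) -
      2 * (n%:R `^ (- al) + 8 * expR (- (2 * w ^+ 3))))%:E <=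
   P [set w | (log_s1_dev X w <= B%:E)%E])%E.
Proof.
move=> al0 w w50 b0 p0 p1 np pb2 pbw cbz ZE pZE hB.
have L0 := ln_nat_gt0.
have w4 : w ^+ 4 = L by rewrite /w -powR_mulrn ?powR_ge0// -powRrM mulVf// powRr1// ltW.
have w0 : 0 < w by rewrite powR_gt0.
pose z : R := n%:R^-1; have z0 : 0 < z by rewrite invr_gt0.
pose h : R := b ^+ 2 * w ^+ 4 / 2.
have hE : N%:R = h * n%:R.
  by rewrite /h w4 beta_sqr; field; rewrite gt_eqF.
have expoE c' x : moment_exponent n N c' x = - (x * (1 - x)) * h + c' * x * h * z.
  by rewrite /moment_exponent hE /z; field; rewrite gt_eqF.
rewrite -w4 -/h in ZE pZE.
pose v := w^-1; have v0 : 0 < v by rewrite invr_gt0.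
have v50 : v <= 50^-1 by rewrite lef_pV2 ?posrE.
pose q := p * (1 - 8 * v); pose dl := p * v.
pose a := 3 * b * w ^+ 3; pose y := (2 * q - 1) * h - a; pose y' := (2 * q - 1) * h + a.
have t1 := truncation_low w50 b0 p0 pb2 pbw c0 z0 cbz; rewrite -/h -/v -/q -/dl -/a -/y in t1.
have t2 := truncation_high w50 b0 p0 pb2 pbw c0 z0 cbz; rewrite -/h -/v -/q -/dl -/a -/y' in t2.
have t3 := count_exponent w50 b0 p0 pb2 c0 z0 cbz; rewrite -/h -/v -/q -/a -/y' in t3.
have t4 := level_exponent w50 b0 p0 p1 pb2 pbw c0 z0 cbz; rewrite -/h -/v -/q -/a -/y' -/y in t4.
pose M := - (q * (1 - q)) * h - c * q * h * z.
(* The factor [1 / 2] is the part of the moment that survives the truncation. *)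
pose p' := expR (- (q * y') + M) / 2.
have p'0 : 0 < p' by rewrite divr_gt0 ?expR_gt0.
have dl0 : 0 < dl by exact: mulr_gt0.
have pv := ler_wpM2l (ltW p0) v50.
have e2 (t : R) := expR_sub2 t.
have tail : (P (sample (flat X) @^-1` [set x |
    (mean_square (\col_i (i == Ordinal n0)%:R) x < expR y * p' / 2)%R]) <=
    (4 / (m%:R * p'))%:E)%E.
  apply: (mean_square_count_tail (nsq_unit0 R n0) indepX lawX n0 m0 bounds
    (q := q) (dl := dl) (y' := y')) => //.
  - by rewrite /q /dl; have := pv; rewrite /v in v0 *; lra.
  - by rewrite /q /dl; move: np pv; rewrite mulrC -/z; lra.
  - by rewrite /q /dl; have := mulr_gt0 p0 v0; lra.
  have -> : p' * expR (q * y') = expR M / 2.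
    by rewrite /p' mulrAC -expRD; congr (expR _ / _); ring.
  rewrite -!expRD !expoE.
  have -> : - (q * (1 - q)) * h + - c * q * h * z = M by rewrite /M; ring.
  have l1 : expR (dl * y + (- ((q - dl) * (1 - (q - dl))) * h + c * (q - dl) * h * z)) <=
    expR (M - 2) by rewrite ler_expR.
  have l2 : expR (- (dl * y') + (- ((q + dl) * (1 - (q + dl))) * h + c * (q + dl) * h * z)) <=
    expR (M - 2) by rewrite ler_expR.
  by have := e2 M; lra.
have bw0 : 0 <= b * w ^+ 3 by rewrite mulr_ge0 ?exprn_ge0 ?ltW.
have s0 : 0 < expR y * p' / 2 by rewrite divr_gt0// mulr_gt0 ?expR_gt0.
have lns : 2 * Z - 22 * (b * w ^+ 3) <= ln (expR y * p' / 2).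
  have -> : expR y * p' / 2 = expR (y - q * y' + M) / 4.
    by rewrite /p' !expRD; field.
  rewrite -ler_expR lnK; last by rewrite posrE divr_gt0 ?expR_gt0.
  rewrite ler_pdivlMr// mulrC; apply: le_trans (e2 _).
  rewrite ler_pM2l// ler_expR ZE /M.
  by move: t4; lra.
(* The margin [2 b w^3], multiplied by [p], pays for the moment error and still leaves [p b w^3] in
   the exponent of the upper tail. *)
apply: (@deviation_bound p (2 * Z + 2 * (b * w ^+ 3)) (expR y * p' / 2)) => //.
- by apply: le_trans np; rewrite ler_peMl ?ler1n//; exact: ltW.
- by move: hB; lra.
- by move: hB lns; lra.
- rewrite ler_pM2l// ler_expR expoE -w4.
  have -> : (1 - p) * w ^+ 4 + (- (p * (1 - p)) * h + c * p * h * z) -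
      p * (2 * Z + 2 * (b * w ^+ 3)) - 2 * al * p * ln n%:R =
    ((1 - p) * w ^+ 4 - p * (1 - p) * h - p * (2 * Z)) + c * p * h * z -
      2 * (p * b * w ^+ 3) - 2 * al * p * ln n%:R by ring.
  rewrite pZE subrr add0r lerD2r.
  have -> : c * p * h * z = p * b * w ^+ 2 / 2 * (c * b * w ^+ 2 / n%:R).
    by rewrite /h /z; field; rewrite gt_eqF.
  have g0 : 0 <= p * b * w ^+ 2 / 2 by move: pbw; lra.
  have h1 := ler_wpM2l g0 cbz.
  have h2 : p * b * w ^+ 2 * 50 <= p * b * w ^+ 3.
    rewrite (exprSr w 2) mulrA; apply: ler_wpM2l => //.
    by move: pbw; lra.
  by move: h1 h2 pbw; lra.
- apply: (le_trans tail); rewrite lee_fin.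
  have -> : m%:R * p' = expR (w ^+ 4 + (- (q * y') + M)) / 2.
    by rewrite expRD w4 -mE mulrA.
  rewrite invf_div mulrA ler_pdivrMr ?expR_gt0// -mulrA -expRD.
  suff : 1 <= expR (- (2 * w ^+ 3) + (w ^+ 4 + (- (q * y') + M))) by lra.
  rewrite -[leLHS]expR0 ler_expR /M; move: t3; lra.
Qed.

End regimes.

Section bounds.
Context (R : realType) (n N m : nat).
Context (d : measure_display) (T : measurableType d) (P : probability T R).
Variable X : 'I_m -> 'I_N.+1 -> 'I_n -> 'I_n -> {RV P >-> R}.
Hypothesis iidX : iid_gaussian_entries X.
Hypothesis n2 : (2 <= n)%N.
Hypothesis m1 : (1 < m)%N.
Variable c : R.
Hypothesis c0 : 0 < c.
Hypothesis bounds : power_moment_bounds c n.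
Variables e al : R.
Hypothesis e0 : 0 < e.
Hypothesis e1 : e < 1.
Hypothesis al0 : 0 < al.

Local Notation L := (ln m%:R : R).
Local Notation b := (beta R n N.+1 m).

Let n0 : (0 < n)%N. Proof. exact: leq_trans n2. Qed.
Let nR0 : 0 < n%:R :> R. Proof. by rewrite ltr0n. Qed.
Let mR0 : 0 < m%:R :> R. Proof. by rewrite ltr0n; exact: ltnW. Qed.
Let L0 : 0 < L. Proof. exact: ln_nat_gt0. Qed.
Let ln0 : 0 <= ln n%:R :> R. Proof. by rewrite ln_ge0// ler1n. Qed.

Let f0 : 0 <= e / (1 - e).
Proof. by rewrite divr_ge0 ?subr_ge0 ?ltW. Qed.

Let expR_n0 : 0 <= expR (- (2^-1 * n%:R * e ^+ 2)) :> R.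
Proof. exact: expR_ge0. Qed.

Let powR_n (x : R) : n%:R `^ x = expR (x * ln n%:R).
Proof. by rewrite /powR gt_eqF. Qed.

(** With [8 <= L] and [16 c b^2 <= 1], a factor [2] and the second moment cost at most [L / 4] and
    [L / 8] in the exponent, which leaves more than [L / 2]. In [23 = 21 + 2] the Markov and
    small-ball constants are added; in [11 + c] the summand [c] is for this regime and [11], half of
    [22], for the second. *)
Lemma first_bound : b ^+ 2 <= 1 -> 16 * c * b ^+ 2 <= 1 -> 8 <= L ->
  ((1 - e ^- 2 * expR (- (2^-1 * L)) - 2 * expR (- (2^-1 * n%:R * e ^+ 2)) -
      23 * n%:R `^ (- al))%:E <=
   P [set w | (log_s1_dev X w <= ((11 + c) * (e / (1 - e) + b ^+ 2 * L / n%:R) +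
       (1 + 2 * al) * ln n%:R / 2)%:E)%E])%E.
Proof.
move=> b1 cb L8.
have bL : 0 <= b ^+ 2 * L / n%:R by rewrite divr_ge0// mulr_ge0 ?sqr_ge0// ltW.
have Z0 : Zlim R n N.+1 m = 0.
  rewrite /Zlim ifT// -ler_sqr ?nnegrE ?sqrtr_ge0//; last by rewrite divr_ge0 ?sqrtr_ge0.
  by rewrite sqr_sqrtr//; apply: le_trans b1 _; rewrite ler1n.
have := @first_regime R n N m _ _ _ X iidX n0 m1 c c0 bounds e al
  ((11 + c) * (e / (1 - e) + b ^+ 2 * L / n%:R) + (1 + 2 * al) * ln n%:R / 2) e0 e1 al0 Z0.
move=> h.
apply: le_trans (h _).
  rewrite lee_fin.
  have e20 : 0 < e ^- 2 by rewrite invr_gt0 exprn_gt0.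
  suff : 2 * (expR (2 * c * (b ^+ 2 * L)) / m%:R) <= expR (- (2^-1 * L)).
    move=> /(ler_wpM2l (ltW e20)); have := expR_n0; lra.
  have mE : m%:R = expR L :> R by rewrite lnK.
  rewrite {2}mE -expRN -expRD.
  have x2 : 2 <= expR (L / 4) by have := expR_ge1Dx (L / 4); lra.
  have cL := ler_wpM2r (ltW L0) cb.
  apply: (@le_trans _ _ (expR (L / 4) * expR (2 * c * (b ^+ 2 * L) - L))).
    by rewrite ler_wpM2r ?expR_ge0.
  by rewrite -expRD ler_expR; lra.
have := mulr_ge0 (ltW c0) f0; have := f0; have := mulr_ge0 (ltW c0) bL; have := bL.
lra.
Qed.

Lemma second_bound (D : R) : 0 < D -> D <= 1 ->
  let w := L `^ 4^-1 in
  50 <= w -> 2 <= D * w ^+ 2 -> D <= b -> 8 * (c ^+ 2 + 1) * N.+1%:R <= n%:R ^+ 3 ->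
  ((1 - (1 + e ^- 2) * expR (- (2^-1 * L `^ (3 / 4))) -
      2 * expR (- (2^-1 * n%:R * e ^+ 2)) - 23 * n%:R `^ (- al / 2))%:E <=
   P [set w | ((b ^+ 2 * L)^-1%:E * log_s1_dev X w <=
     ((11 + c) * (e / ((1 - e) * b * L) + (b * L `^ 4^-1)^-1) +
      (1 + 2 * al) * ln n%:R / (2 * b ^+ 2 * L))%:E)%E])%E.
Proof.
move=> D0 D1 w w50 Dw Db hN.
have b0 : 0 < b by exact: lt_le_trans Db.
have w0 : 0 < w by apply: lt_le_trans w50; rewrite ltr0n.
have w4 : w ^+ 4 = L by rewrite /w -powR_mulrn ?powR_ge0// -powRrM mulVf// powRr1// ltW.
have w3 : L `^ (3 / 4) = w ^+ 3 by rewrite /w -powR_mulrn ?powR_ge0// -powRrM mulrC.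
have s2 : Num.sqrt 2 ^+ 2 = 2 :> R by rewrite sqr_sqrtr.
have s20 : 0 <= Num.sqrt 2 :> R by exact: sqrtr_ge0.
have s21 : 1 <= Num.sqrt 2 :> R by rewrite -[leLHS]sqrtr1 ler_wsqrtr// ler1n.
have bL0 : 0 < b ^+ 2 * L by rewrite mulr_gt0 ?exprn_gt0.
have bLN : b ^+ 2 * L * n%:R = 2 * N%:R.
  by rewrite beta_sqr//; field; rewrite gt_eqF.
have bLn : 4 * (c ^+ 2 + 1) * (b ^+ 2 * L) <= n%:R ^+ 2.
  rewrite -(ler_pM2r nR0) -(mulrA _ (b ^+ 2 * L)) bLN -exprSr; apply: le_trans hN.
  have -> : 4 * (c ^+ 2 + 1) * (2 * N%:R) = 8 * (c ^+ 2 + 1) * N%:R by ring.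
  by rewrite ler_wpM2l ?ler_nat// mulr_ge0// addr_ge0 ?sqr_ge0.
have L1 : 1 <= L by rewrite -w4 exprn_ege1//; apply: le_trans w50; rewrite ler1n.
have cbz : c * b * w ^+ 2 / n%:R <= 2^-1.
  rewrite ler_pdivrMr// -ler_sqr ?nnegrE; first last.
  - by rewrite mulr_ge0.
  - by apply: mulr_ge0; [apply: mulr_ge0; exact: ltW|exact: sqr_ge0].
  have -> : (c * b * w ^+ 2) ^+ 2 = c ^+ 2 * (b ^+ 2 * L) by rewrite -w4; ring.
  have -> : (2^-1 * n%:R) ^+ 2 = 4^-1 * n%:R ^+ 2 :> R by field.
  by have := ltW bL0; lra.
have bn : 2 * b <= n%:R.
  rewrite -ler_sqr ?nnegrE ?mulr_ge0 ?(ltW b0)//.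
  have h1 : b ^+ 2 <= b ^+ 2 * L by rewrite ler_peMr ?sqr_ge0.
  have h2 : 0 <= c ^+ 2 * (b ^+ 2 * L) by rewrite mulr_ge0 ?sqr_ge0// ltW.
  have -> : (2 * b) ^+ 2 = 4 * b ^+ 2 by ring.
  by lra.
pose p := if b <= Num.sqrt 2 then 1 else Num.sqrt 2 / b.
have [p0 p1 np pb2 Dpb] : [/\ 0 < p, p <= 1, 2 / n%:R <= p, (p * b) ^+ 2 <= 2 & D <= p * b].
  rewrite /p; case: (leP b (Num.sqrt 2)) => bs.
    split; rewrite ?ltr01 ?mul1r//.
      by rewrite ler_pdivrMr// mul1r ler_nat.
    by rewrite -[leRHS]s2 lerXn2r ?nnegrE//; exact: ltW.
  rewrite divfK ?gt_eqF//; split => //.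
  - by apply: divr_gt0 => //; exact: lt_le_trans s21.
  - by rewrite ler_pdivrMr// mul1r ltW.
  - rewrite ler_pdivrMr// mulrAC ler_pdivlMr//.
    by apply: (@le_trans _ _ (1 * n%:R)); [rewrite mul1r|rewrite ler_wpM2r].
  - by rewrite s2.
  - by apply: le_trans s21.
have ZE : 2 * Zlim R n N.+1 m = - ((1 - p) ^+ 2 * (b ^+ 2 * L / 2)).
  rewrite /Zlim /p; case: (leP b (Num.sqrt 2)) => bs.
    by rewrite subrr expr0n/= mul0r oppr0 mulr0.
  by field; rewrite gt_eqF.
have pZE : (1 - p) * L - p * (1 - p) * (b ^+ 2 * L / 2) = p * (2 * Zlim R n N.+1 m).
  rewrite ZE /p; case: (leP b (Num.sqrt 2)) => bs; first by rewrite subrr; ring.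
  have -> : (1 - Num.sqrt 2 / b) * L =
      (1 - Num.sqrt 2 / b) * L * (Num.sqrt 2 ^+ 2 / 2) by rewrite s2 divff// mulr1.
  by field; rewrite gt_eqF.
have pbw : 2 <= p * b * w ^+ 2.
  by apply: (le_trans Dw); rewrite ler_wpM2r ?exprn_ge0// ltW.
pose B := b ^+ 2 * L * ((11 + c) * (e / ((1 - e) * b * L) + (b * w)^-1) +
      (1 + 2 * al) * ln n%:R / (2 * b ^+ 2 * L)).
have BE : B = (11 + c) * (e / (1 - e) * b + b * w ^+ 3) + (1 + 2 * al) * ln n%:R / 2.
  rewrite /B -w4; field; rewrite !gt_eqF ?subr_gt0//.
have bw30 : 0 <= b * w ^+ 3 by rewrite mulr_ge0 ?exprn_ge0 ?ltW.
have hB : 11 * (b * w ^+ 3) + (1 + 2 * al) * ln n%:R / 2 <= B.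
  rewrite BE; have := mulr_ge0 (ltW c0) bw30.
  have fb := mulr_ge0 f0 (ltW b0); have := mulr_ge0 (ltW c0) fb.
  by move: fb; lra.
have := @second_regime R n N m _ _ _ X iidX n0 m1 c c0 bounds p al B al0 w50 b0 p0 p1 np
  pb2 pbw cbz ZE pZE hB.
rewrite -/w => h.
have -> : [set x | ((b ^+ 2 * L)^-1%:E * log_s1_dev X x <=
     ((11 + c) * (e / ((1 - e) * b * L) + (b * w)^-1) +
      (1 + 2 * al) * ln n%:R / (2 * b ^+ 2 * L))%:E)%E] =
    [set x | (log_s1_dev X x <= B%:E)%E].
  apply/seteqP; split => x /=; rewrite /B EFinM lee_pdivrMl//.
apply: le_trans h; rewrite lee_fin w3 !powR_n.
have e20 : 0 < e ^- 2 by rewrite invr_gt0 exprn_gt0.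
have w2 : 2 <= w ^+ 2.
  by apply: (le_trans Dw); rewrite ler_piMl ?exprn_ge0// ltW.
have w3l : 100 <= w ^+ 3.
  have -> : 100 = 2 * 50 :> R by ring.
  by rewrite (exprSr w 2); apply: ler_pM.
have i1 : expR (- al * ln n%:R) <= expR (- al / 2 * ln n%:R).
  by rewrite ler_expR; have := mulr_ge0 (ltW al0) ln0; lra.
(* [37 = 21 + 16] gathers the upper tail and the count tail; [w^3 >= 100] gives
   [exp (w^3 / 2) >= 51]. *)
have i2 : 37 * expR (- w ^+ 3) <= expR (- (2^-1 * w ^+ 3)).
  have -> : - (2^-1 * w ^+ 3) = w ^+ 3 / 2 + - w ^+ 3 by field.
  rewrite expRD; apply: ler_wpM2r; first exact: expR_ge0.
  by have := expR_ge1Dx (w ^+ 3 / 2); lra.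
have i3 : expR (- (2 * w ^+ 3)) <= expR (- w ^+ 3) by rewrite ler_expR; lra.
(* If [b <= sqrt 2] then [p = 1] and the power of [n] is small enough. Otherwise [p], and with it
   the decay in [n], may be small, but [p b = sqrt 2 >= 1] makes the other factor at most
   [exp (- w^3)]. *)
have i4 : 21 * expR (- (p * b * w ^+ 3) - 2 * al * p * ln n%:R) <=
    21 * expR (- w ^+ 3) + 21 * expR (- al / 2 * ln n%:R).
  rewrite -mulrDr ler_pM2l//.
  have E1 := expR_ge0 (- w ^+ 3); have E2 := expR_ge0 (- al / 2 * ln n%:R : R).
  have lal := mulr_ge0 (ltW al0) ln0.
  have plal := mulr_ge0 (ltW p0) lal.
  have [bs|bs] := leP b (Num.sqrt 2).
    have pE : p = 1 by rewrite /p bs.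
    apply: (@le_trans _ _ (expR (- al / 2 * ln n%:R))); last by lra.
    by rewrite ler_expR pE; lra.
  have pbE : p * b = Num.sqrt 2 by rewrite /p leNgt bs/= divfK// gt_eqF.
  apply: (@le_trans _ _ (expR (- w ^+ 3))); last by lra.
  rewrite ler_expR pbE.
  have w30 : 0 <= w ^+ 3 by lra.
  by have := ler_wpM2r w30 s21; lra.
have i5 := mulr_ge0 (ltW e20) (expR_ge0 (- (2^-1 * w ^+ 3))).
have := expR_n0.
lra.
Qed.

End bounds.

Theorem theorem2 (R : realType) :
  exists c C C' : R, [/\ 0 < c, 0 < C, 0 < C' &
  forall n N m : nat -> nat,
    n @ \oo --> \oo -> N @ \oo --> \oo -> m @ \oo --> \oo ->
    let beta_ (k : nat) : R := beta R (n k) (N k) (m k) in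
    (* (i) *)
    (beta_ =o_\oo (fun=> 1 : R) ->
     \forall k \near \oo, forall eps alpha : R,
       0 < eps -> eps < 1 -> 0 < alpha ->
       forall (d : measure_display) (T : measurableType d)
         (P : probability T R)
         (X : 'I_(m k) -> 'I_(N k) -> 'I_(n k) -> 'I_(n k) -> {RV P >-> R}),
       iid_gaussian_entries X ->
       let b := beta_ k in
       let n_ : R := (n k)%:R in
       let logm := ln (m k)%:R : R in
       ((1 - eps ^- 2 * expR (- (c * logm))
           - 2 * expR (- (c * n_ * eps ^+ 2)) - C' * n_ `^ (- alpha))%:E
        <= P [set w | (log_s1_dev X w <=
             (C * (eps / (1 - eps) + b ^+ 2 * logm / n_)
              + (1 + 2 * alpha) * ln n_ / 2)%:E)%E])%E)
    /\
    (* (ii) *)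
    (beta_ =Omega_\oo (fun=> 1 : R) ->
     (fun k => ln (m k)%:R : R) =o_\oo (fun k => (N k)%:R `^ 3^-1 : R) ->
     (fun k => (N k)%:R : R) =o_\oo (fun k => (n k)%:R ^+ 3 : R) ->
     \forall k \near \oo, forall eps alpha : R,
       0 < eps -> eps < 1 -> 0 < alpha ->
       forall (d : measure_display) (T : measurableType d)
         (P : probability T R)
         (X : 'I_(m k) -> 'I_(N k) -> 'I_(n k) -> 'I_(n k) -> {RV P >-> R}),
       iid_gaussian_entries X ->
       let b := beta_ k in
       let n_ : R := (n k)%:R in
       let logm := ln (m k)%:R : R in
       ((1 - (1 + eps ^- 2) * expR (- (c * logm `^ (3 / 4)))
           - 2 * expR (- (c * n_ * eps ^+ 2)) - C' * n_ `^ (- alpha / 2))%:E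
        <= P [set w | ((b ^+ 2 * logm)^-1%:E * log_s1_dev X w <=
             (C * (eps / ((1 - eps) * b * logm) + (b * logm `^ 4^-1)^-1)
              + (1 + 2 * alpha) * ln n_ / (2 * b ^+ 2 * logm))%:E)%E])%E)].
Proof.
have [c c0 bounds] := power_moments R.
exists 2^-1, (11 + c), 23; split; rewrite ?invr_gt0// ?addr_gt0// => n N m ninf Ninf minf beta_.
have log_ge (A : R) : \forall k \near \oo, A <= ln (m k)%:R.
  have : \forall k \near \oo, expR A <= (m k)%:R by exact: minf _ (nbhs_infty_ger (expR A)).
  apply: filterS => k Ak; rewrite -ler_expR lnK// posrE.
  exact: lt_le_trans (expR_gt0 A) Ak.
have n2 : \forall k \near \oo, (2 <= n k)%N by exact: ninf _ (nbhs_infty_ge 2).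
have N1 : \forall k \near \oo, (1 <= N k)%N by exact: Ninf _ (nbhs_infty_ge 1).
have m2 : \forall k \near \oo, (1 < m k)%N by exact: minf _ (nbhs_infty_ge 2).
have nb : \forall k \near \oo, power_moment_bounds c (n k) by exact: ninf _ bounds.
split.
- move=> /eqoP small.
  (* As [D <= 1], [|b| <= D] gives [b^2 <= D], hence both [b^2 <= 1] and [16 c b^2 <= 1]. *)
  pose D : R := (16 * c + 1)^-1.
  have D0 : 0 < D by rewrite invr_gt0 addr_gt0 ?mulr_gt0.
  have D1 : D <= 1 by rewrite invf_le1 ?lerDr ?addr_gt0 ?mulr_ge0 ?mulr_gt0// ltW.
  have betaD : \forall k \near \oo, `|beta_ k| <= D.
    by apply: filterS (small D D0) => k; rewrite normr1 mulr1.
  have L8 := log_ge 8.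
  near=> k; move=> e al e0 e1 al0 d T P X iidX; set b := beta_ k.
  have bD : `|b| <= D by rewrite /b; near: k.
  have b2D : b ^+ 2 <= D.
    rewrite -real_normK ?num_real// expr2.
    by apply: le_trans (ler_piMr _ (le_trans bD D1)) bD.
  have hb : 16 * c * b ^+ 2 <= 1.
    have : (16 * c + 1) * b ^+ 2 <= 1.
      by rewrite -ler_pdivlMl ?addr_gt0 ?mulr_gt0// mulr1.
    by have := sqr_ge0 b; lra.
  have b21 : b ^+ 2 <= 1 by exact: le_trans b2D D1.
  have : 8 <= ln (m k)%:R :> R by near: k.
  have : (1 <= N k)%N by near: k.
  have : (2 <= n k)%N by near: k.
  have : (1 < m k)%N by near: k.
  have : power_moment_bounds c (n k) by near: k.
  move: X iidX b21 hb; rewrite /b /beta_.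
  (* The bounds are stated for [N'.+1] factors, the last one being singled out. *)
  case: (N k) => [//|N'] X iidX b21 hb nbk mk nk _ Lk.
  exact: (@first_bound R (n k) N' (m k)).
- rewrite eqOmegaE qualifE => /asboolP[D' D'0 big] _ /eqoP small.
  pose D : R := Num.min D' 1.
  have D0 : 0 < D by rewrite lt_min D'0 ltr01.
  have D1 : D <= 1 by rewrite ge_min lexx orbT.
  have betaD : \forall k \near \oo, D <= `|beta_ k|.
    apply: filterS big => k; rewrite normr1 mulr1; apply: le_trans.
    by rewrite ge_min lexx.
  pose F : R := (8 * (c ^+ 2 + 1))^-1.
  have F0 : 0 < F by rewrite invr_gt0 mulr_gt0// ltr_wpDl ?sqr_ge0.
  have hN : \forall k \near \oo, 8 * (c ^+ 2 + 1) * (N k)%:R <= (n k)%:R ^+ 3 :> R.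
    apply: filterS (small F F0) => k; rewrite normr_nat ger0_norm ?exprn_ge0//.
    by rewrite /F ler_pdivlMl// -invr_gt0.
  (* [W] is a threshold for the fourth root [w] of [ln m]: from [w >= W] follow [w >= 50] and
     [D w^2 >= D w >= 2]. *)
  have [W [W50 WD]] : exists W : R, 50 <= W /\ 2 <= D * W.
    exists (50 + 2 / D); split; first by rewrite lerDl divr_ge0// ltW.
    by rewrite mulrDr mulrCA divff ?gt_eqF// mulr1 lerDr mulr_ge0// ltW.
  have W1 : 1 <= W by apply: le_trans W50; rewrite ler1n.
  have LW := log_ge (W ^+ 4).
  near=> k; move=> e al e0 e1 al0 d T P X iidX; set b := beta_ k.
  have bD : D <= b.
    by rewrite /b -[beta_ k]ger0_norm; [near: k|rewrite divr_ge0].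
  have LWk : W ^+ 4 <= ln (m k)%:R :> R by near: k.
  have L0 : 0 <= ln (m k)%:R :> R by apply: le_trans LWk; rewrite exprn_ge0// (le_trans _ W1).
  have Ww : W <= ln (m k)%:R `^ 4^-1.
    rewrite -(@ler_pXn2r _ 4)// ?nnegrE ?powR_ge0 ?(le_trans _ W1)//.
    by rewrite -[leRHS]powR_mulrn ?powR_ge0// -powRrM mulVf// powRr1.
  have w50 := le_trans W50 Ww.
  have Dw : 2 <= D * (ln (m k)%:R `^ 4^-1) ^+ 2.
    apply: (le_trans WD); rewrite ler_pM2l//; apply: (le_trans Ww).
    by rewrite expr2 ler_peMr ?powR_ge0//; exact: le_trans Ww.
  have : 8 * (c ^+ 2 + 1) * (N k)%:R <= (n k)%:R ^+ 3 :> R by near: k.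
  have : (1 <= N k)%N by near: k.
  have : (2 <= n k)%N by near: k.
  have : (1 < m k)%N by near: k.
  have : power_moment_bounds c (n k) by near: k.
  move: X iidX bD; rewrite /b /beta_.
  case: (N k) => [//|N'] X iidX bD nbk mk nk _ hNk.
  have h := second_bound iidX nk mk c0 nbk e0 e1 al0 D0 D1 w50 Dw bD hNk.
  exact: h.
Unshelve. all: by end_near.
Qed.
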